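(* $\mathrm{RCA}_0^*$ proves $\ell\text{-}\mathrm{ADS}^{\mathrm{sq}} \leftrightarrow \mathrm{ADS}$, and $\mathrm{WKL}_0^*$ proves $\ell\text{-}\mathrm{CRT}^2_2 \leftrightarrow \mathrm{CRT}^2_2$.
   Context: $\mathrm{RCA}_0^*$ is $\mathrm{RCA}_0$ with $\Sigma^0_1$-induction replaced by $\Delta^0_0$-induction plus the axiom $\exp$; $\mathrm{WKL}_0^*$ is $\mathrm{RCA}_0^*$ plus Weak König's Lemma. A set is unbounded if it contains elements above every number; it has cardinality $\mathbb{N}$ if for every $n$ it contains a finite subset with $n$ elements. $\mathrm{ADS}$: every linear order $(\mathbb{N},\preceq)$ has an unbounded $S$ such that either for all $x,y\in S$, $x\le y\iff x\preceq y$, or for all $x,y\in S$, $x\le y\iff x\succeq y$. $\ell\text{-}\mathrm{ADS}^{\mathrm{sq}}$: for every linear order $(\mathbb{N},\preceq)$ there is a sequence $(s_i)_{i\in\mathbb{N}}$ (a function with domain $\mathbb{N}$) that is either strictly $\preceq$-increasing or strictly $\preceq$-decreasing. $\mathrm{CRT}^2_2$: for every $c\colon[\mathbb{N}]^2\to2$ there is an unbounded $S$ such that for each $x\in S$ there is $y\in S$ with $c(x,z)=c(x,y)$ for all $z\in S$, $z\ge y$. $\ell\text{-}\mathrm{CRT}^2_2$: the same but requiring $S$ to have cardinality $\mathbb{N}$. *)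

(* Defs.v *)
From Stdlib Require Import List.
Import ListNotations.

(** * Second-order arithmetic: syntax

    De Bruijn indices, with two independent families of variables: number
    variables (bound by [AllN], [ExN]) and set variables (bound by [AllS],
    [ExS]).  There is no equality symbol between sets. *)

Inductive term : Type :=
| Var (n : nat)
| Zero
| One
| Add (s t : term)
| Mul (s t : term).

Inductive form : Type :=
| Eq (s t : term)
| Lt (s t : term)
| In (t : term) (X : nat)
| Bot
| Imp (p q : form)
| And (p q : form)
| Or (p q : form)
| AllN (p : form)
| ExN (p : form)
| AllS (p : form)
| ExS (p : form).

Definition Neg (p : form) : form := Imp p Bot.
Definition Iff (p q : form) : form := And (Imp p q) (Imp q p).

Fixpoint subst_term (sg : nat -> term) (t : term) : term :=
  match t with
  | Var n => sg n
  | Zero => Zero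
  | One => One
  | Add s t => Add (subst_term sg s) (subst_term sg t)
  | Mul s t => Mul (subst_term sg s) (subst_term sg t)
  end.

Definition scons {A : Type} (a : A) (f : nat -> A) (n : nat) : A :=
  match n with 0 => a | S k => f k end.

Definition lift_term : term -> term := subst_term (fun n => Var (S n)).
Definition up_num (sg : nat -> term) : nat -> term :=
  scons (Var 0) (fun n => lift_term (sg n)).
Definition up_set (rh : nat -> nat) : nat -> nat :=
  scons 0 (fun n => S (rh n)).

(** Set variables are the only set terms, so they are merely renamed. *)
Fixpoint subst (sg : nat -> term) (rh : nat -> nat) (p : form) : form :=
  match p with
  | Eq s t => Eq (subst_term sg s) (subst_term sg t)
  | Lt s t => Lt (subst_term sg s) (subst_term sg t)
  | In t X => In (subst_term sg t) (rh X)
  | Bot => Bot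
  | Imp p q => Imp (subst sg rh p) (subst sg rh q)
  | And p q => And (subst sg rh p) (subst sg rh q)
  | Or p q => Or (subst sg rh p) (subst sg rh q)
  | AllN p => AllN (subst (up_num sg) rh p)
  | ExN p => ExN (subst (up_num sg) rh p)
  | AllS p => AllS (subst sg (up_set rh) p)
  | ExS p => ExS (subst sg (up_set rh) p)
  end.

Definition lift_num : form -> form := subst (fun n => Var (S n)) (fun X => X).
Definition lift_set : form -> form := subst Var S.
Definition inst_num (p : form) (t : term) : form :=
  subst (scons t Var) (fun X => X) p.
Definition inst_set (p : form) (X : nat) : form :=
  subst Var (scons X (fun Y => Y)) p.

(** * Provability

    Classical two-sorted natural deduction from a theory [T].  The eigenvariable
    rules lift the local assumptions [G] but not [T]: free variables of a
    formula in [T] are parameters, i.e. [T] stands for the set of universal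
    closures of its members. *)

Definition theory : Type := form -> Prop.

Inductive derives (T : theory) : list form -> form -> Prop :=
| d_axiom G p : T p -> derives T G p
| d_hyp G p : List.In p G -> derives T G p
| d_contra G p : derives T (Neg p :: G) Bot -> derives T G p
| d_impI G p q : derives T (p :: G) q -> derives T G (Imp p q)
| d_impE G p q : derives T G (Imp p q) -> derives T G p -> derives T G q
| d_andI G p q : derives T G p -> derives T G q -> derives T G (And p q)
| d_andE1 G p q : derives T G (And p q) -> derives T G p
| d_andE2 G p q : derives T G (And p q) -> derives T G q
| d_orI1 G p q : derives T G p -> derives T G (Or p q)
| d_orI2 G p q : derives T G q -> derives T G (Or p q)
| d_orE G p q r : derives T G (Or p q) ->
    derives T (p :: G) r -> derives T (q :: G) r -> derives T G r
| d_allNI G p : derives T (map lift_num G) p -> derives T G (AllN p)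
| d_allNE G p t : derives T G (AllN p) -> derives T G (inst_num p t)
| d_exNI G p t : derives T G (inst_num p t) -> derives T G (ExN p)
| d_exNE G p r : derives T G (ExN p) ->
    derives T (p :: map lift_num G) (lift_num r) -> derives T G r
| d_allSI G p : derives T (map lift_set G) p -> derives T G (AllS p)
| d_allSE G p X : derives T G (AllS p) -> derives T G (inst_set p X)
| d_exSI G p X : derives T G (inst_set p X) -> derives T G (ExS p)
| d_exSE G p r : derives T G (ExS p) ->
    derives T (p :: map lift_set G) (lift_set r) -> derives T G r
| d_eqI G t : derives T G (Eq t t)
| d_eqE G p s t : derives T G (Eq s t) ->
    derives T G (inst_num p s) -> derives T G (inst_num p t).

Definition proves (T : theory) (p : form) : Prop := derives T [] p.

(** * Writing formulas with named variables

    An [fm] is a formula still to be placed under [d] number binders and [e] set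
    binders.  A bound variable is remembered by its level (the number of binders
    of its sort above its own); placed under [d'] binders, level [d] is the
    index [d' - S d]. *)

Definition tm : Type := nat -> term.
Definition sv : Type := nat -> nat.
Definition fm : Type := nat -> nat -> form.

Definition closed (p : fm) : form := p 0 0.

Definition tm_add (s t : tm) : tm := fun d => Add (s d) (t d).
Definition tm_mul (s t : tm) : tm := fun d => Mul (s d) (t d).

Definition fm_eq (s t : tm) : fm := fun d _ => Eq (s d) (t d).
Definition fm_lt (s t : tm) : fm := fun d _ => Lt (s d) (t d).
Definition fm_in (t : tm) (X : sv) : fm := fun d e => In (t d) (X e).
Definition fm_neg (p : fm) : fm := fun d e => Neg (p d e).
Definition fm_imp (p q : fm) : fm := fun d e => Imp (p d e) (q d e).
Definition fm_and (p q : fm) : fm := fun d e => And (p d e) (q d e).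
Definition fm_or (p q : fm) : fm := fun d e => Or (p d e) (q d e).
Definition fm_iff (p q : fm) : fm := fun d e => Iff (p d e) (q d e).

Definition fm_allN (p : tm -> fm) : fm :=
  fun d e => AllN (p (fun d' => Var (d' - S d)) (S d) e).
Definition fm_exN (p : tm -> fm) : fm :=
  fun d e => ExN (p (fun d' => Var (d' - S d)) (S d) e).
Definition fm_allS (p : sv -> fm) : fm :=
  fun d e => AllS (p (fun e' => e' - S e) d (S e)).
Definition fm_exS (p : sv -> fm) : fm :=
  fun d e => ExS (p (fun e' => e' - S e) d (S e)).

Declare Scope L2_scope.
Delimit Scope L2_scope with L2.

Notation "0" := (fun _ : nat => Zero) : L2_scope.
Notation "1" := (fun _ : nat => One) : L2_scope.
Notation "s + t" := (tm_add s t) : L2_scope.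
Notation "s * t" := (tm_mul s t) : L2_scope.
Notation "s = t" := (fm_eq s t) : L2_scope.
Notation "s < t" := (fm_lt s t) : L2_scope.
Notation "s <= t" := (fm_or (fm_lt s t) (fm_eq s t)) : L2_scope.
Notation "t \in X" := (fm_in t X) (at level 70) : L2_scope.
Notation "~ p" := (fm_neg p) : L2_scope.
Notation "p -> q" := (fm_imp p q) : L2_scope.
Notation "p /\ q" := (fm_and p q) : L2_scope.
Notation "p \/ q" := (fm_or p q) : L2_scope.
Notation "p <-> q" := (fm_iff p q) : L2_scope.
Notation "'allN' x .. y , p" := (fm_allN (fun x => .. (fm_allN (fun y => p%L2)) ..))
  (at level 200, x binder, y binder, right associativity) : L2_scope.
Notation "'exN' x .. y , p" := (fm_exN (fun x => .. (fm_exN (fun y => p%L2)) ..))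
  (at level 200, x binder, y binder, right associativity) : L2_scope.
Notation "'allS' X .. Y , p" := (fm_allS (fun X => .. (fm_allS (fun Y => p%L2)) ..))
  (at level 200, X binder, Y binder, right associativity) : L2_scope.
Notation "'exS' X .. Y , p" := (fm_exS (fun X => .. (fm_exS (fun Y => p%L2)) ..))
  (at level 200, X binder, Y binder, right associativity) : L2_scope.

Local Open Scope L2_scope.

(** * The theories *)

(** Formulas with bounded number quantifiers only; the bound is a term in which
    the quantified variable does not occur, and set parameters are allowed. *)
Inductive delta0 : form -> Prop :=
| delta0_Eq s t : delta0 (Eq s t)
| delta0_Lt s t : delta0 (Lt s t)
| delta0_In t X : delta0 (In t X)
| delta0_Bot : delta0 Bot
| delta0_Imp p q : delta0 p -> delta0 q -> delta0 (Imp p q)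
| delta0_And p q : delta0 p -> delta0 q -> delta0 (And p q)
| delta0_Or p q : delta0 p -> delta0 q -> delta0 (Or p q)
| delta0_AllN t p : delta0 p -> delta0 (AllN (Imp (Lt (Var 0) (lift_term t)) p))
| delta0_ExN t p : delta0 p -> delta0 (ExN (And (Lt (Var 0) (lift_term t)) p)).

Definition basic_axioms : list fm :=
  [ (allN m, ~ (m + 1 = 0));
    (allN m n, m + 1 = n + 1 -> m = n);
    (allN m, m + 0 = m);
    (allN m n, m + (n + 1) = (m + n) + 1);
    (allN m, m * 0 = 0);
    (allN m n, m * (n + 1) = m * n + m);
    (allN m, ~ (m < 0));
    (allN m n, m < n + 1 <-> m <= n) ].

(** Goedel's beta function: [u] is the remainder of [a] modulo [1 + (i+1)b]. *)
Definition beta (a b i u : tm) : fm :=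
  u < 1 + (i + 1) * b /\ exN q, a = q * (1 + (i + 1) * b) + u.

(** [y = 2^x], via a code of the sequence [2^0, ..., 2^x]. *)
Definition pow2 (x y : tm) : fm :=
  exN a b,
    beta a b 0 1
    /\ (allN i, i < x -> exN u, beta a b i u /\ beta a b (i + 1) (u + u))
    /\ beta a b x y.

Definition exp_axiom : fm := allN x, exN y, pow2 x y.

Definition succ_inst (p : form) : form :=
  subst (scons (Add (Var 0) One) (fun n => Var (S n))) (fun X => X) p.

Inductive RCA0s : theory :=
| RCA0s_basic p : List.In p basic_axioms -> RCA0s (closed p)
| RCA0s_exp : RCA0s (closed exp_axiom)
| RCA0s_induction p : delta0 p ->
    RCA0s (Imp (And (inst_num p Zero) (AllN (Imp p (succ_inst p)))) (AllN p))
| RCA0s_comprehension p q : delta0 p -> delta0 q ->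
    RCA0s (Imp (AllN (Iff (ExN p) (AllN q)))
               (ExS (AllN (Iff (In (Var 0) 0) (lift_set (ExN p)))))).

(** The pairing map [(x,y) |-> (x+y)^2 + x]. *)
Definition opair (x y : tm) : tm := (x + y) * (x + y) + x.

Definition function (F : sv) : fm :=
  (allN i, exN x, opair i x \in F)
  /\ (allN i x y, opair i x \in F /\ opair i y \in F -> x = y).

Definition unbounded (A : sv) : fm := allN n, exN x, x \in A /\ n < x.

(** The binary string s is coded by the number whose binary expansion is s with
    a leading 1 added: the empty string is [1], and [c] is extended by 0 and by
    1 to [c + c] and [c + c + 1].  The number 0 is no code. *)
Definition binary_tree (T : sv) : fm :=
  ~ (0 \in T)
  /\ allN c, 0 < c -> (c + c \in T \/ c + c + 1 \in T) -> c \in T.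

(** [G] maps [n] to the code of the string of the first [n] values of the
    characteristic function of [X]. *)
Definition initial_segments (X G : sv) : fm :=
  function G
  /\ opair 0 1 \in G
  /\ allN n c, opair n c \in G ->
       (n \in X -> opair (n + 1) (c + c + 1) \in G)
       /\ (~ (n \in X) -> opair (n + 1) (c + c) \in G).

Definition path (T X : sv) : fm :=
  exS G, initial_segments X G /\ allN n c, opair n c \in G -> c \in T.

Definition WKL : fm :=
  allS T, binary_tree T /\ unbounded T -> exS X, path T X.

Inductive WKL0s : theory :=
| WKL0s_RCA0s p : RCA0s p -> WKL0s p
| WKL0s_WKL : WKL0s (closed WKL).

(** * The principles *)

Definition linear_order (R : sv) : fm :=
  (allN x, opair x x \in R)
  /\ (allN x y, opair x y \in R /\ opair y x \in R -> x = y)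
  /\ (allN x y z, opair x y \in R /\ opair y z \in R -> opair x z \in R)
  /\ (allN x y, opair x y \in R \/ opair y x \in R).

Definition ADS : fm :=
  allS R, linear_order R ->
    exS A, unbounded A
      /\ ((allN x y, x \in A /\ y \in A -> (x <= y <-> opair x y \in R))
          \/ (allN x y, x \in A /\ y \in A -> (x <= y <-> opair y x \in R))).

Definition lADSsq : fm :=
  allS R, linear_order R ->
    exS F, function F
      /\ ((allN i j x y, i < j /\ opair i x \in F /\ opair j y \in F ->
             opair x y \in R /\ ~ (x = y))
          \/ (allN i j x y, i < j /\ opair i x \in F /\ opair j y \in F ->
             opair y x \in R /\ ~ (x = y))).

(** There is a bijection [G] from the numbers below [n] to [A]. *)
Definition has_card (A : sv) (n : tm) : fm :=
  exS G,
    (allN i x, opair i x \in G -> i < n /\ x \in A)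
    /\ (allN i, i < n -> exN x, opair i x \in G)
    /\ (allN i x y, opair i x \in G /\ opair i y \in G -> x = y)
    /\ (allN x, x \in A -> exN i, opair i x \in G)
    /\ (allN i j x, opair i x \in G /\ opair j x \in G -> i = j).

(** Finite sets are the bounded ones. *)
Definition finite (A : sv) : fm := exN b, allN x, x \in A -> x < b.

Definition cardN (A : sv) : fm :=
  allN n, exS B, (allN x, x \in B -> x \in A) /\ finite B /\ has_card B n.

(** The colour of a pair [x < y] is 1 if [opair x y] is in [C], and 0 otherwise;
    this is equality of the colours of two such pairs. *)
Definition same_colour (C : sv) (x y x' y' : tm) : fm :=
  opair x y \in C <-> opair x' y' \in C.

Definition stabilises (C A : sv) : fm :=
  allN x, x \in A -> exN y, y \in A /\ x < y
    /\ allN z, z \in A /\ y <= z -> same_colour C x z x y.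

Definition CRT22 : fm := allS C, exS A, unbounded A /\ stabilises C A.

Definition lCRT22 : fm := allS C, exS A, cardN A /\ stabilises C A.

(* Main.v *)
(** By the completeness of the calculus it is enough to argue in an arbitrary
    model, given by its numbers and its sets, in which induction and
    comprehension are available for the predicates that belong to the model.
    There exponentiation yields codes of bounded sets, hence counting and the
    pigeonhole principle; this replaces [Sigma_1]-induction below.

    From a strictly monotone sequence of length [N], the records
    [s_i > s_j] (all [j < i]) form an unbounded set.  Conversely, cut the numbers
    into rapidly growing intervals.  When all numbers up to the end of the [k]-th
    interval are sorted, some [2 (k + 1)] consecutive ones all lie in the interval, so
    that they are indistinguishable for smaller numbers.  ADS, applied to
    the middle elements of these runs, gives an unbounded set of runs whose
    lower (or upper) halves can be concatenated into a monotone sequence; from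
    each run [k] only the entries with positions in [(k', k]] are used, [k'] being
    the previous run, and so no summation of lengths is needed.

    A set of cardinality [N] is unbounded by the pigeonhole principle.  For the
    converse concerning CRT, either every unbounded set has cardinality [N], or
    some unbounded set has fewer than [b] elements below each number, and then
    has a very sparse subset whose elements cut the numbers into blocks.
    Homogenise each block first towards all smaller numbers; since there are fewer than
    [b] later blocks, any finite number of blocks can then be thinned so that
    colours between elements of two blocks depend on the blocks only.  The thinned
    sets form an unbounded binary tree.  Along a path, CRT for the colouring
    of blocks gives blocks whose union is as required. *)
From HB Require Import structures.
From mathcomp Require Import all_boot all_order all_algebra.
From mathcomp Require Import boolp lra.
From Stdlib Require Import Cantor Ring.
Require Import Defs.

(** * Algebra of simultaneous substitutions on terms and formulas *)

Lemma subst_term_comp sg sg' t :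
  subst_term sg' (subst_term sg t) = subst_term (fun n => subst_term sg' (sg n)) t.
Proof. by elim: t => //= s -> t ->. Qed.

Lemma subst_term_Var t : subst_term Var t = t.
Proof. by elim: t => //= s -> t ->. Qed.

Lemma up_num_comp sg sg' :
  (fun n => subst_term (up_num sg') (up_num sg n)) =
  up_num (fun n => subst_term sg' (sg n)).
Proof.
by apply: funext => -[|n] //=; rewrite /lift_term !subst_term_comp.
Qed.

Lemma up_set_comp rh rh' :
  (fun n => up_set rh' (up_set rh n)) = up_set (fun n => rh' (rh n)).
Proof. by apply: funext => -[|n]. Qed.

Lemma up_num_Var : up_num Var = Var.
Proof. by apply: funext => -[|n]. Qed.

Lemma up_set_id : up_set (fun n => n) = (fun n => n).
Proof. by apply: funext => -[|n]. Qed.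

Lemma subst_comp p sg rh sg' rh' :
  subst sg' rh' (subst sg rh p) =
  subst (fun n => subst_term sg' (sg n)) (fun n => rh' (rh n)) p.
Proof.
elim: p sg rh sg' rh' => //= [s t|s t|t X|p IHp q IHq|p IHp q IHq|p IHp q IHq
  |p IH|p IH|p IH|p IH] sg rh sg' rh';
  by rewrite ?subst_term_comp ?IHp ?IHq ?IH ?up_num_comp ?up_set_comp.
Qed.

Lemma subst_id p : subst Var (fun X => X) p = p.
Proof.
elim: p => //= [s t|s t|t X|p IHp q IHq|p IHp q IHq|p IHp q IHq
  |p IH|p IH|p IH|p IH];
  by rewrite ?subst_term_Var ?up_num_Var ?up_set_id ?IHp ?IHq ?IH.
Qed.

Lemma subst_lift_num p sg rh :
  subst (up_num sg) rh (lift_num p) = lift_num (subst sg rh p).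
Proof. by rewrite /lift_num !subst_comp. Qed.

Lemma subst_lift_set p sg rh :
  subst sg (up_set rh) (lift_set p) = lift_set (subst sg rh p).
Proof.
rewrite /lift_set !subst_comp; congr (subst _ _ p).
by apply: funext => n; rewrite subst_term_Var.
Qed.

Lemma subst_scons_num p sg rh t :
  inst_num (subst (up_num sg) rh p) t = subst (scons t sg) rh p.
Proof.
rewrite /inst_num subst_comp; congr (subst _ _ p).
by apply: funext => -[|n] //=; rewrite /lift_term subst_term_comp subst_term_Var.
Qed.

Lemma subst_scons_set p sg rh X :
  inst_set (subst sg (up_set rh) p) X = subst sg (scons X rh) p.
Proof.
rewrite /inst_set subst_comp; congr (subst _ _ p).
  by apply: funext => n; rewrite subst_term_Var.
by apply: funext => -[|n].
Qed.

Lemma subst_inst_num p t sg rh :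
  subst sg rh (inst_num p t) = inst_num (subst (up_num sg) rh p) (subst_term sg t).
Proof.
rewrite subst_scons_num /inst_num subst_comp; congr (subst _ _ p).
by apply: funext => -[|n].
Qed.

Lemma subst_inst_set p X sg rh :
  subst sg rh (inst_set p X) = inst_set (subst sg (up_set rh) p) (rh X).
Proof.
rewrite subst_scons_set /inst_set subst_comp; congr (subst _ _ p).
by apply: funext => -[|n].
Qed.

Lemma inst_up_num_lift p :
  inst_num (subst (up_num (fun n => Var (S n))) (fun X => X) p) (Var 0) = p.
Proof.
rewrite subst_scons_num -[RHS]subst_id; congr (subst _ _ p).
by apply: funext => -[|n].
Qed.

Lemma inst_up_set_lift p : inst_set (subst Var (up_set S) p) 0 = p.
Proof.
rewrite subst_scons_set -[RHS]subst_id; congr (subst _ _ p).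
by apply: funext => -[|n].
Qed.

(** * Completeness of the calculus *)

Section Calculus.
Variable T : theory.
Hypothesis T_subst : forall p sg rh, T p -> T (subst sg rh p).

Lemma derives_weaken G p : derives T G p ->
  forall G', List.incl G G' -> derives T G' p.
Proof.
have cons q L L' : List.incl L L' -> List.incl (q :: L) (q :: L').
  by move=> inc r [<-|/inc]; [left|right].
have mapi f L L' : List.incl L L' -> List.incl (List.map f L) (List.map f L').
  by move=> inc r /List.in_map_iff [q [<- /inc Lq]]; apply: List.in_map.
elim=> {G p}; try by intros; econstructor; eauto.
Qed.

(** Substitution commutes with lifting, so the eigenvariable rules can be re-applied under [up_num]
    and [up_set]. Axioms may have free variables, so the axiom case rests on [T_subst]. *)
Lemma derives_subst G p : derives T G p ->
  forall sg rh, derives T (List.map (subst sg rh) G) (subst sg rh p).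
Proof.
have lN sg rh L : List.map (subst (up_num sg) rh) (List.map lift_num L) =
    List.map lift_num (List.map (subst sg rh) L).
  by rewrite !List.map_map; apply: List.map_ext => q; exact: subst_lift_num.
have lS sg rh L : List.map (subst sg (up_set rh)) (List.map lift_set L) =
    List.map lift_set (List.map (subst sg rh) L).
  by rewrite !List.map_map; apply: List.map_ext => q; exact: subst_lift_set.
elim=> {G p} /=.
- by move=> G p Tp sg rh; apply/d_axiom/T_subst.
- by move=> G p Gp sg rh; apply/d_hyp/List.in_map.
- by move=> G p _ IH sg rh; apply/d_contra/(IH sg rh).
- by move=> G p q _ IH sg rh; apply/d_impI/(IH sg rh).
- by move=> G p q _ IH _ IH' sg rh; apply: d_impE (IH sg rh) (IH' sg rh).
- by move=> G p q _ IH _ IH' sg rh; apply: d_andI (IH sg rh) (IH' sg rh).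
- by move=> G p q _ IH sg rh; apply: d_andE1 (IH sg rh).
- by move=> G p q _ IH sg rh; apply: d_andE2 (IH sg rh).
- by move=> G p q _ IH sg rh; apply: d_orI1 (IH sg rh).
- by move=> G p q _ IH sg rh; apply: d_orI2 (IH sg rh).
- by move=> G p q r _ IH _ IH' _ IH'' sg rh;
    apply: d_orE (IH sg rh) (IH' sg rh) (IH'' sg rh).
- by move=> G p _ IH sg rh; apply: d_allNI; rewrite -lN; apply: IH.
- by move=> G p t _ IH sg rh; rewrite subst_inst_num; apply/d_allNE/(IH sg rh).
- move=> G p t _ IH sg rh; apply: (@d_exNI _ _ _ (subst_term sg t)).
  by rewrite -subst_inst_num.
- move=> G p r _ IH _ IH' sg rh; apply: (d_exNE _ _ _ _ (IH sg rh)).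
  by rewrite -lN -subst_lift_num; apply: IH'.
- by move=> G p _ IH sg rh; apply: d_allSI; rewrite -lS; apply: IH.
- by move=> G p X _ IH sg rh; rewrite subst_inst_set; apply/d_allSE/(IH sg rh).
- move=> G p X _ IH sg rh; apply: (@d_exSI _ _ _ (rh X)).
  by rewrite -subst_inst_set.
- move=> G p r _ IH _ IH' sg rh; apply: (d_exSE _ _ _ _ (IH sg rh)).
  by rewrite -lS -subst_lift_set; apply: IH'.
- by move=> *; apply: d_eqI.
- move=> G p s t _ IH _ IH' sg rh; rewrite subst_inst_num.
  by apply: d_eqE (IH sg rh) _; rewrite -subst_inst_num.
Qed.

(** The following substitutions free the index [0] by sending [k] to it; on
    formulas in which [k] does not occur they coincide with lifting. *)
Definition open_num (k n : nat) : term :=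
  if n == k then Var 0 else Var (S n).
Definition open_set (k n : nat) : nat := if n == k then 0 else S n.

Lemma subst_term_bounded t : exists k, forall sg sg',
  (forall n, n < k -> sg n = sg' n) -> subst_term sg t = subst_term sg' t.
Proof.
elim: t => [n|||s [k IHs] t [l IHt]|s [k IHs] t [l IHt]]; try by exists 0.
- by exists (S n) => sg sg' e /=; apply: e.
- exists (maxn k l) => sg sg' e /=; congr Add; [apply: IHs|apply: IHt] => n nk;
    by apply: e; rewrite leq_max nk ?orbT.
- exists (maxn k l) => sg sg' e /=; congr Mul; [apply: IHs|apply: IHt] => n nk;
    by apply: e; rewrite leq_max nk ?orbT.
Qed.

(** Only finitely many variables occur, which later yields a fresh one. A single bound serves both
    sorts and survives a binder, where index n + 1 refers to n. *)
Lemma subst_bounded p : exists k, forall sg rh sg' rh',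
  (forall n, n < k -> sg n = sg' n /\ rh n = rh' n) ->
  subst sg rh p = subst sg' rh' p.
Proof.
have up A k (a : A) f f' (h : A -> A) : (forall n, n < k -> f n = f' n) ->
    forall n, n < k -> scons a (fun m => h (f m)) n = scons a (fun m => h (f' m)) n.
  by move=> e [|n] //= nk; rewrite e // ltnW.
have bin p1 p2 (c : form -> form -> form) :
    (exists k, forall sg rh sg' rh',
      (forall n, n < k -> sg n = sg' n /\ rh n = rh' n) ->
      subst sg rh p1 = subst sg' rh' p1) ->
    (exists k, forall sg rh sg' rh',
      (forall n, n < k -> sg n = sg' n /\ rh n = rh' n) ->
      subst sg rh p2 = subst sg' rh' p2) ->
    exists k, forall sg rh sg' rh',
      (forall n, n < k -> sg n = sg' n /\ rh n = rh' n) ->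
      c (subst sg rh p1) (subst sg rh p2) = c (subst sg' rh' p1) (subst sg' rh' p2).
  move=> [k IHp] [l IHq]; exists (maxn k l) => sg rh sg' rh' e.
  congr c; [apply: IHp|apply: IHq] => n nk;
    by apply: e; rewrite leq_max nk ?orbT.
elim: p => [s t|s t|t X||p IHp q IHq|p IHp q IHq|p IHp q IHq|p [k IH]|p [k IH]|p [k IH]|p [k IH]];
  try (by apply: bin).
- have [k ks] := subst_term_bounded s; have [l lt] := subst_term_bounded t.
  exists (maxn k l) => sg rh sg' rh' e.
  congr Eq; [apply: ks|apply: lt] => n nk;
    by apply: (proj1 (e n _)); rewrite leq_max nk ?orbT.
- have [k ks] := subst_term_bounded s; have [l lt] := subst_term_bounded t.
  exists (maxn k l) => sg rh sg' rh' e.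
  congr Lt; [apply: ks|apply: lt] => n nk;
    by apply: (proj1 (e n _)); rewrite leq_max nk ?orbT.
- have [k kt] := subst_term_bounded t.
  exists (maxn k (S X)) => sg rh sg' rh' e; congr In.
    by apply: kt => n nk; apply: (proj1 (e n _)); rewrite leq_max nk.
  by apply: (proj2 (e X _)); rewrite leq_max leqnn orbT.
- by exists 0.
all: exists k => sg rh sg' rh' e;
  first [apply: (congr1 AllN)|apply: (congr1 ExN)|apply: (congr1 AllS)|apply: (congr1 ExS)];
  apply: IH => n nk;
  split; try (by case: (e n nk)); apply: up nk => m mk; by case: (e m mk).
Qed.

Lemma subst_bounded_list G : exists k, forall p, List.In p G ->
  forall sg rh sg' rh', (forall n, n < k -> sg n = sg' n /\ rh n = rh' n) ->
  subst sg rh p = subst sg' rh' p.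
Proof.
elim: G => [|q G [k IH]]; first by exists 0.
have [l lq] := subst_bounded q.
exists (maxn k l) => p [<-|Gp] sg rh sg' rh' e; [apply: lq|apply: IH] => // n nk;
  by apply: e; rewrite leq_max nk ?orbT.
Qed.

Definition consistent (G : list form) : Prop := ~ derives T G Bot.

(** The witness is a variable [k] beyond all those in [G]. Sending it to 0 by [open_num] turns a
    refutation of the instance into the minor premise of [d_exNE]. *)
Lemma henkin_num G p : List.In (ExN p) G -> consistent G ->
  exists t, consistent (inst_num p t :: G).
Proof.
move=> Gp con; have [k kG] := subst_bounded_list G.
exists (Var k) => der; apply: con.
have mapE : List.map (subst (open_num k) (fun X => X)) G = List.map lift_num G.
  apply: List.map_ext_in => q Gq; apply: (kG q Gq) => n nk; split=> //.
  by rewrite /open_num ltn_eqF.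
(* As [ExN p] belongs to [G], [open_num] acts on it as lifting does; this fixes the action under the
   binder, and filling in the fresh variable returns [p]. *)
have instE : subst (open_num k) (fun X => X) (inst_num p (Var k)) = p.
  have /= [e] : subst (open_num k) (fun X => X) (ExN p) = lift_num (ExN p).
    by apply: (kG _ Gp) => n nk; rewrite /open_num ltn_eqF.
  by rewrite subst_inst_num e /= /open_num eqxx; exact: inst_up_num_lift.
apply: (d_exNE _ _ p) (d_hyp _ _ _ Gp) _.
by move: (derives_subst _ _ der (open_num k) (fun X => X)); rewrite /= mapE instE.
Qed.

Lemma henkin_set G p : List.In (ExS p) G -> consistent G ->
  exists X, consistent (inst_set p X :: G).
Proof.
move=> Gp con; have [k kG] := subst_bounded_list G.
exists k => der; apply: con.
have mapE : List.map (subst Var (open_set k)) G = List.map lift_set G.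
  apply: List.map_ext_in => q Gq; apply: (kG q Gq) => n nk; split=> //.
  by rewrite /open_set ltn_eqF.
have instE : subst Var (open_set k) (inst_set p k) = p.
  have /= [e] : subst Var (open_set k) (ExS p) = lift_set (ExS p).
    by apply: (kG _ Gp) => n nk; rewrite /open_set ltn_eqF.
  by rewrite subst_inst_set e /= /open_set eqxx; exact: inst_up_set_lift.
apply: (d_exSE _ _ p) (d_hyp _ _ _ Gp) _.
by move: (derives_subst _ _ der Var (open_set k)); rewrite /= mapE instE.
Qed.

(** One stage of the Lindenbaum construction with Henkin witnesses. *)
Definition henkin_step (f : form) (G G' : list form) : Prop :=
  List.incl G G' /\ (consistent (f :: G) -> List.In f G' /\
    (forall p, f = ExN p -> exists t, List.In (inst_num p t) G') /\
    (forall p, f = ExS p -> exists X, List.In (inst_set p X) G')).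

Lemma henkin_step_ex f (G : {G | consistent G}) :
  exists G' : {G | consistent G}, henkin_step f (proj1_sig G) (proj1_sig G').
Proof.
case: G => G conG; rewrite /henkin_step /=.
case: (pselect (consistent (f :: G))) => [con|ncon]; last first.
  by exists (exist _ G conG); split=> //; apply: List.incl_refl.
have tl : List.incl G (f :: G) by right.
have hd : List.In f (f :: G) by left.
case: (pselect (exists p, f = ExN p)) => [[p fE]|nN].
  have [|t ct] := henkin_num (f :: G) p _ con; first by rewrite -fE.
  exists (exist _ _ ct); split=> /= [q /tl|_]; first by right.
  split; first by right.
  by split=> q; rewrite fE // => -[<-]; exists t; left.
case: (pselect (exists p, f = ExS p)) => [[p fE]|nS].
  have [|t ct] := henkin_set (f :: G) p _ con; first by rewrite -fE.
  exists (exist _ _ ct); split=> /= [q /tl|_]; first by right.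
  split; first by right.
  by split=> q; rewrite fE // => -[<-]; exists t; left.
exists (exist _ _ con); split=> //= _; split; first by left.
by split=> p fE; [case: nN|case: nS]; exists p.
Qed.

End Calculus.

(** * Injective codes and an enumeration of all formulas *)

Definition cpair (m n : nat) : nat := to_nat (m, n).
Arguments cpair : simpl never.

Lemma cpair_inj m n m' n' : cpair m n = cpair m' n' -> (m, n) = (m', n').
Proof. exact: to_nat_inj. Qed.

Fixpoint code_term (t : term) : nat :=
  match t with
  | Var n => cpair 0 n
  | Zero => cpair 1 0
  | One => cpair 2 0
  | Add s t => cpair 3 (cpair (code_term s) (code_term t))
  | Mul s t => cpair 4 (cpair (code_term s) (code_term t))
  end.

Fixpoint code_form (p : form) : nat :=
  match p with
  | Eq s t => cpair 0 (cpair (code_term s) (code_term t))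
  | Lt s t => cpair 1 (cpair (code_term s) (code_term t))
  | In t X => cpair 2 (cpair (code_term t) X)
  | Bot => cpair 3 0
  | Imp p q => cpair 4 (cpair (code_form p) (code_form q))
  | And p q => cpair 5 (cpair (code_form p) (code_form q))
  | Or p q => cpair 6 (cpair (code_form p) (code_form q))
  | AllN p => cpair 7 (code_form p)
  | ExN p => cpair 8 (code_form p)
  | AllS p => cpair 9 (code_form p)
  | ExS p => cpair 10 (code_form p)
  end.

Lemma code_term_inj s t : code_term s = code_term t -> s = t.
Proof.
elim: s t => [n|||s IHs t IHt|s IHs t IHt] [m|||s' t'|s' t'] /= /cpair_inj //.
- by case=> ->.
- by case=> /cpair_inj [/IHs -> /IHt ->].
- by case=> /cpair_inj [/IHs -> /IHt ->].
Qed.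

Lemma code_form_inj p q : code_form p = code_form q -> p = q.
Proof.
elim: p q => [s t|s t|t X||p IHp q IHq|p IHp q IHq|p IHp q IHq|p IH|p IH|p IH|p IH]
  [s' t'|s' t'|t' X'||p' q'|p' q'|p' q'|p'|p'|p'|p'] /= /cpair_inj //.
- by case=> /cpair_inj [/code_term_inj -> /code_term_inj ->].
- by case=> /cpair_inj [/code_term_inj -> /code_term_inj ->].
- by case=> /cpair_inj [/code_term_inj -> ->].
- by case=> /cpair_inj [/IHp -> /IHq ->].
- by case=> /cpair_inj [/IHp -> /IHq ->].
- by case=> /cpair_inj [/IHp -> /IHq ->].
all: by case=> /IH ->.
Qed.

Lemma form_enum : exists e : nat -> form, forall p, exists n, e n = p.
Proof.
have /boolp.choice[e eP] : forall n, exists q, (exists p, code_form p = n) ->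
    code_form q = n.
  move=> n; case: (pselect (exists p, code_form p = n)) => [[p pn]|no].
    by exists p.
  by exists Bot => /no.
exists e => p; exists (code_form p); apply: code_form_inj; apply: eP.
by exists p.
Qed.

(** * Henkin semantics and the term model *)

Record model : Type := Model {
  dom : Type; sets : Type;
  mzero : dom; mone : dom;
  madd : dom -> dom -> dom; mmul : dom -> dom -> dom;
  mlt : dom -> dom -> Prop; mem : dom -> sets -> Prop }.

Fixpoint eval (N : model) (v : nat -> dom N) (t : term) : dom N :=
  match t with
  | Var n => v n
  | Zero => mzero N
  | One => mone N
  | Add s t => madd N (eval N v s) (eval N v t)
  | Mul s t => mmul N (eval N v s) (eval N v t)
  end.

(** Set quantifiers range over [sets N] only. Equality of numbers is genuine equality, so the term
    model has to be a quotient. *)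
Fixpoint sat (N : model) (v : nat -> dom N) (w : nat -> sets N) (p : form) : Prop :=
  match p with
  | Eq s t => eval N v s = eval N v t
  | Lt s t => mlt N (eval N v s) (eval N v t)
  | In t X => mem N (eval N v t) (w X)
  | Bot => False
  | Imp p q => sat N v w p -> sat N v w q
  | And p q => sat N v w p /\ sat N v w q
  | Or p q => sat N v w p \/ sat N v w q
  | AllN p => forall x, sat N (scons x v) w p
  | ExN p => exists x, sat N (scons x v) w p
  | AllS p => forall X, sat N v (scons X w) p
  | ExS p => exists X, sat N v (scons X w) p
  end.

Definition satisfies (N : model) (T : theory) : Prop :=
  forall p, T p -> forall v w, sat N v w p.

Section Completeness.
Variable T : theory.
Hypothesis T_subst : forall p sg rh, T p -> T (subst sg rh p).
Variables (G0 : list form) (con0 : consistent T G0).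

Let enum : nat -> form := projT1 (cid form_enum).
Let enumP p : exists n, enum n = p := projT2 (cid form_enum) p.

Fixpoint chain (n : nat) : {G | consistent T G} :=
  if n is S m then projT1 (cid (henkin_step_ex T T_subst (enum m) (chain m)))
  else exist _ G0 con0.

Let stage n : list form := proj1_sig (chain n).

Lemma stage_step n : henkin_step T (enum n) (stage n) (stage (S n)).
Proof. exact: (projT2 (cid (henkin_step_ex T T_subst (enum n) (chain n)))). Qed.

Lemma stage_incl m n : m <= n -> List.incl (stage m) (stage n).
Proof.
elim: n => [|n IH]; first by rewrite leqn0 => /eqP ->; apply: List.incl_refl.
rewrite leq_eqVlt => /orP[/eqP ->|/IH inc]; first exact: List.incl_refl.
by apply: List.incl_tran inc _; case: (stage_step n).
Qed.

(** The deductive closure of the whole chain: a complete Henkin theory, for which every connective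
    and quantifier gets its truth clause below. *)
Definition prov (p : form) : Prop := exists n, derives T (stage n) p.

(** Finitely many premises are all derivable at one common stage, and cuts then discharge [L]. Each
    rule of the calculus thereby passes to [prov]. *)
Lemma prov_rule (L : list form) p : (forall q, List.In q L -> prov q) ->
  (forall G, List.incl L G -> derives T G p) -> prov p.
Proof.
move=> Lprov rule.
have [n nL] : exists n, forall q, List.In q L -> derives T (stage n) q.
  elim: L Lprov {rule} => [|q L IH] Lprov; first by exists 0.
  have [|n nL] := IH; first by move=> r Lr; apply: Lprov; right.
  have [|m mq] := Lprov q; first by left.
  exists (maxn m n) => r [<-|/nL der].
    by apply: derives_weaken mq _ (stage_incl _ _ _); rewrite leq_maxl.
  by apply: derives_weaken der _ (stage_incl _ _ _); rewrite leq_maxr.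
exists n.
have cut : forall L', (forall q, List.In q L' -> derives T (stage n) q) ->
    forall r, derives T (L' ++ stage n)%list r -> derives T (stage n) r.
  elim=> [//|q L' IH] der r rd; apply: (d_impE _ _ q); last by apply: der; left.
  apply: IH => [s L's|]; first by apply: der; right.
  exact: d_impI.
by apply: (cut L nL); apply: rule; apply: List.incl_appl; apply: List.incl_refl.
Qed.

Lemma prov_Bot : ~ prov Bot.
Proof. by case=> n; apply: (proj2_sig (chain n)). Qed.

Lemma derives_exfalso G p : derives T G Bot -> derives T G p.
Proof. by move=> der; apply: d_contra; apply: derives_weaken der _ _; right. Qed.

Lemma prov_in p n : List.In p (stage n) -> prov p.
Proof. by move=> np; exists n; apply: d_hyp. Qed.

(** A derivable formula is consistent with the stage that treats it, hence enters there, together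
    with a witness if it is existential. *)
Lemma prov_enum p : prov p -> exists n, enum n = p /\ consistent T (p :: stage n).
Proof.
move=> pp; have [n np] := enumP p; exists n; split=> // con.
apply: prov_Bot; apply: (prov_rule [:: p; Neg p]) => [q [<- //|[<-|//]]|G inc].
  by exists n; apply: d_impI.
by apply: (d_impE _ _ p); apply: d_hyp; apply: inc; [right; left|left].
Qed.

Lemma prov_Neg p : prov (Neg p) <-> ~ prov p.
Proof.
split=> [np pp|npp].
  apply: prov_Bot; apply: (prov_rule [:: p; Neg p]) => [q [<- //|[<-//|//]]|G inc].
  by apply: (d_impE _ _ p); apply: d_hyp; apply: inc; [right; left|left].
have [n np] := enumP p; case: (stage_step n) => _; rewrite np => h.
case: (pselect (consistent T (p :: stage n))) => [/h [ip _]|].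
  by case: npp; apply: prov_in ip.
by move=> /contrapT der; exists n; apply: d_impI.
Qed.

Lemma prov_Imp p q : prov (Imp p q) <-> (prov p -> prov q).
Proof.
split=> [pq pp|pq].
  apply: (prov_rule [:: p; Imp p q]) => [r [<-//|[<-//|//]]|G inc].
  by apply: (d_impE _ _ p); apply: d_hyp; apply: inc; [right; left|left].
case: (pselect (prov p)) => [/pq qq|/prov_Neg np].
  apply: (prov_rule [:: q]) => [r [<-//|//]|G inc].
  by apply/d_impI/d_hyp; right; apply: inc; left.
apply: (prov_rule [:: Neg p]) => [r [<-//|//]|G inc].
apply/d_impI/derives_exfalso/(d_impE _ _ p); apply: d_hyp; last by left.
by right; apply: inc; left.
Qed.

Lemma prov_And p q : prov (And p q) <-> prov p /\ prov q.
Proof.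
split=> [pq|[pp qq]].
  by split; apply: (prov_rule [:: And p q]) => [r [<-//|//]|G inc];
    [apply: (d_andE1 _ _ _ q)|apply: (d_andE2 _ _ p)]; apply: d_hyp; apply: inc; left.
apply: (prov_rule [:: p; q]) => [r [<-//|[<-//|//]]|G inc].
by apply: d_andI; apply: d_hyp; apply: inc; [left|right; left].
Qed.

Lemma prov_Or p q : prov (Or p q) <-> prov p \/ prov q.
Proof.
split=> [pq|[pp|qq]].
- case: (pselect (prov p)) => [|/prov_Neg np]; first by left.
  right; apply: (prov_rule [:: Or p q; Neg p]) => [r [<-//|[<-//|//]]|G inc].
  apply: (d_orE _ _ p q); first by apply: d_hyp; apply: inc; left.
    apply: derives_exfalso; apply: (d_impE _ _ p); apply: d_hyp; last by left.
    by right; apply: inc; right; left.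
  by apply: d_hyp; left.
- apply: (prov_rule [:: p]) => [r [<-//|//]|G inc].
  by apply/d_orI1/d_hyp/inc; left.
- apply: (prov_rule [:: q]) => [r [<-//|//]|G inc].
  by apply/d_orI2/d_hyp/inc; left.
Qed.

Lemma prov_ExN p : prov (ExN p) <-> exists t, prov (inst_num p t).
Proof.
split=> [pp|[t pt]].
  have [n [np con]] := prov_enum _ pp.
  case: (stage_step n) => _; rewrite np => /(_ con) [_ [/(_ _ erefl) [t tp] _]].
  by exists t; apply: prov_in tp.
apply: (prov_rule [:: inst_num p t]) => [r [<-//|//]|G inc].
by apply: (d_exNI _ _ _ t); apply: d_hyp; apply: inc; left.
Qed.

Lemma prov_ExS p : prov (ExS p) <-> exists X, prov (inst_set p X).
Proof.
split=> [pp|[t pt]].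
  have [n [np con]] := prov_enum _ pp.
  case: (stage_step n) => _; rewrite np => /(_ con) [_ [_ /(_ _ erefl) [t tp]]].
  by exists t; apply: prov_in tp.
apply: (prov_rule [:: inst_set p t]) => [r [<-//|//]|G inc].
by apply: (d_exSI _ _ _ t); apply: d_hyp; apply: inc; left.
Qed.

(** If the universal formula were not provable, [ExN (Neg p)] would be, and its Henkin witness would
    contradict the corresponding instance of [p]. *)
Lemma prov_AllN p : prov (AllN p) <-> forall t, prov (inst_num p t).
Proof.
split=> [pp t|pp].
  apply: (prov_rule [:: AllN p]) => [r [<-//|//]|G inc].
  by apply/d_allNE/d_hyp/inc; left.
apply: contrapT => /prov_Neg nall.
have /prov_ExN [t nt] : prov (ExN (Neg p)).
  apply: (prov_rule [:: Neg (AllN p)]) => [r [<-//|//]|G inc].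
  apply: d_contra; apply: (d_impE _ _ (AllN p)).
    by apply: d_hyp; right; apply: inc; left.
  apply: d_allNI; apply: d_contra => /=.
  apply: (d_impE _ _ (lift_num (ExN (Neg p)))); first by apply: d_hyp; right; left.
  apply: (d_exNI _ _ _ (Var 0)).
  by have -> := inst_up_num_lift (Neg p); apply: d_hyp; left.
by move/prov_Neg: nt; apply; apply: pp.
Qed.

Lemma prov_AllS p : prov (AllS p) <-> forall X, prov (inst_set p X).
Proof.
split=> [pp t|pp].
  apply: (prov_rule [:: AllS p]) => [r [<-//|//]|G inc].
  by apply/d_allSE/d_hyp/inc; left.
apply: contrapT => /prov_Neg nall.
have /prov_ExS [t nt] : prov (ExS (Neg p)).
  apply: (prov_rule [:: Neg (AllS p)]) => [r [<-//|//]|G inc].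
  apply: d_contra; apply: (d_impE _ _ (AllS p)).
    by apply: d_hyp; right; apply: inc; left.
  apply: d_allSI; apply: d_contra => /=.
  apply: (d_impE _ _ (lift_set (ExS (Neg p)))); first by apply: d_hyp; right; left.
  apply: (d_exSI _ _ _ 0).
  by have -> := inst_up_set_lift (Neg p); apply: d_hyp; left.
by move/prov_Neg: nt; apply; apply: pp.
Qed.

Lemma prov_eqE p s t : prov (Eq s t) -> prov (inst_num p s) -> prov (inst_num p t).
Proof.
move=> st ps.
apply: (prov_rule [:: Eq s t; inst_num p s]) => [r [<-//|[<-//|//]]|G inc].
by apply: (d_eqE _ _ _ s); apply: d_hyp; apply: inc; [left|right; left].
Qed.

Lemma prov_eqI t : prov (Eq t t).
Proof. by exists 0; apply: d_eqI. Qed.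

Let inst_lift t s : subst_term (scons s Var) (lift_term t) = t.
Proof. by rewrite /lift_term subst_term_comp subst_term_Var. Qed.

Lemma prov_eq_sym s t : prov (Eq s t) -> prov (Eq t s).
Proof.
move=> st; have := prov_eqE (Eq (Var 0) (lift_term s)) s t st.
by rewrite /inst_num /= !inst_lift; apply; apply: prov_eqI.
Qed.

Lemma prov_eq_trans s t u : prov (Eq s t) -> prov (Eq t u) -> prov (Eq s u).
Proof.
move=> st tu; have := prov_eqE (Eq (lift_term s) (Var 0)) t u tu.
by rewrite /inst_num /= !inst_lift; apply.
Qed.

(** Classes are predicates on terms, so that extensionality turns provable equality into
    equality. *)
Definition eqclass : Type := {P : term -> Prop | exists t, P = fun s => prov (Eq t s)}.
Definition cls (t : term) : eqclass :=
  exist _ (fun s => prov (Eq t s)) (ex_intro _ t erefl).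
Definition rep (c : eqclass) : term := projT1 (cid (proj2_sig c)).

Lemma cls_eq s t : cls s = cls t <-> prov (Eq s t).
Proof.
split=> [/(congr1 (@proj1_sig _ _)) /= e|st].
  by move: (prov_eqI t); rewrite -[prov (Eq t t)]/((fun u => prov (Eq t u)) t) -e.
apply: eq_exist; apply: funext => u; apply: propext; split=> h.
  exact: prov_eq_trans (prov_eq_sym _ _ st) h.
exact: prov_eq_trans st h.
Qed.

Lemma repK c : cls (rep c) = c.
Proof.
case: c => P hP; apply: eq_exist; rewrite /rep /=.
by case: (cid hP) => t /= ->.
Qed.

Lemma rep_cls t : prov (Eq (rep (cls t)) t).
Proof. by apply/cls_eq; rewrite repK. Qed.

Definition term_model : model := {|
  dom := eqclass; sets := nat;
  mzero := cls Zero; mone := cls One;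
  madd := fun c d => cls (Add (rep c) (rep d));
  mmul := fun c d => cls (Mul (rep c) (rep d));
  mlt := fun c d => prov (Lt (rep c) (rep d));
  mem := fun c X => prov (In (rep c) X) |}.

Lemma prov_congr2 (c : term -> term -> term) s s' t t' :
  (forall sg a b, subst_term sg (c a b) = c (subst_term sg a) (subst_term sg b)) ->
  prov (Eq s s') -> prov (Eq t t') -> prov (Eq (c s t) (c s' t')).
Proof.
move=> cS ss' tt'.
have := prov_eqE (Eq (lift_term (c s t)) (c (Var 0) (lift_term t))) s s' ss'.
have := prov_eqE (Eq (lift_term (c s t)) (c (lift_term s') (Var 0))) t t' tt'.
rewrite /inst_num /= !cS /= !inst_lift => h1 h2; apply: h1; apply: h2.
exact: prov_eqI.
Qed.

Lemma eval_term_model sg t :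
  eval term_model (fun n => cls (sg n)) t = cls (subst_term sg t).
Proof.
elim: t => //= s -> t ->; apply/cls_eq; apply: prov_congr2 => //; exact: rep_cls.
Qed.

Lemma prov_Lt s s' t t' : prov (Eq s s') -> prov (Eq t t') ->
  prov (Lt s t) -> prov (Lt s' t').
Proof.
move=> ss' tt' st.
have := prov_eqE (Lt (Var 0) (lift_term t)) s s' ss'.
have := prov_eqE (Lt (lift_term s') (Var 0)) t t' tt'.
by rewrite /inst_num /= !inst_lift => h1 h2; apply: h1; apply: h2.
Qed.

Lemma prov_In s s' X : prov (Eq s s') -> prov (In s X) -> prov (In s' X).
Proof.
by move=> ss'; have := prov_eqE (In (Var 0) X) s s' ss'; rewrite /inst_num.
Qed.

(** The induction needs arbitrary substitutions, since a quantifier extends [sg] by a representative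
    of a class. Set variables are their own values in the term model. *)
Lemma truth p sg rh :
  sat term_model (fun n => cls (sg n)) rh p <-> prov (subst sg rh p).
Proof.
have ext c sg' : scons c (fun n => cls (sg' n)) = fun n => cls (scons (rep c) sg' n).
  by apply: funext => -[|n] //=; rewrite repK.
elim: p sg rh => /= [s t|s t|t X||p IHp q IHq|p IHp q IHq|p IHp q IHq
  |p IH|p IH|p IH|p IH] sg rh.
- by rewrite !eval_term_model cls_eq.
- rewrite !eval_term_model; split; apply: prov_Lt; try exact: rep_cls;
    exact/prov_eq_sym/rep_cls.
- rewrite !eval_term_model; split; apply: prov_In; first exact: rep_cls.
  exact/prov_eq_sym/rep_cls.
- by split=> // /prov_Bot.
- by rewrite IHp IHq prov_Imp.
- by rewrite IHp IHq prov_And.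
- by rewrite IHp IHq prov_Or.
- rewrite prov_AllN; split=> h t; first rewrite subst_scons_num -IH.
    suff <- : scons (cls t) (fun n => cls (sg n)) = fun n => cls (scons t sg n) by [].
    by apply: funext => -[].
  by rewrite ext IH -subst_scons_num.
- rewrite prov_ExN; split=> -[t h].
    by exists (rep t); rewrite subst_scons_num -IH -ext.
  exists (cls t); move: h; rewrite subst_scons_num -IH.
  suff <- : scons (cls t) (fun n => cls (sg n)) = fun n => cls (scons t sg n) by [].
  by apply: funext => -[].
- rewrite prov_AllS; split=> h X; first by rewrite subst_scons_set -IH.
  by rewrite IH -subst_scons_set.
- rewrite prov_ExS; split=> -[X h]; exists X; first by rewrite subst_scons_set -IH.
  by rewrite IH -subst_scons_set.
Qed.

Lemma term_model_satisfies : satisfies term_model T.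
Proof.
move=> p Tp v w.
have -> : v = fun n => cls (rep (v n)) by apply: funext => n; rewrite repK.
by apply/truth; exists 0; apply/d_axiom/T_subst.
Qed.

End Completeness.

Lemma completeness (T : theory) (p : form) :
  (forall q sg rh, T q -> T (subst sg rh q)) ->
  (forall N, satisfies N T -> forall v w, sat N v w p) -> proves T p.
Proof.
move=> T_subst valid; apply: contrapT => np.
have con : consistent T [:: Neg p] by move=> der; apply/np/d_contra.
have /truth := valid _ (term_model_satisfies T T_subst _ con)
  (fun n => cls T T_subst _ con (Var n)) (fun X => X).
rewrite subst_id; apply/prov_Neg.
by exists 0; apply: d_hyp; left.
Qed.

(** * Substitution instances of axioms, and substitution in models *)

Lemma delta0_subst p sg rh : delta0 p -> delta0 (subst sg rh p).
Proof.
have lift t sg' : subst_term (up_num sg') (lift_term t) = lift_term (subst_term sg' t).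
  by rewrite /lift_term !subst_term_comp.
move=> dp; elim: dp sg rh => {p} /= [s t|s t|t X||p q _ IHp _ IHq|p q _ IHp _ IHq
  |p q _ IHp _ IHq|t p _ IH|t p _ IH] sg rh; rewrite ?lift; constructor;
  by [apply: IHp|apply: IHq|apply: IH].
Qed.

(** The basic axioms and exponentiation are closed formulas; an instance of a scheme becomes another
    instance, by stability of [delta0]. *)
Lemma RCA0s_subst p sg rh : RCA0s p -> RCA0s (subst sg rh p).
Proof.
case=> {p} [p ax||p dp|p q dp dq].
- have -> : subst sg rh (closed p) = closed p.
    by case: ax => [<-|[<-|[<-|[<-|[<-|[<-|[<-|[<-|//]]]]]]]].
  exact: RCA0s_basic.
- exact: RCA0s_exp.
- rewrite /= subst_inst_num.
  have -> : subst (up_num sg) rh (succ_inst p) = succ_inst (subst (up_num sg) rh p).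
    rewrite /succ_inst !subst_comp; congr (subst _ _ p).
    by apply: funext => -[|n] //=; rewrite /lift_term subst_term_comp.
  exact/RCA0s_induction/delta0_subst.
- have := RCA0s_comprehension _ _ (delta0_subst p (up_num (up_num sg)) rh dp)
    (delta0_subst q (up_num (up_num sg)) rh dq).
  rewrite -[ExN (subst _ _ p)]/(subst (up_num sg) rh (ExN p)) -subst_lift_set.
  exact.
Qed.

Lemma WKL0s_subst p sg rh : WKL0s p -> WKL0s (subst sg rh p).
Proof. by case=> [q /RCA0s_subst|]; [left|right]. Qed.

Lemma eval_subst N v sg t :
  eval N v (subst_term sg t) = eval N (fun n => eval N v (sg n)) t.
Proof. by elim: t => //= s -> t ->. Qed.

Lemma sat_subst N p v w sg rh : sat N v w (subst sg rh p) <->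
  sat N (fun n => eval N v (sg n)) (fun n => w (rh n)) p.
Proof.
have upN v' sg' x : (fun n => eval N (scons x v') (up_num sg' n)) =
    scons x (fun n => eval N v' (sg' n)).
  by apply: funext => -[|n] //=; rewrite /lift_term eval_subst.
have upS (w' : nat -> sets N) rh' X : (fun n => scons X w' (up_set rh' n)) =
    scons X (fun n => w' (rh' n)).
  by apply: funext => -[|n].
elim: p v w sg rh => /= [s t|s t|t X||p IHp q IHq|p IHp q IHq|p IHp q IHq
  |p IH|p IH|p IH|p IH] v w sg rh; rewrite ?eval_subst ?IHp ?IHq //.
- by split=> h x; move: (h x); rewrite IH upN.
- by split=> -[x h]; exists x; move: h; rewrite IH upN.
- by split=> h x; move: (h x); rewrite IH upS.
- by split=> -[x h]; exists x; move: h; rewrite IH upS.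
Qed.

Set Implicit Arguments.
Unset Strict Implicit.

(** * Arithmetic in a model *)

(** A model in which set variables have a value, so that its axioms hold
    non-vacuously. *)
Record rca : Type := Rca {
  rca_model :> model; rca_set : sets rca_model;
  rcaP : satisfies rca_model RCA0s }.

Definition mle {N : model} (x y : dom N) : Prop := mlt N x y \/ x = y.

Declare Scope m_scope.
Delimit Scope m_scope with M.
Notation "0" := (mzero _) : m_scope.
Notation "1" := (mone _) : m_scope.
Notation "x + y" := (madd _ x y) : m_scope.
Notation "x * y" := (mmul _ x y) : m_scope.
Notation "x < y" := (mlt _ x y) : m_scope.
Notation "x <= y" := (mle x y) : m_scope.
Local Open Scope m_scope.

Section Semiring.
Variable N : rca.
Implicit Types x y z : dom N.

Let v0 : nat -> dom N := fun _ => 0.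
Let w0 : nat -> sets N := fun _ => rca_set N.

(** The uses below give the formula explicitly and place its parameters in [v] and [w]. *)
Lemma delta0_ind p v w : delta0 p -> sat N (scons 0 v) w p ->
  (forall x, sat N (scons x v) w p -> sat N (scons (x + 1) v) w p) ->
  forall x, sat N (scons x v) w p.
Proof.
move=> dp base step.
apply: (@rcaP N _ (RCA0s_induction p dp) v w); split.
  apply/sat_subst; move: base.
  suff -> : (fun n => eval N v (scons Zero Var n)) = scons 0 v by [].
  by apply: funext => -[].
move=> x /step h; apply/sat_subst; move: h.
suff -> : (fun n => eval N (scons x v) (scons (Add (Var O) One) (fun n => Var (S n)) n))
  = scons (x + 1) v by [].
by apply: funext => -[].
Qed.

Lemma basic p : List.In p basic_axioms -> sat N v0 w0 (closed p).
Proof. by move=> h; apply: rcaP; apply: RCA0s_basic. Qed.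

Lemma add1_neq0 x : x + 1 <> 0.
Proof. by apply: (@basic (List.nth 0 basic_axioms (fun _ _ => Bot))); left. Qed.
Lemma add1_inj x y : x + 1 = y + 1 -> x = y.
Proof. by apply: (@basic (List.nth 1 basic_axioms (fun _ _ => Bot))); right; left. Qed.
Lemma addx0 x : x + 0 = x.
Proof. by apply: (@basic (List.nth 2 basic_axioms (fun _ _ => Bot))); do 2 right; left. Qed.
Lemma addxS x y : x + (y + 1) = (x + y) + 1.
Proof. by apply: (@basic (List.nth 3 basic_axioms (fun _ _ => Bot))); do 3 right; left. Qed.
Lemma mulx0 x : x * 0 = 0.
Proof. by apply: (@basic (List.nth 4 basic_axioms (fun _ _ => Bot))); do 4 right; left. Qed.
Lemma mulxS x y : x * (y + 1) = x * y + x.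
Proof. by apply: (@basic (List.nth 5 basic_axioms (fun _ _ => Bot))); do 5 right; left. Qed.
Lemma mltx0 x : ~ x < 0.
Proof. by apply: (@basic (List.nth 6 basic_axioms (fun _ _ => Bot))); do 6 right; left. Qed.
Lemma ltxS x y : x < y + 1 <-> x <= y.
Proof.
have ax : List.In (List.nth 7 basic_axioms (fun _ _ => Bot)) basic_axioms.
  by do 7 right; left.
by have [] := basic ax x y.
Qed.

Lemma add0x x : 0 + x = x.
Proof.
move: x; apply: (@delta0_ind (Eq (Add Zero (Var O)) (Var O)) v0 w0) => /=; first by constructor.
  exact: addx0.
by move=> x /= IH; rewrite addxS IH.
Qed.

Lemma addSx x y : (x + 1) + y = (x + y) + 1.
Proof.
move: y; apply: (@delta0_ind (Eq (Add (Add (Var 1) One) (Var O)) (Add (Add (Var 1) (Var O)) One))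
  (scons x v0) w0) => /=; first by constructor.
  by rewrite !addx0.
by move=> y IH; rewrite !addxS IH.
Qed.

Lemma addC x y : x + y = y + x.
Proof.
move: y; apply: (@delta0_ind (Eq (Add (Var 1) (Var O)) (Add (Var O) (Var 1)))
  (scons x v0) w0) => /=; first by constructor.
  by rewrite addx0 add0x.
by move=> y IH; rewrite addxS addSx IH.
Qed.

Lemma addA x y z : x + (y + z) = (x + y) + z.
Proof.
move: z; apply: (@delta0_ind (Eq (Add (Var 1) (Add (Var 2) (Var O))) (Add (Add (Var 1) (Var 2)) (Var O)))
  (scons x (scons y v0)) w0) => /=; first by constructor.
  by rewrite !addx0.
by move=> z IH; rewrite !addxS IH.
Qed.

Lemma addI x y z : x + z = y + z -> x = y.
Proof.
move: z; apply: (@delta0_ind (Imp (Eq (Add (Var 1) (Var O)) (Add (Var 2) (Var O))) (Eq (Var 1) (Var 2)))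
  (scons x (scons y v0)) w0) => /=; first by do !constructor.
  by rewrite !addx0.
by move=> z IH; rewrite !addxS => /add1_inj.
Qed.

Lemma mul0x x : 0 * x = 0.
Proof.
move: x; apply: (@delta0_ind (Eq (Mul Zero (Var O)) Zero) v0 w0) => /=; first by constructor.
  exact: mulx0.
by move=> x IH; rewrite mulxS IH addx0.
Qed.

Lemma mulSx x y : (x + 1) * y = x * y + y.
Proof.
move: y; apply: (@delta0_ind (Eq (Mul (Add (Var 1) One) (Var O)) (Add (Mul (Var 1) (Var O)) (Var O)))
  (scons x v0) w0) => /=; first by constructor.
  by rewrite !mulx0 addx0.
by move=> y IH; rewrite !mulxS IH !addxS -(addA _ y) -(addA _ x) (addC y).
Qed.

Lemma mulC x y : x * y = y * x.
Proof.
move: y; apply: (@delta0_ind (Eq (Mul (Var 1) (Var O)) (Mul (Var O) (Var 1)))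
  (scons x v0) w0) => /=; first by constructor.
  by rewrite mulx0 mul0x.
by move=> y IH; rewrite mulxS mulSx IH.
Qed.

Lemma mulDr x y z : x * (y + z) = x * y + x * z.
Proof.
move: z; apply: (@delta0_ind (Eq (Mul (Var 1) (Add (Var 2) (Var O)))
  (Add (Mul (Var 1) (Var 2)) (Mul (Var 1) (Var O))))
  (scons x (scons y v0)) w0) => /=; first by constructor.
  by rewrite mulx0 !addx0.
by move=> z IH; rewrite addxS !mulxS IH addA.
Qed.

Lemma mulDl x y z : (x + y) * z = x * z + y * z.
Proof. by rewrite mulC mulDr !(mulC z). Qed.

Lemma mulA x y z : x * (y * z) = (x * y) * z.
Proof.
move: z; apply: (@delta0_ind (Eq (Mul (Var 1) (Mul (Var 2) (Var O))) (Mul (Mul (Var 1) (Var 2)) (Var O)))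
  (scons x (scons y v0)) w0) => /=; first by constructor.
  by rewrite !mulx0.
by move=> z IH; rewrite !mulxS mulDr IH.
Qed.

Lemma mulx1 x : x * 1 = x.
Proof. by rewrite -[1]add0x mulxS mulx0 add0x. Qed.

Lemma mul1x x : 1 * x = x.
Proof. by rewrite mulC mulx1. Qed.

Lemma ltSS x y : x < y -> x + 1 < y + 1.
Proof.
move: y; apply: (@delta0_ind (Imp (Lt (Var 1) (Var O)) (Lt (Add (Var 1) One) (Add (Var O) One)))
  (scons x v0) w0) => /=; first by do !constructor.
  by move/mltx0.
by move=> y IH /ltxS [/IH lt|->]; apply/ltxS; [left|right].
Qed.

Lemma lt_addS x y : x < x + y + 1.
Proof.
move: y; apply: (@delta0_ind (Lt (Var 1) (Add (Add (Var 1) (Var O)) One))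
  (scons x v0) w0) => /=; first by constructor.
  by rewrite addx0; apply/ltxS; right.
by move=> y IH; rewrite addxS; apply/ltxS; left.
Qed.

(** A bound on [z] is added first, to make the induction formula [delta0]. *)
Lemma lt_ex x y : x < y -> exists z, y = x + z + 1.
Proof.
move=> xy; suff [z [_]] : exists z, z < y + 1 /\ x + z + 1 = y by exists z.
move: y xy; apply: (@delta0_ind (Imp (Lt (Var 1) (Var O)) (ExN (And (Lt (Var O) (lift_term (Add (Var O) One)))
   (Eq (Add (Add (Var 2) (Var O)) One) (Var 1)))))
  (scons x v0) w0) => /=; first by do 2 constructor; constructor.
  by move/mltx0.
move=> y IH /ltxS [/IH [z [zy xzy]]|->].
  by exists (z + 1); split; [apply: ltSS|rewrite addxS xzy].
exists 0; rewrite addx0; split=> //.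
by have := lt_addS 0 (y + 1); rewrite add0x.
Qed.

Lemma mleP x y : x <= y <-> exists z, y = x + z.
Proof.
split=> [[/lt_ex [z ->]|->]|[z]].
- by exists (z + 1); rewrite addxS.
- by exists 0; rewrite addx0.
have [->|[u ->]] : z = 0 \/ exists u, z = u + 1.
  have [/lt_ex [u]|] : 0 <= z.
  - apply: (@delta0_ind (Or (Lt Zero (Var O)) (Eq Zero (Var O))) v0 w0) => /=;
      first by do !constructor.
      by right.
    by move=> u h; left; apply/ltxS.
  - by rewrite add0x; right; exists u.
  - by left.
- by rewrite addx0 => ->; right.
- by rewrite addxS => ->; left; apply: lt_addS.
Qed.

Lemma add_eq0 x y : x + y = 0 -> x = 0.
Proof.
have : 0 <= y by apply/mleP; exists y; rewrite add0x.
by case=> [/lt_ex [z ->]|<-]; rewrite ?addxS ?addx0 // => /add1_neq0.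
Qed.

Lemma mle_total x y : x <= y \/ y <= x.
Proof.
have le0 (u : dom N) : 0 <= u by apply/mleP; exists u; rewrite add0x.
suff [h|[h|h]] : x < y \/ x = y \/ y < x.
- by do 2 left.
- by left; right.
- by right; left.
move: y; apply: (@delta0_ind (Or (Lt (Var 1) (Var O)) (Or (Eq (Var 1) (Var O)) (Lt (Var O) (Var 1))))
  (scons x v0) w0) => /=; first by do !constructor.
  by case: (le0 x) => h; [right; right|right; left].
move=> y [h|[->|/lt_ex [z ->]]].
- by left; apply/ltxS; left.
- by left; apply/ltxS; right.
have -> : y + z + 1 = (y + 1) + z by rewrite addSx.
right; case: (le0 z) => [/lt_ex [u ->]|<-]; last by left; rewrite addx0.
by right; rewrite addxS; apply: lt_addS.
Qed.

Lemma lt_leS x y : x < y <-> x + 1 <= y.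
Proof.
rewrite mleP; split=> [/lt_ex [z ->]|[z ->]]; first by exists z; rewrite addSx.
by rewrite addSx; apply: lt_addS.
Qed.

End Semiring.

Import Order.TTheory GRing.Theory Num.Theory.

(** * The ordered ring of differences

    It gives access to [lra] for inequalities between numbers of the model. *)

Section Differences.
Variable N : rca.
Local Notation M := (dom N).
Implicit Types x y z : M.

Lemma dom_semiring : semi_ring_theory (mzero N) (mone N) (madd N) (mmul N) eq.
Proof.
split; [exact: add0x|exact: addC|exact: addA|exact: mul1x|exact: mul0x|exact: mulC
  |exact: mulA|exact: mulDl].
Qed.

Add Ring dom_ring : dom_semiring.

(** The pair of x and y stands for the difference x - y. *)
Definition drel (p q : M * M) : Prop := p.1 + q.2 = q.1 + p.2.
Definition diff : Type := {P : M * M -> Prop | exists p, P = drel p}.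
Definition dcls (p : M * M) : diff := exist _ (drel p) (ex_intro _ p erefl).
Definition drep (a : diff) : M * M := projT1 (cid (proj2_sig a)).

Lemma drel_trans p q r : drel p q -> drel q r -> drel p r.
Proof.
case: p q r => [a b] [c d] [e f]; rewrite /drel /= => h h'; apply: (@addI N _ _ d).
transitivity ((a + d) + f); [by ring|rewrite h].
by transitivity ((c + f) + b); [by ring|rewrite h'; ring].
Qed.

Lemma dcls_eq p q : dcls p = dcls q <-> p.1 + q.2 = q.1 + p.2.
Proof.
have sym r s : drel r s -> drel s r by rewrite /drel => ->.
split=> [/(congr1 (@proj1_sig _ _)) /= e|e].
  by apply: sym; rewrite -[drel q p]/((fun r => drel q r) p) -e.
apply: eq_exist; apply: funext => r; apply: propext; split=> h.
  exact: drel_trans (sym _ _ e) h.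
exact: drel_trans e h.
Qed.

Lemma drepK a : dcls (drep a) = a.
Proof.
case: a => P hP; apply: eq_exist; rewrite /drep /=.
by case: (cid hP) => t /= ->.
Qed.

Lemma dclsP a : exists x y, a = dcls (x, y).
Proof. by exists (drep a).1, (drep a).2; rewrite -surjective_pairing drepK. Qed.

Lemma drep_cls p : (drep (dcls p)).1 + p.2 = p.1 + (drep (dcls p)).2.
Proof. by apply/dcls_eq; rewrite drepK. Qed.

Definition dadd a b := dcls ((drep a).1 + (drep b).1, (drep a).2 + (drep b).2).
Definition dopp a := dcls ((drep a).2, (drep a).1).
Definition dmul a b := dcls
  ((drep a).1 * (drep b).1 + (drep a).2 * (drep b).2,
   (drep a).1 * (drep b).2 + (drep a).2 * (drep b).1).

Lemma daddE x y z t : dadd (dcls (x, y)) (dcls (z, t)) = dcls (x + z, y + t).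
Proof.
have := drep_cls (x, y); have := drep_cls (z, t); rewrite /dadd.
case: (drep (dcls (x, y))) => a b; case: (drep (dcls (z, t))) => c d /= h h'.
apply/dcls_eq => /=; transitivity ((a + y) + (c + t)); first by ring.
by rewrite h h'; ring.
Qed.

Lemma doppE x y : dopp (dcls (x, y)) = dcls (y, x).
Proof. by apply/dcls_eq => /=; rewrite addC -(drep_cls (x, y)) addC. Qed.

Lemma dmulE x y z t : dmul (dcls (x, y)) (dcls (z, t)) =
  dcls (x * z + y * t, x * t + y * z).
Proof.
have := drep_cls (x, y); have := drep_cls (z, t); rewrite /dmul.
case: (drep (dcls (x, y))) => a b; case: (drep (dcls (z, t))) => c d /= h h'.
transitivity (dcls (x * c + y * d, x * d + y * c)); apply/dcls_eq => /=.
  transitivity ((a + y) * c + (x + b) * d); first by ring.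
  by transitivity ((x + b) * c + (a + y) * d); [rewrite h'|ring].
transitivity (x * (c + t) + y * (z + d)); first by ring.
by transitivity (x * (z + d) + y * (c + t)); [rewrite h|ring].
Qed.

Lemma daddA : associative dadd.
Proof.
move=> a b c; have [x [y ->]] := dclsP a; have [z [t ->]] := dclsP b.
by have [u [v ->]] := dclsP c; rewrite !daddE !addA.
Qed.

Lemma daddC : commutative dadd.
Proof.
move=> a b; have [x [y ->]] := dclsP a; have [z [t ->]] := dclsP b.
by rewrite !daddE (addC x) (addC y).
Qed.

Lemma dadd0 : left_id (dcls (0, 0)) dadd.
Proof. by move=> a; have [x [y ->]] := dclsP a; rewrite daddE !add0x. Qed.

Lemma daddN : left_inverse (dcls (0, 0)) dopp dadd.
Proof.
move=> a; have [x [y ->]] := dclsP a; rewrite doppE daddE; apply/dcls_eq => /=.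
by rewrite addx0 add0x addC.
Qed.

HB.instance Definition _ := gen_eqMixin diff.
HB.instance Definition _ := gen_choiceMixin diff.
HB.instance Definition _ := GRing.isZmodule.Build diff daddA daddC dadd0 daddN.

Lemma dmulA : associative dmul.
Proof.
move=> a b c; have [x [y ->]] := dclsP a; have [z [t ->]] := dclsP b.
have [u [v ->]] := dclsP c; rewrite !dmulE; congr (dcls (_, _)); ring.
Qed.

Lemma dmulC : commutative dmul.
Proof.
move=> a b; have [x [y ->]] := dclsP a; have [z [t ->]] := dclsP b.
rewrite !dmulE; congr (dcls (_, _)); ring.
Qed.

Lemma dmul1 : left_id (dcls (1, 0)) dmul.
Proof.
move=> a; have [x [y ->]] := dclsP a; rewrite dmulE; congr (dcls (_, _)); ring.
Qed.

Lemma dmulDl : left_distributive dmul dadd.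
Proof.
move=> a b c; have [x [y ->]] := dclsP a; have [z [t ->]] := dclsP b.
have [u [v ->]] := dclsP c; rewrite daddE !dmulE daddE; congr (dcls (_, _)); ring.
Qed.

Lemma done_neq0 : dcls (1, 0) != 0%R.
Proof.
apply/eqP => /dcls_eq /=; rewrite !addx0 => h.
by apply: (@add1_neq0 N 0); rewrite add0x.
Qed.

HB.instance Definition _ := GRing.Zmodule_isComNzRing.Build diff
  dmulA dmulC dmul1 dmulDl done_neq0.

Definition dunit : {pred diff} := fun a => `[< exists b, (b * a = 1)%R >].
Definition dinv (a : diff) : diff :=
  if pselect (exists b, (b * a = 1)%R) is left h then projT1 (cid h) else a.

Lemma dmulVx : {in dunit, left_inverse 1%R dinv *%R}.
Proof.
by move=> a /asboolP ua; rewrite /dinv; case: pselect => // h; case: (cid h).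
Qed.

Lemma dunitPl a b : (b * a = 1)%R -> dunit a.
Proof. by move=> h; apply/asboolP; exists b. Qed.

Lemma dinv_out : {in [predC dunit], dinv =1 id}.
Proof. by move=> a /asboolPn ua; rewrite /dinv; case: pselect. Qed.

HB.instance Definition _ := GRing.ComNzRing_hasMulInverse.Build diff
  dmulVx dunitPl dinv_out.

Definition emb x : diff := dcls (x, 0).

Lemma emb_inj x y : emb x = emb y -> x = y.
Proof. by move/dcls_eq => /=; rewrite !addx0. Qed.

Lemma embD x y : emb (x + y) = (emb x + emb y)%R.
Proof. by rewrite [RHS]daddE addx0. Qed.

Lemma embM x y : emb (x * y) = (emb x * emb y)%R.
Proof. by rewrite [RHS]dmulE; congr (dcls (_, _)); ring. Qed.

Lemma emb0 : emb 0 = 0%R. Proof. by []. Qed.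
Lemma emb1 : emb 1 = 1%R. Proof. by []. Qed.

Lemma diffP (a : diff) : exists x, a = emb x \/ a = (- emb x)%R.
Proof.
have [x [y ->]] := dclsP a; case: (mle_total x y) => /mleP [z ->]; exists z; [right|left].
  by rewrite [RHS]doppE; apply/dcls_eq => /=; ring.
by apply/dcls_eq => /=; ring.
Qed.

Lemma mul_eq0 x y : x * y = 0 -> x = 0 \/ y = 0.
Proof.
have : 0 <= y by apply/mleP; exists y; rewrite add0x.
case=> [/lt_ex [z ->]|<-]; last by right.
by rewrite add0x mulxS addC => /add_eq0; left.
Qed.

Lemma diff_integral : GRing.integral_domain_axiom diff.
Proof.
move=> a b ab.
have [x xE] := diffP a; have [y yE] := diffP b.
have : emb (x * y) = 0%R.
  by rewrite embM; case: xE yE ab => -> [] ->; rewrite ?mulrN ?mulNr ?opprK //;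
    move/eqP; rewrite oppr_eq0 => /eqP.
move/emb_inj => /mul_eq0 [] e; rewrite e emb0 ?oppr0 in xE yE.
  by case: xE => ->; rewrite eqxx.
by case: yE => ->; rewrite eqxx orbT.
Qed.

HB.instance Definition _ := GRing.ComUnitRing_isIntegral.Build diff diff_integral.

Definition dle (a b : diff) : bool := `[< exists x, (b - a)%R = emb x >].
Definition dnorm (a : diff) : diff := if dle 0%R a then a else (- a)%R.

Lemma dle0_add a b : dle 0%R a -> dle 0%R b -> dle 0%R (a + b)%R.
Proof.
move=> /asboolP[x] + /asboolP[y]; rewrite !subr0 => -> ->; apply/asboolP.
by exists (x + y); rewrite subr0 embD.
Qed.

Lemma dle0_mul a b : dle 0%R a -> dle 0%R b -> dle 0%R (a * b)%R.
Proof.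
move=> /asboolP[x] + /asboolP[y]; rewrite !subr0 => -> ->; apply/asboolP.
by exists (x * y); rewrite subr0 embM.
Qed.

Lemma dle0_anti a : dle 0%R a -> dle a 0%R -> a = 0%R.
Proof.
move=> /asboolP[x] + /asboolP[y]; rewrite subr0 sub0r => -> e.
have : emb (x + y) = 0%R by rewrite embD -e subrr.
by move/emb_inj => /add_eq0 ->.
Qed.

Lemma dsub_ge0 a b : dle 0%R (b - a)%R = dle a b.
Proof. by rewrite /dle subr0. Qed.

Lemma dle0_total a : dle 0%R a || dle a 0%R.
Proof.
by have [x [] ->] := diffP a; apply/orP; [left|right]; apply/asboolP; exists x;
  rewrite ?subr0 ?sub0r ?opprK.
Qed.

Lemma dnormN a : dnorm (- a)%R = dnorm a.
Proof.
have sw (b : diff) : dle 0%R (- b)%R = dle b 0%R by rewrite -(dsub_ge0 b) sub0r.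
rewrite /dnorm sw; have := dle0_total a; have := @dle0_anti a.
case: (dle 0%R a) (dle a 0%R) => [] [] //=; last by rewrite opprK.
by move=> -> //; rewrite oppr0.
Qed.

Lemma dge0_norm a : dle 0%R a -> dnorm a = a.
Proof. by rewrite /dnorm => ->. Qed.

HB.instance Definition _ := Num.IntegralDomain_isLeReal.Build diff
  dle0_add dle0_mul dle0_anti dsub_ge0 dle0_total dnormN dge0_norm (fun a b => erefl).

Lemma emb_ge0 x : (0 <= emb x)%R.
Proof. by apply/asboolP; exists x; rewrite subr0. Qed.

Lemma emb_eq x y : x = y <-> emb x = emb y.
Proof. by split=> [->|/emb_inj]. Qed.

Lemma emb_le x y : x <= y <-> (emb x <= emb y)%R.
Proof.
rewrite mleP; split=> [[z ->]|/asboolP [z]].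
  by apply/asboolP; exists z; rewrite embD addrC addKr.
by move=> e; exists z; apply: emb_inj; rewrite embD -e addrC subrK.
Qed.

(** The order of the model is discrete; writing [<] with a gap of 1 lets linear arithmetic exploit
    this. *)
Lemma emb_lt x y : x < y <-> (emb x + 1 <= emb y)%R.
Proof. by rewrite lt_leS emb_le embD. Qed.

Lemma nle_lt x y : ~ x <= y <-> y < x.
Proof.
rewrite emb_le emb_lt; split=> [h|h h']; last by lra.
rewrite -emb1 -embD; apply/emb_le.
case: (mle_total y x) => [[|e]|/emb_le //]; first by rewrite lt_leS.
by case: h; rewrite e.
Qed.

Lemma nlt_le x y : ~ x < y <-> y <= x.
Proof. by split=> [h|h h']; [apply: contrapT => /nle_lt|apply/nle_lt: h]. Qed.

Lemma mle_anti x y : x <= y -> y <= x -> x = y.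
Proof. by rewrite !emb_le emb_eq => h h'; apply/eqP; rewrite eq_le h h'. Qed.

Definition embE := (embD, embM, emb0, emb1).

End Differences.

Ltac emb_hyps := repeat match goal with
  | H : _ /\ _ |- _ => case: H => ? ?
  | H : ~ @eq (dom _) _ _ |- _ => clear H
  | H : ~ mlt _ _ _ |- _ => apply nlt_le in H
  | H : ~ mle _ _ |- _ => apply nle_lt in H
  | H : mlt _ _ _ |- _ => apply emb_lt in H; rewrite ?embE in H
  | H : mle _ _ |- _ => apply emb_le in H; rewrite ?embE in H
  | H : @eq (dom _) _ _ |- _ => apply emb_eq in H; rewrite ?embE in H
  end.

Ltac emb_pos := repeat match goal with
  | |- context [emb ?x] =>
    lazymatch goal with
    | _ : is_true (0 <= emb x)%R |- _ => fail
    | _ => have := emb_ge0 x; move=> ?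
    end
  | _ : context [emb ?x] |- _ =>
    lazymatch goal with
    | _ : is_true (0 <= emb x)%R |- _ => fail
    | _ => have := emb_ge0 x; move=> ?
    end
  end.

(** Statements about numbers become linear inequalities between differences. Only single numbers
    receive nonnegativity facts from [emb_pos]; for a product, [mle0x] has to be supplied by
    hand. *)
Ltac mlra :=
  lazymatch goal with
  | |- @eq (dom _) _ _ => apply: mle_anti; mlra
  | |- mlt _ _ _ => apply/emb_lt; rewrite ?embE; emb_hyps; emb_pos; lra
  | |- mle _ _ => apply/emb_le; rewrite ?embE; emb_hyps; emb_pos; lra
  | |- _ -> _ => intro; mlra
  | |- ~ _ => intro; mlra
  | |- False => emb_hyps; emb_pos; lra
  | _ => exfalso; mlra
  end.

(** * Definability *)

Section Pairing.
Variable N : rca.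
Local Notation M := (dom N).
Implicit Types x y z : M.

Add Ring dom_ring2 : (dom_semiring N).

Definition pr x y : M := (x + y) * (x + y) + x.

Lemma lt_sq x y : x < y -> x * x + x + x + 1 <= y * y.
Proof.
case/lt_ex => z ->; apply/mleP; exists (z * z + x * z + x * z + z + z); ring.
Qed.

Lemma le_sq x : x <= x * x.
Proof.
have [->|/lt_ex [z ->]] : x = 0 \/ 0 < x.
- by case: (mle_total x 0) => [[/mltx0 //|->]|[|->]]; [left|right|left].
- by right; rewrite mulx0.
apply/mleP; exists (z * z + z); ring.
Qed.

(** Pairs of sum s have codes from s^2 to s^2 + s, all below (s + 1)^2. So the code determines the
    sum, and cancellation then gives the first component. *)
Lemma pr_inj x y x' y' : pr x y = pr x' y' -> x = x' /\ y = y'.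
Proof.
have mono a b a' b' : a + b < a' + b' -> pr a b < pr a' b'.
  by move/lt_sq => h; rewrite /pr; mlra.
move=> e; have s : x + y = x' + y'.
  by case: (mle_total (x + y) (x' + y')) => -[/mono|//]; rewrite e => h; mlra.
have xx : x = x' by move: e; rewrite /pr s ![_ + x]addC ![_ + x']addC; apply: addI.
by split=> //; move: s; rewrite xx ![x' + _]addC; apply: addI.
Qed.

Lemma le_pr1 x y : x <= pr x y.
Proof. by apply/mleP; exists ((x + y) * (x + y)); rewrite addC. Qed.

Lemma le_pr2 x y : y <= pr x y.
Proof. by have := le_sq (x + y); rewrite /pr; mlra. Qed.

(** The default on numbers that code no pair keeps both projections total and at most their
    argument, so that they can be bounded in formulas. *)
Definition unpr z : M * M :=
  if pselect (exists p, z = pr p.1 p.2) is left h then projT1 (cid h) else (0, 0).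
Definition pi1 z : M := (unpr z).1.
Definition pi2 z : M := (unpr z).2.

Lemma unpr_pr x y : unpr (pr x y) = (x, y).
Proof.
rewrite /unpr; case: pselect => [h|[]]; last by exists (x, y).
by case: (cid h) => -[a b] /= /pr_inj [-> ->].
Qed.

Lemma pi1_pr x y : pi1 (pr x y) = x. Proof. by rewrite /pi1 unpr_pr. Qed.
Lemma pi2_pr x y : pi2 (pr x y) = y. Proof. by rewrite /pi2 unpr_pr. Qed.

Lemma unprP z : z = pr (pi1 z) (pi2 z) \/
  (forall x y, z <> pr x y) /\ pi1 z = 0 /\ pi2 z = 0.
Proof.
case: (pselect (exists x y, z = pr x y)) => [[x [y ->]]|no].
  by left; rewrite pi1_pr pi2_pr.
right; split=> [x y zE|]; first by case: no; exists x, y.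
rewrite /pi1 /pi2 /unpr; case: pselect => // -[[x y] zE].
by case: no; exists x, y.
Qed.

Lemma mle0x x : 0 <= x. Proof. by mlra. Qed.

Lemma pi1_le z : pi1 z <= z.
Proof.
case: (unprP z) => [{2}->|[_ [-> _]]]; first exact: le_pr1; exact: mle0x.
Qed.

Lemma pi2_le z : pi2 z <= z.
Proof.
case: (unprP z) => [{2}->|[_ [_ ->]]]; first exact: le_pr2; exact: mle0x.
Qed.

End Pairing.

Section Definability.
Variable N : rca.
Local Notation M := (dom N).
Implicit Types (P Q : M -> Prop) (f g : M -> M) (x y z : M).

Let v0 : nat -> M := fun _ => 0.
Let w0 : nat -> sets N := fun _ => rca_set N.

Lemma comprehension p q v w : delta0 p -> delta0 q ->
  (forall x, (exists y, sat N (scons y (scons x v)) w p) <->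
             (forall y, sat N (scons y (scons x v)) w q)) ->
  exists X, forall x, mem N x X <-> exists y, sat N (scons y (scons x v)) w p.
Proof.
move=> dp dq pq.
have [x|X h] := @rcaP N _ (RCA0s_comprehension p q dp dq) v w.
  by case: (pq x).
exists X => x; have [h1 h2] := h x.
have E : sat N (scons x v) (scons X w) (lift_set (ExN p)) <-> sat N (scons x v) w (ExN p).
  exact: sat_subst.
by split=> [/h1 /E|/E /h2].
Qed.

(** Moves a formula from the context u, y, x, v to y, x, u, z, v, where z codes the pair of x and
    y. *)
Definition unshift2 (n : nat) : term :=
  match n with 0 => Var 2 | 1 => Var 0 | 2 => Var 1 | S (S (S m)) => Var (S (S (S (S m)))) end.

Definition PR (s t : term) : term := Add (Mul (Add s t) (Add s t)) s.

Definition BEx (t : term) (p : form) : form := ExN (And (Lt (Var O) (lift_term t)) p).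
Definition BAll (t : term) (p : form) : form := AllN (Imp (Lt (Var O) (lift_term t)) p).

Definition graph_form (p : form) : form :=
  BEx (Add (Var 1) One) (BEx (Add (Var 2) One)
    (And (Eq (Var 3) (PR (Var 1) (Var 0))) (subst unshift2 (fun X => X) p))).

Lemma graph_formP p v w u z : sat N (scons u (scons z v)) w (graph_form p) <->
  exists x y, z = pr x y /\ sat N (scons u (scons y (scons x v))) w p.
Proof.
have sh x y : (fun n => eval N (scons y (scons x (scons u (scons z v)))) (unshift2 n))
    = scons u (scons y (scons x v)) by apply: funext => -[|[|[|n]]].
split=> [[x [_ [y [_ [/= zE /sat_subst]]]]]|[x [y [zE h]]]].
  by rewrite sh; exists x, y.
exists x; split; first by rewrite /= zE; apply/ltxS/le_pr1.
exists y; split; first by rewrite /= zE; apply/ltxS/le_pr2.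
by split=> //; apply/sat_subst; rewrite sh.
Qed.

Lemma delta0_graph_form p : delta0 p -> delta0 (graph_form p).
Proof. by move=> dp; do 3 constructor; [constructor|apply: delta0_subst]. Qed.

Lemma graph_comprehension p q v w : delta0 p -> delta0 q ->
  (forall x y, (exists u, sat N (scons u (scons y (scons x v))) w p) <->
             (forall u, sat N (scons u (scons y (scons x v))) w q)) ->
  exists X, forall x y, mem N (pr x y) X <->
    exists u, sat N (scons u (scons y (scons x v))) w p.
Proof.
move=> dp dq pq; have [] := @comprehension (graph_form p) (graph_form q) v w.
- exact: delta0_graph_form.
- exact: delta0_graph_form.
- move=> z; split=> [[u /graph_formP [x [y [-> h]]]] t|h].
    by apply/graph_formP; exists x, y; split=> //; apply: (pq x y).1; exists u.
  have /graph_formP [x [y [zE _]]] := h 0.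
  have [t|u hu] := (pq x y).2 _; last by exists u; apply/graph_formP; exists x, y.
  by have /graph_formP [x' [y' []]] := h t; rewrite zE => /pr_inj [<- <-].
move=> X XP; exists X => x y; rewrite XP; split=> -[u].
  by case/graph_formP => x' [y' [/pr_inj [<- <-]]]; exists u.
by move=> h; exists u; apply/graph_formP; exists x, y.
Qed.

Lemma comprehension0 p v w : delta0 p ->
  exists X, forall x, mem N x X <-> sat N (scons x v) w p.
Proof.
move=> dp; have E u x : sat N (scons u (scons x v)) w (lift_num p) <-> sat N (scons x v) w p.
  exact: sat_subst.
have dl : delta0 (lift_num p) by apply: delta0_subst.
have [x|X XP] := @comprehension _ _ v w dl dl.
  by split=> [[u /E h] t|h]; [apply/E|exists 0; apply: h].
by exists X => x; rewrite XP; split=> [[u /E]//|h]; exists 0; apply/E.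
Qed.

Lemma graph_comprehension0 p v w : delta0 p ->
  exists X, forall x y, mem N (pr x y) X <-> sat N (scons y (scons x v)) w p.
Proof.
move=> dp; have E u (v' : nat -> M) : sat N (scons u v') w (lift_num p) <-> sat N v' w p.
  exact: sat_subst.
have dl : delta0 (lift_num p) by apply: delta0_subst.
have [x y|X XP] := @graph_comprehension _ _ v w dl dl.
  by split=> [[u /E h] t|h]; [apply/E|exists 0; apply: h].
by exists X => x y; rewrite XP; split=> [[u /E]//|h]; exists 0; apply/E.
Qed.

(** [D1] and [F1] single out the predicates and functions that belong to the model. Closure
    properties replace the writing of formulas from here on. *)
Definition D1 P : Prop := exists X, forall x, mem N x X <-> P x.
Definition F1 f : Prop := exists X, forall x y, mem N (pr x y) X <-> f x = y.

Lemma D1_ext P Q : (forall x, P x <-> Q x) -> D1 P -> D1 Q.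
Proof. by move=> PQ [X XP]; exists X => x; rewrite XP. Qed.

Lemma D1_imp P Q : D1 P -> D1 Q -> D1 (fun x => P x -> Q x).
Proof.
move=> [X XP] [Y YQ].
have [|Z ZP] := @comprehension0 (Imp (In (Var O) 0) (In (Var O) 1)) v0 (scons X (scons Y w0)).
  by do !constructor.
by exists Z => x; rewrite ZP /= XP YQ.
Qed.

Lemma D1_False : D1 (fun _ => False).
Proof. by have [|X XP] := @comprehension0 Bot v0 w0; [constructor|exists X]. Qed.

Lemma D1_True : D1 (fun _ => True).
Proof. by have [X XP] := D1_imp D1_False D1_False; exists X => x; rewrite XP. Qed.

Lemma D1_not P : D1 P -> D1 (fun x => ~ P x).
Proof. by move=> dP; apply: D1_imp D1_False. Qed.

Lemma D1_or P Q : D1 P -> D1 Q -> D1 (fun x => P x \/ Q x).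
Proof.
move=> dP dQ; apply: D1_ext (D1_imp (D1_not dP) dQ) => x.
by split=> [h|[h //|//]]; case: (pselect (P x)) => [|/h]; [left|right].
Qed.

Lemma D1_and P Q : D1 P -> D1 Q -> D1 (fun x => P x /\ Q x).
Proof.
move=> dP dQ; apply: D1_ext (D1_not (D1_imp dP (D1_not dQ))) => x.
split=> [h|[p q] /(_ p)//].
split; apply: contrapT => np; apply: h => // p; by case: np.
Qed.

Lemma D1_iff P Q : D1 P -> D1 Q -> D1 (fun x => P x <-> Q x).
Proof. by move=> dP dQ; apply: D1_and; apply: D1_imp. Qed.

(** As [f] is total and single-valued, the composite can be written both with an existential and
    with a universal quantifier over the value, and Delta1 comprehension applies. *)
Lemma D1_comp P f : D1 P -> F1 f -> D1 (fun x => P (f x)).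
Proof.
move=> [X XP] [F Ff].
have [|||Z ZP] := @comprehension (And (In (PR (Var 1) (Var O)) 1) (In (Var O) 0))
  (Imp (In (PR (Var 1) (Var O)) 1) (In (Var O) 0)) v0 (scons X (scons F w0)).
- by do !constructor.
- by do !constructor.
- move=> x /=; split=> [[y]|h].
    by rewrite -/(pr x y) Ff => -[<- h] z; rewrite -/(pr x z) Ff => <-.
  by exists (f x); split; [apply/Ff|apply: h; apply/Ff].
exists Z => x; rewrite ZP /= -XP; split=> [[y]|h].
  by rewrite -/(pr x y) Ff => -[<-].
by exists (f x); split=> //; apply/Ff.
Qed.

Lemma F1_id : F1 (fun x => x).
Proof.
have [|X XP] := @graph_comprehension0 (Eq (Var 1) (Var O)) v0 w0; first by constructor.
by exists X.
Qed.

Lemma F1_const c : F1 (fun _ => c).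
Proof.
have [|X XP] := @graph_comprehension0 (Eq (Var 2) (Var O)) (scons c v0) w0; first by constructor.
by exists X.
Qed.

Lemma F1_comp g f : F1 g -> F1 f -> F1 (fun x => g (f x)).
Proof.
move=> [G Gg] [F Ff].
have [|||Z ZP] := @graph_comprehension
  (And (In (PR (Var 2) (Var O)) 1) (In (PR (Var O) (Var 1)) 0))
  (Imp (In (PR (Var 2) (Var O)) 1) (In (PR (Var O) (Var 1)) 0)) v0 (scons G (scons F w0)).
- by do !constructor.
- by do !constructor.
- move=> x y /=; split=> [[u]|h].
    by rewrite -/(pr x u) Ff => -[<- h] z; rewrite -/(pr x z) Ff => <-.
  by exists (f x); split; [apply/Ff|apply: h; apply/Ff].
exists Z => x y; rewrite ZP /= -Gg; split=> [[u]|h].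
  by rewrite -/(pr x u) Ff => -[<-].
by exists (f x); split=> //; apply/Ff.
Qed.

Lemma F1_pr f g : F1 f -> F1 g -> F1 (fun x => pr (f x) (g x)).
Proof.
move=> [F Ff] [G Gg].
have [|Z ZP] := @graph_comprehension0
  (BEx (Add (Var O) One) (BEx (Add (Var 1) One) (And (In (PR (Var 3) (Var 1)) 0)
    (And (In (PR (Var 3) (Var O)) 1) (Eq (PR (Var 1) (Var O)) (Var 2)))))) v0 (scons F (scons G w0)).
  by do !constructor.
exists Z => x y; rewrite ZP /=; split=> [[u [_ [t [_ []]]]]|<-].
  by rewrite -/(pr x u) -/(pr x t) Ff Gg => -> [-> <-].
exists (f x); split; first by apply/ltxS/le_pr1.
exists (g x); split; first by apply/ltxS/le_pr2.
by split; [apply/Ff|split; [apply/Gg|]].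
Qed.

Let not_pair_form (s : term) : form :=
  BAll (Add s One) (BAll (Add (lift_term s) One)
    (Neg (Eq (lift_term (lift_term s)) (PR (Var 1) (Var O))))).

Let not_pairP s v w : sat N v w (not_pair_form s) <-> forall x y, eval N v s <> pr x y.
Proof.
have lt v' x t : eval N (scons x v') (subst_term (fun n => Var (S n)) t) = eval N v' t.
  by rewrite eval_subst.
split=> [h x y e|h x _ y _ /=]; last by rewrite !lt; apply: h.
apply: (h x _ y) => /=; rewrite !lt // e; apply/ltxS; [exact: le_pr1|exact: le_pr2].
Qed.

Lemma F1_pi1 : F1 (@pi1 N).
Proof.
(* The second disjunct gives the default 0 on numbers that code no pair. *)
have [|X XP] := @graph_comprehension0 (Or (BEx (Add (Var 1) One) (Eq (Var 2) (PR (Var 1) (Var O))))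
  (And (not_pair_form (Var 1)) (Eq (Var O) Zero))) v0 w0.
  by do !constructor.
exists X => x y; rewrite XP; split=> [[[u [_ /= ->]]|[/not_pairP /= np ->]]|<-].
- by rewrite -/(pr y u) pi1_pr.
- by case: (unprP x) => [/np //|[_ []]].
case: (unprP x) => [e|[np [-> _]]]; last by right; split=> //; apply/not_pairP.
by left; exists (pi2 x); split=> //=; apply/ltxS/pi2_le.
Qed.

Lemma F1_pi2 : F1 (@pi2 N).
Proof.
have [|X XP] := @graph_comprehension0 (Or (BEx (Add (Var 1) One) (Eq (Var 2) (PR (Var O) (Var 1))))
  (And (not_pair_form (Var 1)) (Eq (Var O) Zero))) v0 w0.
  by do !constructor.
exists X => x y; rewrite XP; split=> [[[u [_ /= ->]]|[/not_pairP /= np ->]]|<-].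
- by rewrite -/(pr u y) pi2_pr.
- by case: (unprP x) => [/np //|[_ []]].
case: (unprP x) => [e|[np [_ ->]]]; last by right; split=> //; apply/not_pairP.
by left; exists (pi1 x); split=> //=; apply/ltxS/pi1_le.
Qed.

(** Makes the two projections of the argument available to [p] as variables 1 and 0, through their
    graphs and with bounded quantifiers. *)
Let split_form (p : form) : form :=
  BEx (Add (Var O) One) (BEx (Add (Var 1) One) (And (In (PR (Var 2) (Var 1)) 0)
    (And (In (PR (Var 2) (Var O)) 1) p))).

Let splitP (P1 P2 : sets N) p x v w :
  (forall x y, mem N (pr x y) P1 <-> pi1 x = y) ->
  (forall x y, mem N (pr x y) P2 <-> pi2 x = y) ->
  sat N (scons x v) (scons P1 (scons P2 w)) (split_form p) <->
  sat N (scons (pi2 x) (scons (pi1 x) (scons x v))) (scons P1 (scons P2 w)) p.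
Proof.
move=> e1 e2; split=> [[u [_ [t [_ /= []]]]]|h].
  by rewrite -/(pr x u) -/(pr x t) e1 e2 => <- [<-].
exists (pi1 x); split; first by apply/ltxS/pi1_le.
exists (pi2 x); split; first by apply/ltxS/pi2_le.
by split; [apply/e1|split; [apply/e2|]].
Qed.

(** The relation is comprehended once, on codes of pairs, and then composed with the pairing of [f]
    and [g]. *)
Lemma D1_eq f g : F1 f -> F1 g -> D1 (fun x => f x = g x).
Proof.
move=> Ff Fg; have [[P1 e1] [P2 e2]] := (F1_pi1, F1_pi2).
have [|X XP] := @comprehension0 (split_form (Eq (Var 1) (Var O))) v0 (scons P1 (scons P2 w0)).
  by do !constructor.
apply: (@D1_ext (fun x => mem N (pr (f x) (g x)) X)) => [x|].
  by rewrite XP splitP //= pi1_pr pi2_pr.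
by apply: (@D1_comp (fun x => mem N x X)); [exists X|apply: F1_pr].
Qed.

Lemma D1_lt f g : F1 f -> F1 g -> D1 (fun x => f x < g x).
Proof.
move=> Ff Fg; have [[P1 e1] [P2 e2]] := (F1_pi1, F1_pi2).
have [|X XP] := @comprehension0 (split_form (Lt (Var 1) (Var O))) v0 (scons P1 (scons P2 w0)).
  by do !constructor.
apply: (@D1_ext (fun x => mem N (pr (f x) (g x)) X)) => [x|].
  by rewrite XP splitP //= pi1_pr pi2_pr.
by apply: (@D1_comp (fun x => mem N x X)); [exists X|apply: F1_pr].
Qed.

Lemma D1_le f g : F1 f -> F1 g -> D1 (fun x => f x <= g x).
Proof. by move=> Ff Fg; apply: D1_or; [apply: D1_lt|apply: D1_eq]. Qed.

Lemma D1_mem f X : F1 f -> D1 (fun x => mem N (f x) X).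
Proof. by move=> Ff; apply: (@D1_comp (fun x => mem N x X)) => //; exists X. Qed.

Lemma F1_graph f : D1 (fun z => f (pi1 z) = pi2 z) -> F1 f.
Proof. by case=> X XP; exists X => x y; rewrite XP pi1_pr pi2_pr. Qed.

Lemma F1_ext f g : (forall x, f x = g x) -> F1 f -> F1 g.
Proof. by move=> fg [X XP]; exists X => x y; rewrite XP fg. Qed.

Let F1_op (o : term -> term -> term) (h : M -> M -> M) f g :
  (forall v s t, eval N v (o s t) = h (eval N v s) (eval N v t)) ->
  F1 f -> F1 g -> F1 (fun x => h (f x) (g x)).
Proof.
move=> oh Ff Fg; have [[P1 e1] [P2 e2]] := (F1_pi1, F1_pi2).
have [|X XP] := @graph_comprehension0
  (BEx (Add (Var 1) One) (BEx (Add (Var 2) One) (And (In (PR (Var 3) (Var 1)) 0)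
    (And (In (PR (Var 3) (Var O)) 1) (Eq (o (Var 1) (Var O)) (Var 2)))))) v0 (scons P1 (scons P2 w0)).
  by do !constructor.
apply: (@F1_ext (fun x => (fun z => h (pi1 z) (pi2 z)) (pr (f x) (g x)))) => [x|].
  by rewrite pi1_pr pi2_pr.
apply: (@F1_comp (fun z => h (pi1 z) (pi2 z))); last exact: F1_pr.
exists X => x y; rewrite XP /=; split=> [[u [_ [t [_ []]]]]|<-].
  by rewrite -/(pr x u) -/(pr x t) e1 e2 oh => -> [-> <-].
exists (pi1 x); split; first by apply/ltxS/pi1_le.
exists (pi2 x); split; first by apply/ltxS/pi2_le.
by split; [apply/e1|split; [apply/e2|rewrite oh]].
Qed.

Lemma F1_add f g : F1 f -> F1 g -> F1 (fun x => f x + g x).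
Proof. exact: (@F1_op Add). Qed.

Lemma F1_mul f g : F1 f -> F1 g -> F1 (fun x => f x * g x).
Proof. exact: (@F1_op Mul). Qed.

(** The bound [f x] is made the second component of a pair; it then is a variable, and the formula
    stays [delta0]. *)
Lemma D1_all_lt f (P : M -> M -> Prop) : F1 f -> D1 (fun z => P (pi1 z) (pi2 z)) ->
  D1 (fun x => forall y, y < f x -> P x y).
Proof.
move=> Ff [X XP]; have [[P1 e1] [P2 e2]] := (F1_pi1, F1_pi2).
have [|Y YP] := @comprehension0 (split_form (BAll (Var O) (In (PR (Var 2) (Var O)) 2)))
    v0 (scons P1 (scons P2 (scons X w0))).
  by do !constructor.
apply: (@D1_ext (fun x => mem N (pr x (f x)) Y)) => [x|].
  rewrite YP splitP //= pi1_pr pi2_pr; split=> h y /h; rewrite -/(pr x y) XP;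
    by rewrite pi1_pr pi2_pr.
by apply: D1_mem; apply: F1_pr => //; apply: F1_id.
Qed.

Lemma D1_ex_lt f (P : M -> M -> Prop) : F1 f -> D1 (fun z => P (pi1 z) (pi2 z)) ->
  D1 (fun x => exists y, y < f x /\ P x y).
Proof.
move=> Ff dP; have := D1_not (D1_all_lt (P := fun x y => ~ P x y) Ff (D1_not dP)).
apply: D1_ext => x; split=> [h|[y [yf p]] /(_ _ yf)//].
by apply: contrapT => no; apply: h => y yf p; apply: no; exists y.
Qed.

Lemma D1_all_le f (P : M -> M -> Prop) : F1 f -> D1 (fun z => P (pi1 z) (pi2 z)) ->
  D1 (fun x => forall y, y <= f x -> P x y).
Proof.
move=> Ff dP; have := D1_all_lt (F1_add Ff (F1_const 1)) dP.
by apply: D1_ext => x; split=> h y yf; apply: h; apply/ltxS.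
Qed.

Lemma D1_ex_le f (P : M -> M -> Prop) : F1 f -> D1 (fun z => P (pi1 z) (pi2 z)) ->
  D1 (fun x => exists y, y <= f x /\ P x y).
Proof.
move=> Ff dP; have := D1_ex_lt (F1_add Ff (F1_const 1)) dP.
by apply: D1_ext => x; split=> -[y [/ltxS yf h]]; exists y.
Qed.

Lemma D1_delta1 (P Q : M -> M -> Prop) :
  D1 (fun z => P (pi1 z) (pi2 z)) -> D1 (fun z => Q (pi1 z) (pi2 z)) ->
  (forall x, (exists y, P x y) <-> (forall y, Q x y)) -> D1 (fun x => exists y, P x y).
Proof.
move=> [X XP] [Y YQ] PQ.
have [|||Z ZP] := @comprehension (In (PR (Var 1) (Var O)) 0)
  (In (PR (Var 1) (Var O)) 1) v0 (scons X (scons Y w0)).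
- by constructor.
- by constructor.
- move=> x /=; split=> [[y]|h].
    rewrite -/(pr x y) XP pi1_pr pi2_pr => h z.
    by rewrite -/(pr x z) YQ pi1_pr pi2_pr; apply: (PQ x).1; exists y.
  have [y|y h'] := (PQ x).2 _.
    by have := h y; rewrite -/(pr x y) YQ pi1_pr pi2_pr.
  by exists y; rewrite -/(pr x y) XP pi1_pr pi2_pr.
exists Z => x; rewrite ZP /=; split=> -[y]; rewrite -?/(pr x y) ?XP ?pi1_pr ?pi2_pr => h;
  by exists y; rewrite -?/(pr x y) ?XP ?pi1_pr ?pi2_pr.
Qed.

Definition If (p : Prop) x y : M := if pselect p then x else y.

Lemma IfT (p : Prop) x y : p -> If p x y = x.
Proof. by rewrite /If; case: pselect. Qed.

Lemma IfF (p : Prop) x y : ~ p -> If p x y = y.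
Proof. by rewrite /If; case: pselect. Qed.

Lemma F1_if P f g : D1 P -> F1 f -> F1 g -> F1 (fun x => If (P x) (f x) (g x)).
Proof.
move=> dP Ff Fg; apply: F1_graph.
apply: (@D1_ext (fun z => (P (pi1 z) -> f (pi1 z) = pi2 z) /\ (~ P (pi1 z) -> g (pi1 z) = pi2 z))).
  by move=> z; case: (pselect (P (pi1 z))) => h; [rewrite IfT|rewrite IfF] => //; split=> [[? ?]|?]; auto.
have dP1 := D1_comp dP (F1_pi1); have f1 := F1_comp Ff F1_pi1; have g1 := F1_comp Fg F1_pi1.
by apply: D1_and; apply: D1_imp => //; try apply: D1_not => //; apply: D1_eq => //; apply: F1_pi2.
Qed.

Lemma D1_ind P : D1 P -> P 0 -> (forall x, P x -> P (x + 1)) -> forall x, P x.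
Proof.
move=> [X XP] P0 PS x; apply/XP; move: x.
apply: (@delta0_ind N (In (Var O) 0) v0 (scons X w0)) => /=; first by constructor.
  exact/XP.
by move=> x /XP /PS /XP.
Qed.

Lemma D1_least P x : D1 P -> P x -> exists y, P y /\ forall z, z < y -> ~ P z.
Proof.
move=> dP px; apply: contrapT => no.
have : forall y, forall z, z < y -> ~ P z.
  apply: D1_ind.
  - by apply: D1_all_lt F1_id _; apply: D1_not; apply: D1_comp dP F1_pi2.
  - by move=> z /mltx0.
  - by move=> y IH z /ltxS [/IH //|->] py; apply: no; exists y.
by move=> /(_ (x + 1) x); apply=> //; mlra.
Qed.

(** Stated for arbitrary arguments so that the tactic [d1] below can apply
    hypotheses of this form inside larger predicates. *)
Definition Rel1 (P : M -> Prop) : Prop := forall f, F1 f -> D1 (fun x => P (f x)).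
Definition Rel2 (P : M -> M -> Prop) : Prop :=
  forall f g, F1 f -> F1 g -> D1 (fun x => P (f x) (g x)).
Definition Rel3 (P : M -> M -> M -> Prop) : Prop :=
  forall f g h, F1 f -> F1 g -> F1 h -> D1 (fun x => P (f x) (g x) (h x)).
Definition Fun1 (F : M -> M) : Prop := forall f, F1 f -> F1 (fun x => F (f x)).
Definition Fun2 (F : M -> M -> M) : Prop :=
  forall f g, F1 f -> F1 g -> F1 (fun x => F (f x) (g x)).

Definition Fun3 (F : M -> M -> M -> M) : Prop :=
  forall f g h, F1 f -> F1 g -> F1 h -> F1 (fun x => F (f x) (g x) (h x)).

Lemma Fun1_F1 f : F1 f -> Fun1 f.
Proof. by move=> Ff g Fg; apply: F1_comp. Qed.

Lemma Fun1_pi1 : Fun1 (@pi1 N). Proof. exact: Fun1_F1 F1_pi1. Qed.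
Lemma Fun1_pi2 : Fun1 (@pi2 N). Proof. exact: Fun1_F1 F1_pi2. Qed.

Lemma Rel1_set P : Rel1 P -> exists X, forall x, mem N x X <-> P x.
Proof. by move=> RP; apply: (RP (fun x => x)) F1_id. Qed.

Lemma Rel1_ind P : Rel1 P -> P 0 -> (forall x, P x -> P (x + 1)) -> forall x, P x.
Proof. by move=> RP; apply: D1_ind; apply: RP F1_id. Qed.

Lemma Rel1_least P x : Rel1 P -> P x -> exists y, P y /\ forall z, z < y -> ~ P z.
Proof. by move=> RP; apply: D1_least; apply: RP F1_id. Qed.

(** Choosing the least witness makes the graph definable: minimality only needs a quantifier bounded
    by the value. *)
Lemma Rel2_mu (Q : M -> M -> Prop) : Rel2 Q -> (forall x, exists y, Q x y) ->
  exists f, Fun1 f /\ forall x, Q x (f x) /\ forall y, y < f x -> ~ Q x y.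
Proof.
move=> RQ Qex.
have /boolp.choice[f fP] : forall x, exists y, Q x y /\ forall z, z < y -> ~ Q x z.
  by move=> x; have [y] := Qex x; apply: D1_least; apply: RQ F1_id; apply: F1_const.
exists f; split=> //; apply: Fun1_F1; apply: F1_graph.
apply: (@D1_ext (fun z => Q (pi1 z) (pi2 z) /\ forall y, y < pi2 z -> ~ Q (pi1 z) y)).
  move=> z; have [h1 h2] := fP (pi1 z); split=> [[q least]|<- //].
  apply: mle_anti; apply/nlt_le; first by move=> /h2.
  by move=> /least.
apply: D1_and; first exact: RQ F1_pi1 F1_pi2.
apply: (D1_all_lt (P := fun z y => ~ Q (pi1 z) y)) F1_pi2 _; apply: D1_not.
by apply: RQ; [apply: F1_comp; apply: F1_pi1|apply: F1_pi2].
Qed.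

End Definability.

(** The tactic [d1] decomposes a definability goal along its syntax; this hook is extended when
    [exp2] and [Bit] become available. *)
Ltac d1_user := fail.
Ltac d1_step := first
  [ assumption
  | match goal with |- Rel1 _ => intros ? ? | |- Rel2 _ => intros ? ? ? ? | |- Rel3 _ => intros ? ? ? ? ? ?
     | |- Fun1 _ => intros ? ? | |- Fun2 _ => intros ? ? ? ?
     | |- Fun3 _ => intros ? ? ? ? ? ? end
  | apply D1_False | apply D1_True | apply F1_id | apply F1_const
  | apply D1_not | apply D1_and | apply D1_or | apply D1_iff | apply D1_imp
  | apply D1_all_lt | apply D1_all_le | apply D1_ex_lt | apply D1_ex_le
  | apply D1_lt | apply D1_le | apply D1_eq | apply D1_mem
  | apply F1_if | apply F1_add | apply F1_mul | apply F1_pr | apply Fun1_pi1 | apply Fun1_pi2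
  | match goal with
    | H : F1 _ |- F1 _ => apply (Fun1_F1 H)
    | H : Rel1 _ |- D1 _ => apply H
    | H : Rel2 _ |- D1 _ => apply H
    | H : Rel3 _ |- D1 _ => apply H
    | H : Fun1 _ |- F1 _ => apply H
    | H : Fun2 _ |- F1 _ => apply H
    | H : Fun3 _ |- F1 _ => apply H
    end
  | d1_user ].
Ltac d1 := repeat (cbv beta; d1_step).

(** * Exponentiation and codes of finite sets *)

Section Exponential.
Variable N : rca.
Local Notation M := (dom N).
Implicit Types x y z : M.

Add Ring dom_ring3 : (dom_semiring N).

Lemma div_uniq m q u q' u' : u < m -> u' < m -> q * m + u = q' * m + u' ->
  q = q' /\ u = u' :> M.
Proof.
have no a b r s : r < m -> s < m -> a < b -> a * m + r = b * m + s -> False.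
  move=> rm sm /lt_ex [z ->].
  have -> : (a + z + 1) * m + s = a * m + (z * m + m + s) by ring.
  have := mle0x (z * m); mlra.
move=> um um' e; have qq : q = q'.
  by apply: mle_anti; apply/nlt_le => lt; [apply: no lt (esym e)|apply: no lt e].
by split=> //; move: e; rewrite qq ![_ * _ + _]addC; apply: addI.
Qed.

(** The quotient is bounded by [a], which is harmless as the modulus is positive, and makes the
    relation definable with bounded quantifiers. *)
Definition Beta (a b i u : M) : Prop :=
  u < 1 + (i + 1) * b /\ exists q, q <= a /\ a = q * (1 + (i + 1) * b) + u.

Lemma BetaP a b i u : Beta a b i u <->
  u < 1 + (i + 1) * b /\ exists q, a = q * (1 + (i + 1) * b) + u.
Proof.
split=> -[h [q]]; first by case=> _ ?; split=> //; exists q.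
move=> e; split=> //; exists q; split=> //; rewrite e.
have -> : q * (1 + (i + 1) * b) + u = q + (q * ((i + 1) * b) + u) by ring.
by apply/mleP; eexists.
Qed.

Lemma Beta_uniq a b i u u' : Beta a b i u -> Beta a b i u' -> u = u'.
Proof. by move=> [h [q [_ ->]]] [h' [q' [_ /(div_uniq h h') []]]]. Qed.

Lemma Beta_le a b i u : Beta a b i u -> u <= a.
Proof. by move=> [_ [q [_ ->]]]; apply/mleP; eexists; rewrite addC. Qed.

(** [w] codes the pair of parameters of a beta sequence [1, 2, ..., y = 2^x]. *)
Definition Pow (w x y : M) : Prop :=
  Beta (pi1 w) (pi2 w) 0 1 /\
  (forall i, i < x -> exists u, u <= pi1 w /\
     (Beta (pi1 w) (pi2 w) i u /\ Beta (pi1 w) (pi2 w) (i + 1) (u + u))) /\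
  Beta (pi1 w) (pi2 w) x y.

Lemma Rel3_Pow : Rel3 Pow.
Proof. by rewrite /Pow /Beta; d1. Qed.

Lemma Pow_total x : exists y w, Pow w x y.
Proof.
have [y [a [b [/BetaP h0 [hS /BetaP hx]]]]] :=
  @rcaP N _ RCA0s_exp (fun _ => 0) (fun _ => rca_set N) x.
exists y, (pr a b); rewrite /Pow pi1_pr pi2_pr; split=> //; split=> // i /hS.
by case=> u [/BetaP hu /BetaP hu']; exists u; split=> //; apply: Beta_le hu.
Qed.

(** Induction on the index. The values are bounded by the codes, so the induction statement is
    bounded. *)
Lemma Pow_agree w w' x y y' : Pow w x y -> Pow w' x y' ->
  forall i, i <= x -> forall u, u <= pi1 w -> forall u', u' <= pi1 w' ->
    Beta (pi1 w) (pi2 w) i u -> Beta (pi1 w') (pi2 w') i u' -> u = u'.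
Proof.
move=> [h0 [hS _]] [h0' [hS' _]]; apply: Rel1_ind.
- by rewrite /Beta; d1.
- by move=> _ u _ u' _ /(Beta_uniq h0) <- /(Beta_uniq h0') <-.
- move=> i IH ix; have ix' : i < x by mlra.
  have [v [lv [bv /Beta_uniq bv']]] := hS i ix'.
  have [t [lt [bt /Beta_uniq bt']]] := hS' i ix'.
  move=> u _ u' _ /bv' <- /bt' <-.
  suff -> : v = t by [].
  by apply: IH => //; left.
Qed.

Lemma Pow_uniq w w' x y y' : Pow w x y -> Pow w' x y' -> y = y'.
Proof.
move=> h h'; have [_ [_ b]] := h; have [_ [_ b']] := h'.
apply: (Pow_agree h h' (or_intror erefl) _ _ b b'); [exact: Beta_le b|exact: Beta_le b'].
Qed.

Lemma Pow0 w y : Pow w 0 y -> y = 1.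
Proof. by move=> [h [_ h']]; apply: Beta_uniq h' h. Qed.

Lemma PowS w x y : Pow w (x + 1) y -> exists u, Pow w x u /\ y = u + u.
Proof.
move=> [h0 [hS h]]; have [|u [lu [hu hu']]] := hS x; first by mlra.
exists u; split; last exact: Beta_uniq h hu'.
by split=> //; split=> // i ix; apply: hS; mlra.
Qed.

Definition exp2 x : M := projT1 (cid (Pow_total x)).

Lemma Pow_exp2 x : exists w, Pow w x (exp2 x).
Proof. exact: (projT2 (cid (Pow_total x))). Qed.

Lemma exp2_Pow w x y : Pow w x y -> exp2 x = y.
Proof. by have [w'] := Pow_exp2 x; apply: Pow_uniq. Qed.

Lemma exp2_0 : exp2 0 = 1.
Proof. by have [w /Pow0] := Pow_exp2 0. Qed.

Lemma exp2S x : exp2 (x + 1) = exp2 x + exp2 x.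
Proof. by have [w /PowS [u [/exp2_Pow -> ->]]] := Pow_exp2 (x + 1). Qed.

(** All codes of the sequence of powers yield the same last value, so the graph is both Sigma1 and
    Pi1. *)
Lemma Fun1_exp2 : Fun1 exp2.
Proof.
apply: Fun1_F1; apply: F1_graph.
have RP := Rel3_Pow.
apply: (@D1_ext _ (fun z => exists w, Pow w (pi1 z) (pi2 z))).
  by move=> z; split=> [[w /exp2_Pow]|<-] //; apply: Pow_exp2.
apply: (@D1_delta1 _ (fun z w => Pow w (pi1 z) (pi2 z))
  (fun z w => forall y, y <= pi1 w -> Pow w (pi1 z) y -> y = pi2 z)).
- by d1.
- by d1.
move=> z; split=> [[w h] w' y _ h'|h]; first exact: Pow_uniq h' h.
have [w h'] := Pow_exp2 (pi1 z); exists w; rewrite -(h w (exp2 (pi1 z))) //.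
by case: h' => _ [_ /Beta_le].
Qed.

Ltac d1_user ::= first [apply Fun1_exp2].

Lemma exp2_add x y : exp2 (x + y) = exp2 x * exp2 y.
Proof.
move: y; apply: Rel1_ind; first by d1.
  by rewrite addx0 exp2_0 mulx1.
by move=> y IH; rewrite addxS !exp2S IH; ring.
Qed.

Lemma exp2_gt x : x + 1 <= exp2 x.
Proof.
move: x; apply: Rel1_ind; first by d1.
  by rewrite exp2_0 add0x; right.
by move=> x IH; rewrite exp2S; have := mle0x x; mlra.
Qed.

Lemma exp2_gt0 x : 1 <= exp2 x.
Proof. by have := exp2_gt x; mlra. Qed.

Lemma exp2_le x y : x <= y -> exp2 x <= exp2 y.
Proof.
case/mleP => z ->; move: z; apply: Rel1_ind; first by d1.
  by rewrite addx0; right.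
by move=> z IH; rewrite addxS exp2S; have := mle0x (exp2 (x + z)); mlra.
Qed.

Lemma exp2_lt x y : x < y -> exp2 x + exp2 x <= exp2 y.
Proof. by rewrite -exp2S => h; apply: exp2_le; mlra. Qed.

Lemma div_ex m x : 0 < m -> exists q r, r < m /\ x = q * m + r.
Proof.
move=> m0; suff [q [_ [r [rm e]]]] : exists q, q <= x /\ exists r, r < m /\ x = q * m + r.
  by exists q, r.
move: x; apply: Rel1_ind; first by d1.
  by exists 0; split; [right|exists 0; split=> //; rewrite mul0x add0x].
move=> x [q [qx [r [rm e]]]].
case: (pselect (r + 1 < m)) => h.
  exists q; split; first by mlra.
  by exists (r + 1); split=> //; rewrite e addxS.
exists (q + 1); split; first by mlra.
exists 0; split=> //; have -> : m = r + 1 by mlra.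
rewrite e; have -> : m = r + 1 by mlra.
ring.
Qed.

(** Binary digit [i] of [c] is 1: the quotient by [exp2 i] is odd. *)
Definition Bit (i c : M) : Prop := exists q, q <= c /\ exists r, r < exp2 i /\ c = (q + q + 1) * exp2 i + r.

Lemma Rel2_Bit : Rel2 Bit.
Proof. by rewrite /Bit; d1. Qed.

Lemma Bit1 i q r : r < exp2 i -> Bit i ((q + q + 1) * exp2 i + r).
Proof.
move=> h; exists q; split; last by exists r.
have [z ->] : exists z, exp2 i = 1 + z by have /mleP := exp2_gt0 i.
by apply/mleP; exists (q + 1 + (q + q + 1) * z + r); ring.
Qed.

Lemma odd_neq_even x y : x + x + 1 = y + y -> False.
Proof. by case: (mle_total x y) => -[]; mlra. Qed.

Lemma Bit0 i q r : r < exp2 i -> ~ Bit i ((q + q) * exp2 i + r).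
Proof.
move=> h [q' [_ [r' [h' e]]]].
by have [/esym/odd_neq_even] := div_uniq h h' e.
Qed.

Lemma BitP c i : exists q r, r < exp2 i /\
  ((c = (q + q) * exp2 i + r /\ ~ Bit i c) \/ (c = (q + q + 1) * exp2 i + r /\ Bit i c)).
Proof.
have [|q [r [ri ->]]] := @div_ex (exp2 i) c; first by have := exp2_gt0 i; mlra.
have [|p [b [b2 ->]]] := @div_ex (1 + 1) q; first by mlra.
exists p, r; split=> //.
have [->|->] : b = 0 \/ b = 1.
- by case: (pselect (b = 0)) => [|n0]; [left|right; case: (mle0x b) => [|/esym//]; mlra].
- have -> : p * (1 + 1) + 0 = p + p by ring.
  by left; split=> //; apply: Bit0.
- have -> : p * (1 + 1) + 1 = p + p + 1 by ring.
  by right; split=> //; apply: Bit1.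
Qed.

Lemma Bit_high c n i : c < exp2 n -> n <= i -> ~ Bit i c.
Proof.
move=> cn /exp2_le ni [q [_ [r [_ e]]]].
have : (q + q + 1) * exp2 i + r = exp2 i + ((q + q) * exp2 i + r) by ring.
have := mle0x ((q + q) * exp2 i + r); mlra.
Qed.

Lemma Bit_add c n i : i < n -> Bit i (c + exp2 n) <-> Bit i c.
Proof.
case/lt_ex => z ->; rewrite exp2S exp2_add.
have [q [r [ri [[-> nb]|[-> b]]]]] := BitP c i.
  split=> // h; exfalso; move: h.
  have -> : (q + q) * exp2 i + r + (exp2 i * exp2 z + exp2 i * exp2 z) =
    (q + exp2 z + (q + exp2 z)) * exp2 i + r by ring.
  exact: Bit0.
split=> // _.
have -> : (q + q + 1) * exp2 i + r + (exp2 i * exp2 z + exp2 i * exp2 z) =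
    (q + exp2 z + (q + exp2 z) + 1) * exp2 i + r by ring.
exact: Bit1.
Qed.

Lemma Bit_top c n : c < exp2 n -> Bit n (c + exp2 n).
Proof.
move=> cn; have -> : c + exp2 n = (0 + 0 + 1) * exp2 n + c by ring.
exact: Bit1.
Qed.

Lemma Bit_double c b i : b <= 1 -> Bit (i + 1) (c + c + b) <-> Bit i c.
Proof.
move=> b1; have [q [r [ri [[-> nb]|[-> bt]]]]] := BitP c i.
  split=> // h; exfalso; move: h.
  have -> : (q + q) * exp2 i + r + ((q + q) * exp2 i + r) + b =
    (q + q) * exp2 (i + 1) + (r + r + b) by rewrite exp2S; ring.
  by apply: Bit0; rewrite exp2S; mlra.
split=> // _.
have -> : (q + q + 1) * exp2 i + r + ((q + q + 1) * exp2 i + r) + b =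
    (q + q + 1) * exp2 (i + 1) + (r + r + b) by rewrite exp2S; ring.
by apply: Bit1; rewrite exp2S; mlra.
Qed.

Lemma Bit_odd c : Bit 0 (c + c + 1).
Proof.
have -> : c + c + 1 = (c + c + 1) * exp2 0 + 0 by rewrite exp2_0; ring.
by apply: Bit1; rewrite exp2_0; mlra.
Qed.

Lemma Bit_even c : ~ Bit 0 (c + c).
Proof.
have -> : c + c = (c + c) * exp2 0 + 0 by rewrite exp2_0; ring.
by apply: Bit0; rewrite exp2_0; mlra.
Qed.

Ltac d1_user ::= first [apply Fun1_exp2 | apply Rel2_Bit].

(** The bound [exp2 n] makes the existence of the code a bounded statement, which is proved by
    induction on [n], adding [exp2 n] when [P n] holds. *)
Lemma code_ex (P : M -> Prop) n : Rel1 P ->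
  exists c, c < exp2 n /\ forall i, i < n -> (Bit i c <-> P i).
Proof.
move=> RP; move: n; apply: Rel1_ind; first by d1.
  by exists 0; split=> [|i /mltx0//]; rewrite exp2_0; mlra.
move=> n [c [cn h]]; case: (pselect (P n)) => pn.
  exists (c + exp2 n); split=> [|i /ltxS [iN|->]]; first by rewrite exp2S; mlra.
    by rewrite Bit_add // h.
  by split=> // _; apply: Bit_top.
exists c; split=> [|i /ltxS [/h//|->]]; first by rewrite exp2S; have := exp2_gt0 n; mlra.
by split=> [bt|/pn//]; case: (Bit_high cn (or_intror erefl) bt).
Qed.

End Exponential.

Ltac d1_user ::= first [apply Fun1_exp2 | apply Rel2_Bit].

(** * Bounded recursion and counting *)

Section Recursion.
Variable N : rca.
Local Notation M := (dom N).
Implicit Types x y z n : M.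

Variable g : M -> M -> M -> M.
Hypothesis Fun3_g : Fun3 g.
Hypothesis g_le : forall x n u, u <= n -> g x n u <= n + 1.

(** [c] codes the graph of an initial segment of the sequence with parameter
    [x] defined by iterating [g], up to the index [n]. *)
Let trace c x n : Prop :=
  Bit (pr 0 0) c /\
  (forall j, j < n -> forall v, v <= j -> Bit (pr j v) c -> Bit (pr (j + 1) (g x j v)) c) /\
  (forall j, j <= n -> forall v, v <= j -> forall v', v' <= j ->
     Bit (pr j v) c -> Bit (pr j v') c -> v = v').

Let Rel3_trace : Rel3 trace. Proof. by rewrite /trace; d1. Qed.

Lemma pr_le x y x' y' : x <= x' -> y <= y' -> pr x y <= pr x' y'.
Proof.
move=> /mleP [a ->] /mleP [b ->]; rewrite /pr; apply/mleP.
by exists ((x + y) * (a + b) + (a + b) * (x + y) + (a + b) * (a + b) + a); rewrite !(mulDl, mulDr); mlra.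
Qed.

Let trace_val c x n : trace c x n -> exists u, u <= n /\ Bit (pr n u) c.
Proof.
move=> [t0 [tS _]]; suff: n <= n -> exists u, u <= n /\ Bit (pr n u) c by apply; right.
move: {-2}n; apply: Rel1_ind; first by d1.
  by move=> _; exists 0; split=> //; right.
move=> j IH jn; have [|u [uj b]] := IH; first by mlra.
exists (g x j u); split; first exact: g_le.
by apply: tS => //; mlra.
Qed.

Let trace_le c x n m : m <= n -> trace c x n -> trace c x m.
Proof.
move=> mn [t0 [tS tU]]; split=> //; split=> [j jm|j jm]; first by apply: tS; mlra.
by apply: tU; mlra.
Qed.

Let trace_ex x n : exists c, c < exp2 (pr n n + 1) /\ trace c x n.
Proof.
move: n; apply: Rel1_ind; first by d1.
  have [|c [cE cP]] := @code_ex N (fun p => p = pr 0 0) (pr 0 0 + 1); first by d1.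
  exists c; split=> //; split; first by apply/cP => //; mlra.
  split=> [j /mltx0//|j [/mltx0//|->] v [/mltx0//|->] v' [/mltx0//|->]//].
move=> n [c [_ tc]]; have [u [un bu]] := trace_val tc.
(* Restricting the old code to indices up to [n] discards whatever it may contain at index
   [n + 1]. *)
have [|c' [cE cP]] := @code_ex N (fun p => (pi1 p <= n /\ Bit p c) \/ p = pr (n + 1) (g x n u))
  (pr (n + 1) (n + 1) + 1).
  by d1.
have old j v : j <= n -> v <= j -> Bit (pr j v) c' <-> Bit (pr j v) c.
  move=> jn vj; rewrite cP; last first.
    by apply/ltxS; apply: pr_le; mlra.
  rewrite pi1_pr; split=> [[[]//|/pr_inj [e _]]|b]; last by left.
  by mlra.
have new v : v <= n + 1 -> Bit (pr (n + 1) v) c' <-> v = g x n u.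
  move=> vn; rewrite cP; last by apply/ltxS; apply: pr_le; mlra.
  rewrite pi1_pr; split=> [[[? _]|/pr_inj []//]|->]; last by right.
  by mlra.
case: tc => t0 [tS tU]; exists c'; split=> //; split; last split.
- by apply/old => //; [apply: mle0x|right].
- move=> j /ltxS [jn|->] v vj.
    rewrite old //; last by left.
    move=> b; apply/old; [by mlra|exact: g_le|exact: tS].
  rewrite old //; last by right.
  move=> b; rewrite (tU n _ v vj u) //; last by right.
  by apply/new => //; apply: g_le.
move=> j [/ltxS jn|->] v vj v' vj'; first by rewrite !old //; apply: tU.
by rewrite !new // => -> ->.
Qed.

Let trace_agree c c' x n : trace c x n -> trace c' x n -> forall j, j <= n ->
  forall v, v <= j -> Bit (pr j v) c -> Bit (pr j v) c'.
Proof.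
move=> [t0 [tS tU]] tc'; have [t0' [tS' tU']] := tc'.
apply: Rel1_ind; first by d1.
  by move=> _ v [/mltx0//|->].
move=> j IH jn v vj b.
have [|u [uj bu]] := @trace_val c x j; first by apply: trace_le (conj t0 (conj tS tU)); mlra.
have jn' : j < n by mlra.
have -> : v = g x j u by apply: (tU _ jn _ vj _ _ b); [apply: g_le|apply: tS].
by apply: tS' => //; apply: IH => //; left.
Qed.

Lemma bounded_recursion : exists F, Fun2 F /\
  forall x, F x 0 = 0 /\ forall n, F x (n + 1) = g x n (F x n) /\ F x n <= n.
Proof.
(* Parameter and index are packed into [z]; the search for a trace is bounded, so minimisation
   yields the value. *)
pose Q z u := exists c, c < exp2 (pr (pi2 z) (pi2 z) + 1) /\ (trace c (pi1 z) (pi2 z) /\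
  (u <= pi2 z /\ Bit (pr (pi2 z) u) c)).
have [||F [FF FP]] := @Rel2_mu N Q; first by rewrite /Q; d1.
  move=> z; have [c [cE tc]] := trace_ex (pi1 z) (pi2 z).
  by have [u [un bu]] := trace_val tc; exists u, c.
exists (fun x n => F (pr x n)); split; first by d1.
have FE x n : exists c, trace c x n /\ (F (pr x n) <= n /\ Bit (pr n (F (pr x n))) c).
  by move: (FP (pr x n)); rewrite /Q pi1_pr pi2_pr => -[[c [_ h]] _]; exists c.
move=> x; split=> [|n]; first by have [c [_ [[/mltx0|//]]]] := FE x 0.
have [c [tc [le b]]] := FE x (n + 1); have [c' [tc' [le' b']]] := FE x n.
split=> //; have tcn : trace c x n by apply: trace_le tc; mlra.
have b'' : Bit (pr n (F (pr x n))) c by apply: (trace_agree tc' tcn) b' => //; right.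
case: tc => _ [tS tU]; apply: (tU (n + 1) _ _ le) => //; [by right|exact: g_le|].
by apply: tS => //; mlra.
Qed.

End Recursion.

(** * Counting functions and the pigeonhole principle *)

Section Counting.
Variable N : rca.
Local Notation M := (dom N).
Implicit Types (x y z n m s p : M) (P : M -> Prop) (k : M -> M).

(** The recursion equations of the number of elements of [P] below the argument. *)
Definition counts P k : Prop := k 0 = 0 /\ forall n, k (n + 1) = If (P n) (k n + 1) (k n).

Lemma count_ex (P : M -> M -> Prop) : Rel2 P ->
  exists K : M -> M -> M, Fun2 K /\ forall x, counts (P x) (K x).
Proof.
move=> RP; have [||K [FK KP]] := @bounded_recursion N (fun x n u => If (P x n) (u + 1) u).
- by d1.
- move=> x n u un; case: (pselect (P x n)) => h; [rewrite IfT|rewrite IfF] => //; by mlra.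
by exists K; split=> // x; have [h h'] := KP x; split=> // n; case: (h' n).
Qed.

Lemma count1_ex P : Rel1 P -> exists k, Fun1 k /\ counts P k.
Proof.
move=> RP; have [|K [FK KP]] := @count_ex (fun _ => P); first by d1.
by exists (K 0); split=> //; d1.
Qed.

Section Facts.
Variables (P : M -> Prop) (k : M -> M).
Hypotheses (kP : counts P k) (Fk : Fun1 k).

Lemma countST n : P n -> k (n + 1) = k n + 1.
Proof. by move=> h; rewrite (proj2 kP) IfT. Qed.

Lemma countSF n : ~ P n -> k (n + 1) = k n.
Proof. by move=> h; rewrite (proj2 kP) IfF. Qed.

Lemma countS_le n : k n <= k (n + 1).
Proof. by case: (pselect (P n)) => h; [rewrite countST //; mlra|rewrite countSF //; right]. Qed.

Lemma count_mono n m : n <= m -> k n <= k m.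
Proof.
case/mleP => z ->; move: z; apply: Rel1_ind; first by d1.
  by rewrite addx0; right.
by move=> z IH; have := countS_le (n + z); rewrite addxS; mlra.
Qed.

Lemma count_lt n m : P n -> n < m -> k n < k m.
Proof.
move=> /countST e nm; have nm1 : n + 1 <= m by mlra.
by have := count_mono nm1; rewrite e; mlra.
Qed.

Lemma count_inj n m : P n -> P m -> k n = k m -> n = m.
Proof.
by move=> Pn Pm e; apply: mle_anti; apply/nlt_le => lt;
  [have := count_lt Pm lt|have := count_lt Pn lt]; rewrite e; mlra.
Qed.

Lemma count_onto i n : Rel1 P -> i < k n -> exists y, y < n /\ (P y /\ k y = i).
Proof.
move=> RP; move: n; apply: Rel1_ind; first by d1.
  by rewrite (proj1 kP) => /mltx0.
move=> n IH; case: (pselect (P n)) => h.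
  rewrite countST // => /ltxS [/IH [y [yn hy]]|->].
    by exists y; split=> //; mlra.
  by exists n; split; [mlra|].
rewrite countSF // => /IH [y [yn hy]].
by exists y; split=> //; mlra.
Qed.

Lemma count_le1 n : Rel1 P ->
  (forall x y, x < n -> y < n -> P x -> P y -> x = y) -> k n <= 1.
Proof.
move=> RP uniq; apply/nlt_le => h.
have [|x [xn [Px kx]]] := @count_onto 0 n RP; first by mlra.
have [//|y [yn [Py ky]]] := @count_onto 1 n RP.
by move: kx; rewrite (uniq x y) // ky => /esym e; apply: (@add1_neq0 N 0); rewrite add0x.
Qed.

End Facts.

Lemma count_ext P k Q l n : counts P k -> counts Q l -> Fun1 k -> Fun1 l ->
  (forall y, y < n -> (P y <-> Q y)) -> k n = l n.
Proof.
move=> [k0 kS] [l0 lS] Fk Fl PQ; suff: n <= n -> k n = l n by apply; right.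
move: {-2}n; apply: Rel1_ind; first by d1.
  by rewrite k0 l0.
move=> m IH mn; rewrite kS lS IH; last by mlra.
by rewrite (propext (PQ m _)) //; mlra.
Qed.

Lemma count_all P k n : counts P k -> Fun1 k -> (forall y, y < n -> P y) -> k n = n.
Proof.
move=> kP Fk all; suff: n <= n -> k n = n by apply; right.
move: {-2}n; apply: Rel1_ind; first by d1.
  by case: kP.
by move=> m IH mn; rewrite (countST kP) ?IH //; [mlra|apply: all; mlra].
Qed.

(** Let [T q] count the elements of colour below [q]. Passing to [q + 1] adds the class [K q], hence
    at most [s] elements below [v], and induction on [q] gives the bound. *)
Lemma pigeonhole (D : M -> Prop) (h kD : M -> M) (K : M -> M -> M) s p v :
  Rel1 D -> Fun1 h -> Fun1 kD -> Fun2 K -> counts D kD ->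
  (forall q, counts (fun y => D y /\ h y = q) (K q)) ->
  (forall y, y < v -> D y -> h y < p) -> (forall q, q < p -> K q v <= s) ->
  kD v <= s * p.
Proof.
move=> RD Fh FkD FK kDP KP hp Ks.
have [|T [FT TP]] := @count_ex (fun q y => D y /\ h y < q); first by d1.
have TS q : forall n, T (q + 1) n = T q n + K q n.
  apply: Rel1_ind; first by d1.
    by rewrite (proj1 (TP _)) (proj1 (TP _)) (proj1 (KP _)) addx0.
  move=> n IH; case: (pselect (D n)) => Dn; last first.
    by rewrite (countSF (TP _)) ?(countSF (TP _)) ?(countSF (KP _)) //; case.
  case: (pselect (h n < q)) => hq.
    rewrite (countST (TP _)); last by split=> //; mlra.
    rewrite (countST (TP _)) // (countSF (KP _)) ?IH; first by mlra.
    by move=> [_ e]; mlra.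
  case: (pselect (h n = q)) => hq'.
    rewrite (countST (TP _)); last by split=> //; mlra.
    rewrite (countSF (TP _)) ?(countST (KP _)) ?IH //; first by mlra.
    by case.
  rewrite (countSF (TP _)); last by move=> [_ /ltxS []].
  by rewrite (countSF (TP _)) ?(countSF (KP _)) //; case.
have Tle : forall q, q <= p -> T q v <= s * q.
  apply: Rel1_ind; first by d1.
    move=> _; rewrite mulx0; right.
    have [|k0 [Fk0 k0P]] := @count1_ex (fun _ => False); first by d1.
    have e : T 0 v = k0 v.
      by apply: (count_ext (TP 0) k0P); [d1|d1|move=> y _; split=> // -[_ /mltx0]].
    rewrite e; apply: (Rel1_ind (P := fun n => k0 n = 0)); first by d1.
      by case: k0P.
    by move=> n IH; rewrite (countSF k0P).
  move=> q IH qp; rewrite TS mulxS.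
  have := Ks q; have := IH; move=> h1 h2.
  have {}h1 : T q v <= s * q by apply: h1; mlra.
  have {}h2 : K q v <= s by apply: h2; mlra.
  by mlra.
have <- : T p v = kD v; last by apply: Tle; right.
apply: (count_ext (TP p) kDP) => // [|y yv]; first by d1.
by split=> [[]|Dy] //; split=> //; apply: hp.
Qed.

Lemma php (f : M -> M) n : Fun1 f -> (forall i, i <= n -> f i < n) ->
  (forall i j, i <= n -> j <= n -> f i = f j -> i = j) -> False.
Proof.
move=> Ff fn inj.
have [|k [Fk kP]] := @count1_ex (fun _ => True).
  by d1.
have RT : Rel1 (fun _ : M => True) by d1.
have [|K [FK KP]] := @count_ex (fun q y => True /\ f y = q); first by d1.
have := @pigeonhole (fun _ => True) f k K 1 n (n + 1) RT Ff Fk FK kP KP.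
rewrite (count_all kP) // mul1x => h.
suff : n + 1 <= n by mlra.
apply: h => [y /ltxS yn _|q qn]; first exact: fn.
apply: (count_le1 (KP q)); [by d1|by d1|].
by move=> x y /ltxS xn /ltxS yn [_ ex] [_ ey]; apply: inj => //; rewrite ex.
Qed.

(** If [p] were missed, sending [n] to [p] would extend [f] to an injection of [n + 1] numbers into
    [n]. *)
Lemma inj_onto (f : M -> M) n p : Fun1 f -> (forall i, i < n -> f i < n) ->
  (forall i j, i < n -> j < n -> f i = f j -> i = j) -> p < n ->
  exists i, i < n /\ f i = p.
Proof.
move=> Ff fn inj pn; apply: contrapT => no.
have miss i : i < n -> f i <> p by move=> iN e; apply: no; exists i.
apply: (@php (fun i => If (i < n) (f i) p) n); first by d1.
  move=> i _; case: (pselect (i < n)) => h; [rewrite IfT|rewrite IfF] => //; exact: fn.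
move=> i j [iN|->] [jn|->] //; rewrite ?(IfT _ _ iN) ?(IfT _ _ jn) ?IfF //; try by mlra.
- exact: inj.
- by move/(miss _ iN).
- by move/esym/(miss _ jn).
Qed.

End Counting.

(** * ADS *)

Section ADS.
Variable N : rca.
Local Notation M := (dom N).
Implicit Types (x y z i j k n p q : M) (R A F : sets N).

Add Ring dom_ring4 : (dom_semiring N).

Lemma mlt_total x y : x < y \/ x = y \/ y < x.
Proof.
by case: (mle_total x y) => -[h|h]; [left|right; left|right; right|right; left].
Qed.

Definition is_linear R : Prop :=
  (forall x, mem N (pr x x) R) /\
  (forall x y, mem N (pr x y) R /\ mem N (pr y x) R -> x = y) /\
  (forall x y z, mem N (pr x y) R /\ mem N (pr y z) R -> mem N (pr x z) R) /\
  (forall x y, mem N (pr x y) R \/ mem N (pr y x) R).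

Definition is_fun F : Prop :=
  (forall i, exists x, mem N (pr i x) F) /\
  (forall i x y, mem N (pr i x) F /\ mem N (pr i y) F -> x = y).

Definition is_unbounded A : Prop := forall n, exists x, mem N x A /\ n < x.

Definition ads_set R A : Prop := is_unbounded A /\
  ((forall x y, mem N x A /\ mem N y A -> (x <= y <-> mem N (pr x y) R)) \/
   (forall x y, mem N x A /\ mem N y A -> (x <= y <-> mem N (pr y x) R))).

Definition ads_seq R F : Prop := is_fun F /\
  ((forall i j x y, i < j /\ mem N (pr i x) F /\ mem N (pr j y) F ->
      mem N (pr x y) R /\ x <> y) \/
   (forall i j x y, i < j /\ mem N (pr i x) F /\ mem N (pr j y) F ->
      mem N (pr y x) R /\ x <> y)).

Lemma is_funP F : is_fun F ->
  exists f : M -> M, Fun1 f /\ forall i x, mem N (pr i x) F <-> f i = x.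
Proof.
move=> [/boolp.choice[f fP] uniq]; exists f.
have fF i x : mem N (pr i x) F <-> f i = x.
  by split=> [h|<- //]; apply: (uniq i); split.
by split=> //; apply: Fun1_F1; exists F.
Qed.

Lemma Fun1_graph (f : M -> M) : Fun1 f ->
  exists F, is_fun F /\ forall i x, mem N (pr i x) F <-> f i = x.
Proof.
move=> Ff; have [F FP] := Ff _ (F1_id N); exists F; split=> //.
split=> [i|i x y]; first by exists (f i); apply/FP.
by rewrite !FP => -[<- <-].
Qed.

(** The records of an injective sequence: there are unboundedly many by the
    pigeonhole principle, and a record at [i] is at least [i]. *)
Lemma records (s : M -> M) (Q : M -> M -> Prop) : Fun1 s ->
  (forall x, Q x x) -> (forall x y, Q x y -> Q y x -> x = y) ->
  (forall i j, i < j -> Q (s i) (s j) /\ s i <> s j) ->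
  exists A, is_unbounded A /\
    forall x y, mem N x A /\ mem N y A -> (x <= y <-> Q x y).
Proof.
move=> Fs Qr Qa Qs.
have inj i j : s i = s j -> i = j.
  by move=> e; case: (mlt_total i j) => [|[//|]] /Qs [_]; rewrite e.
(* Bounding the index by the value loses no record and makes [A] definable. *)
have [|A AP] := @Rel1_set N (fun x => exists i, i <= x /\
    (s i = x /\ forall j, j < i -> s j < x)); first by d1.
exists A; split=> [n|x y].
  have [i ni] : exists i, n < s i.
    apply: contrapT => no; apply: (@php N s (n + 1)) => // [i _|i j _ _ /inj //].
    by apply/ltxS; apply/nlt_le => ni; apply: no; exists i.
  (* The first index whose value exceeds [n] is a record. *)
  have [|{ni}i [ni least]] := @Rel1_least N (fun i => n < s i) _ _ ni; first by d1.
  have small j : j < i -> s j < s i by move=> /least ji; mlra.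
  exists (s i); split=> //; apply/AP; exists i; split=> //.
  apply/nlt_le => si; apply: (@php N s (s i)) => // [j ji|j j' _ _ /inj //].
  by apply: small; mlra.
rewrite !AP => -[[i [_ [<- ri]]] [j [_ [<- rj]]]].
case: (mlt_total i j) => [ij|[->|ji]].
- by split=> _; [case: (Qs _ _ ij)|left; apply: rj].
- by split=> _; [apply: Qr|right].
- have [Qji ne] := Qs _ _ ji; have := ri _ ji.
  by split=> [|Qij]; [mlra|case: ne; apply: Qa].
Qed.

Lemma ads_seq_set R F : is_linear R -> ads_seq R F -> exists A, ads_set R A.
Proof.
move=> [rR [aR _]] [/is_funP [s [Fs sF]] [up|down]].
  have [|||A [unb AP]] := @records s (fun x y => mem N (pr x y) R) Fs.
  - exact: rR.
  - by move=> x y h h'; apply: aR.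
  - by move=> i j ij; apply: (up i j); rewrite !sF.
  by exists A; split=> //; left.
have [|||A [unb AP]] := @records s (fun x y => mem N (pr y x) R) Fs.
- exact: rR.
- by move=> x y h h'; apply: aR.
- by move=> i j ij; apply: (down i j); rewrite !sF.
by exists A; split=> //; right.
Qed.

(** The excess of [l] over [k] never decreases, and it grows at [w]. *)
Lemma count_sub_lt (P Q : M -> Prop) (k l : M -> M) n : counts P k -> counts Q l ->
  Fun1 k -> Fun1 l -> (forall z, P z -> Q z) ->
  k n <= l n /\ forall w, w < n -> Q w /\ ~ P w -> k n < l n.
Proof.
move=> kP lQ Fk Fl PQ.
have le : forall n, k n <= l n.
  apply: Rel1_ind; first by d1.
    by rewrite (proj1 kP) (proj1 lQ); right.
  move=> m IH; case: (pselect (P m)) => Pm.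
    by rewrite (countST kP) // (countST lQ); [mlra|apply: PQ].
  by rewrite (countSF kP) //; have := countS_le lQ m; mlra.
split=> [//|w]; case/lt_ex => z -> [Qw Pw].
have e : w + z + 1 = (w + 1) + z by ring.
rewrite e; move: z {e}; apply: Rel1_ind; first by d1.
  by rewrite addx0 (countSF kP) // (countST lQ) //; have := le w; mlra.
move=> z IH; rewrite addxS; case: (pselect (P (w + 1 + z))) => Pm.
  by rewrite (countST kP) // (countST lQ); [mlra|apply: PQ].
by rewrite (countSF kP) //; have := countS_le lQ (w + 1 + z); mlra.
Qed.

Lemma le_mul x y x' y' : x <= x' -> y <= y' -> x * y <= x' * y'.
Proof.
move=> /mleP [u ->] /mleP [v ->]; apply/mleP; exists (x * v + u * y + u * v); ring.
Qed.

(** * Runs of consecutive ranks, and monotone sequences from ADS *)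

Section Windows.
Variable R : sets N.
Hypothesis linR : is_linear R.

Let rl x y : Prop := mem N (pr x y) R.
Let sl x y : Prop := rl x y /\ x <> y.

Let rlxx x : rl x x. Proof. exact: (proj1 linR). Qed.
Let rl_anti x y : rl x y -> rl y x -> x = y.
Proof. by case: linR => _ [h _] xy yx; apply: h. Qed.
Let rl_trans x y z : rl x y -> rl y z -> rl x z.
Proof. by case: linR => _ [_ [h _]] xy yz; apply: h (conj xy yz). Qed.
Let rl_total x y : rl x y \/ rl y x.
Proof. by case: linR => _ [_ [_ h]]; apply: h. Qed.
Let sl_rl_trans x y z : sl x y -> rl y z -> sl x z.
Proof.
move=> [xy ne] yz; split; first exact: rl_trans xy yz.
by move=> e; apply: ne; apply: rl_anti xy _; rewrite e.
Qed.
Let rl_sl_trans x y z : rl x y -> sl y z -> sl x z.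
Proof.
move=> xy [yz ne]; split; first exact: rl_trans xy yz.
by move=> e; apply: ne; apply: rl_anti yz _; rewrite -e.
Qed.
Let nrl_sl x y : ~ rl x y -> sl y x.
Proof.
move=> nxy; split; first by case: (rl_total x y).
by move=> e; apply: nxy; rewrite e; apply: rlxx.
Qed.

Let Rel2_rl : Rel2 rl. Proof. by rewrite /rl; d1. Qed.
Let Rel2_sl : Rel2 sl. Proof. by rewrite /sl; d1. Qed.

Let rank_ex : exists K : M -> M -> M, Fun2 K /\ forall x, counts (fun y => sl y x) (K x).
Proof. by apply: (@count_ex N (fun x y => sl y x)); d1. Qed.
(** [rank x n] is the number of elements of [[0, n)] strictly below [x]. *)
Let rank := projT1 (cid rank_ex).
Let Fun2_rank : Fun2 rank := proj1 (projT2 (cid rank_ex)).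
Let rankP x : counts (fun y => sl y x) (rank x) := proj2 (projT2 (cid rank_ex)) x.
Let Fun1_rank x : Fun1 (rank x). Proof. by d1. Qed.

Let rank_le x y n : rl x y -> rank x n <= rank y n.
Proof.
move=> xy; apply: (proj1 (count_sub_lt n (rankP x) (rankP y) _ _ _)) => // z zx.
exact: sl_rl_trans zx xy.
Qed.

Let rank_lt x y n : sl x y -> x < n -> rank x n < rank y n.
Proof.
move=> xy xn; apply: (proj2 (count_sub_lt n (rankP x) (rankP y) _ _ _) x) => //.
  by move=> z [zx _]; apply: rl_sl_trans xy.
by split=> // -[].
Qed.

Let rank_sl x y n : rank x n < rank y n -> sl x y.
Proof. by move=> h; apply: nrl_sl => /(rank_le n); mlra. Qed.

Let rank_bound x n : x < n -> rank x n < n.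
Proof.
have idc : counts (fun _ : M => True) (fun n => n) by split=> // m; rewrite IfT.
move=> xn; apply: (proj2 (count_sub_lt n (rankP x) idc _ _ _) x) => //.
by split=> // -[].
Qed.

Let rank_inj x y n : x < n -> y < n -> rank x n = rank y n -> x = y.
Proof.
move=> xn yn e; apply: contrapT => ne; case: (rl_total x y) => h.
  by have := @rank_lt x y n (conj h ne) xn; rewrite e; mlra.
have ne' : y <> x by move/esym.
by have := @rank_lt y x n (conj h ne') yn; rewrite e; mlra.
Qed.

(** Inverse of the rank: below n the ranks are distinct and less than n, so each p < n is attained.
    The argument [z] packs n and p. *)
Let elt_ex : exists e, Fun1 e /\ forall z,
  (pi2 z < pi1 z -> e z < pi1 z /\ rank (e z) (pi1 z) = pi2 z) /\
  forall y, y < e z -> ~ (pi2 z < pi1 z -> y < pi1 z /\ rank y (pi1 z) = pi2 z).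
Proof.
apply: (@Rel2_mu N (fun z x => pi2 z < pi1 z -> x < pi1 z /\ rank x (pi1 z) = pi2 z)).
  by d1.
move=> z; case: (pselect (pi2 z < pi1 z)) => h; last by exists 0.
have [|||x [xn e]] := @inj_onto N (fun x => rank x (pi1 z)) (pi1 z) (pi2 z) _ _ _ h.
- by d1.
- by move=> x; apply: rank_bound.
- by move=> x y; apply: rank_inj.
by exists x.
Qed.
Let elt n p := projT1 (cid elt_ex) (pr n p).
Let Fun2_elt : Fun2 elt.
Proof. by rewrite /elt; case: (cid elt_ex) => e [Fe _] /=; d1. Qed.
Let eltP n p : p < n -> elt n p < n /\ rank (elt n p) n = p.
Proof.
rewrite /elt; case: (cid elt_ex) => e [_ eP] /=.
by case: (eP (pr n p)); rewrite pi1_pr pi2_pr => h _; apply: h.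
Qed.

(** The intervals end at the values of [a], and [d k] is the length of a run. The factor from [a k]
    to [a (k + 1)] is 2^(2k + 3), enough room for [a k + 1] disjoint windows of length [d k]. *)
Let a k : M := exp2 ((k + 1) * (k + 1)).
Let d k : M := (k + 1) + (k + 1).
Let Fun1_a : Fun1 a. Proof. by rewrite /a; d1. Qed.
Let Fun1_d : Fun1 d. Proof. by rewrite /d; d1. Qed.

Let a_step k : (a k + 1) * d k <= a (k + 1).
Proof.
have -> : a (k + 1) = a k * (exp2 (k + k + 1 + 1 + 1)).
  by rewrite /a -exp2_add; congr (exp2 _); ring.
rewrite !exp2S exp2_add.
have h1 : a k + 1 <= a k + a k by have := exp2_gt0 ((k + 1) * (k + 1)); rewrite -/(a k); mlra.
have h2 : d k <= exp2 k + exp2 k by have := exp2_gt k; rewrite /d; mlra.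
have h3 := le_mul (or_intror (erefl (a k))) (le_sq (exp2 k)).
have := le_mul h1 h2; have := mle0x (a k * (exp2 k * exp2 k)); mlra.
Qed.

Let a_le i j : i < j -> a (i + 1) <= a j.
Proof. by move=> ij; apply: exp2_le; apply: le_mul; mlra. Qed.

Let in_window k w r : Prop := w * d k <= r /\ r < w * d k + d k.

Let window_uniq k w w' r : in_window k w r -> in_window k w' r -> w = w'.
Proof.
have no u u' : u < u' -> in_window k u r -> in_window k u' r -> False.
  move=> uu' [_ h] [h' _].
  have uu1 : u + 1 <= u' by mlra.
  by have := le_mul uu1 (or_intror (erefl (d k))); rewrite mulSx; mlra.
move=> h h'; case: (mlt_total w w') => [lt|[//|lt]].
  by case: (no _ _ lt h h').
by case: (no _ _ lt h' h).
Qed.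

(** By the pigeonhole principle one of the [a k + 1] windows of [d k]
    consecutive ranks in [[0, a (k + 1))] avoids the numbers below [a k]. *)
Let window_ex k : exists w, w * d k + d k <= a (k + 1) /\
  forall x, x < a k -> ~ in_window k w (rank x (a (k + 1))).
Proof.
apply: contrapT => no.
have fits w : w <= a k -> w * d k + d k <= a (k + 1).
  move=> wa; have wa1 : w + 1 <= a k + 1 by mlra.
  by have := a_step k; have := le_mul wa1 (or_intror (erefl (d k))); rewrite mulSx; mlra.
have [||f [Ff fP]] := @Rel2_mu N
  (fun w x => w <= a k -> x < a k /\ in_window k w (rank x (a (k + 1)))).
- by rewrite /in_window; d1.
- move=> w; case: (pselect (w <= a k)) => wa; last by exists 0 => /wa.
  apply: contrapT => now; apply: no; exists w; split; first exact: fits.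
  by move=> x xa inw; apply: now; exists x.
apply: (@php N f (a k)) => // [w wa|w w' wa wa' e].
  by have [/(_ wa) []] := fP w.
have [/(_ wa) [_ h] _] := fP w; have [/(_ wa') [_ h'] _] := fP w'.
by apply: window_uniq h _; rewrite e.
Qed.

Let W_ex : exists W : M -> M, Fun1 W /\ forall k,
  (W k * d k + d k <= a (k + 1) /\
   forall x, x < a k -> ~ in_window k (W k) (rank x (a (k + 1)))) /\ forall w, w < W k ->
  ~ (w * d k + d k <= a (k + 1) /\
   forall x, x < a k -> ~ in_window k w (rank x (a (k + 1)))).
Proof. by apply: Rel2_mu window_ex; rewrite /in_window; d1. Qed.
Let W := projT1 (cid W_ex).
Let Fun1_W : Fun1 W := proj1 (projT2 (cid W_ex)).
Let W_fits k : W k * d k + d k <= a (k + 1) := proj1 (proj1 (proj2 (projT2 (cid W_ex)) k)).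
Let W_avoids k x : x < a k -> ~ in_window k (W k) (rank x (a (k + 1))) :=
  proj2 (proj1 (proj2 (projT2 (cid W_ex)) k)) x.

(** Entry [p] of the run chosen in interval [k], listed in increasing [R]-order. *)
Let cell k p : M := elt (a (k + 1)) (W k * d k + p).
Let Fun2_cell : Fun2 cell. Proof. by rewrite /cell; d1. Qed.

Let cellP k p : p < d k ->
  cell k p < a (k + 1) /\ rank (cell k p) (a (k + 1)) = W k * d k + p.
Proof. by move=> pd; apply: eltP; have := W_fits k; mlra. Qed.

Let cell_ge k p : p < d k -> a k <= cell k p.
Proof.
move=> pd; have [_ e] := cellP pd; apply/nlt_le => /W_avoids; apply.
by rewrite e; split; have := mle0x p; mlra.
Qed.

Let cell_sl k p q : p < q -> q < d k -> sl (cell k p) (cell k q).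
Proof.
move=> pq qd; have [|_ e] := @cellP k p; first by mlra.
by have [_ e'] := cellP qd; apply: (@rank_sl _ _ (a (k + 1))); rewrite e e'; mlra.
Qed.

(** The elements of the window of block [k] are indistinguishable for a smaller
    number. *)
Let cell_above k x p q : x < a k -> p < d k -> q < d k ->
  rl x (cell k p) -> sl x (cell k q).
Proof.
move=> xa pd qd xp; have [_ e] := cellP pd; have [_ e'] := cellP qd.
apply: (@rank_sl _ _ (a (k + 1))); have := rank_le (a (k + 1)) xp; have := W_avoids xa.
rewrite /in_window e e' => h h'; apply/nle_lt => h''; apply: h; split; mlra.
Qed.

Let cell_below k x p q : x < a k -> p < d k -> q < d k ->
  rl (cell k p) x -> sl (cell k q) x.
Proof.
move=> xa pd qd xp; have [_ e] := cellP pd; have [_ e'] := cellP qd.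
apply: (@rank_sl _ _ (a (k + 1))); have := rank_le (a (k + 1)) xp; have := W_avoids xa.
rewrite /in_window e e' => h h'; apply/nle_lt => h''; apply: h; split; mlra.
Qed.

(** The first entry of the upper half of the run; ADS is applied to the order of these entries. *)
Let mid k : M := cell k (k + 1).
Let mid_d k : k + 1 < d k. Proof. by rewrite /d; mlra. Qed.

Let mid_lt i j : i < j -> mid i < a j.
Proof. by move=> /a_le h; have [h' _] := cellP (mid_d i); rewrite /mid; mlra. Qed.

Let mid_inj i j : mid i = mid j -> i = j.
Proof.
by case: (mlt_total i j) => [/mid_lt|[//|/mid_lt]] h e;
  [have := cell_ge (mid_d j)|have := cell_ge (mid_d i)]; rewrite -/(mid _); mlra.
Qed.

Let mid_order : exists R', (forall i j, mem N (pr i j) R' <-> rl (mid i) (mid j)) /\ is_linear R'.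
Proof.
have [|R' R'P] := @Rel1_set N (fun z => rl (mid (pi1 z)) (mid (pi2 z))).
  by rewrite /mid; d1.
have R'exp2 i j : mem N (pr i j) R' <-> rl (mid i) (mid j) by rewrite R'P pi1_pr pi2_pr.
exists R'; split=> //; split=> [i|]; first by apply/R'exp2.
split=> [i j|]; first by rewrite !R'exp2 => -[h h']; apply/mid_inj/rl_anti.
split=> [i j k|i j]; rewrite !R'exp2; last exact: rl_total.
by move=> [h h']; apply: rl_trans h h'.
Qed.

(** Index [p] of the future sequence will draw on run [nx p], the first run of [A] from [p] on. *)
Let next_ex A : is_unbounded A -> exists nx : M -> M, Fun1 nx /\
  (forall p, mem N (nx p) A /\ p <= nx p) /\ (forall p q, p <= q -> nx p <= nx q).
Proof.
move=> unb; have [||nx [Fnx nxP]] := @Rel2_mu N (fun p k => mem N k A /\ p <= k).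
- by d1.
- by move=> p; have [k [kA pk]] := unb p; exists k; split=> //; left.
exists nx; split=> //; split=> [p|p q pq]; first by case: (nxP p).
apply/nlt_le => lt; have [_ /(_ _ lt)] := nxP p; apply.
by have [[qA qn] _] := nxP q; split=> //; mlra.
Qed.

(** Inside one run the positions decide. For two runs, the middle of the earlier one is comparable
    in the same way with every entry of the later one, and its own half lies on the right side of
    that middle. *)
Lemma ads_set_seq : (forall R', is_linear R' -> exists A, ads_set R' A) ->
  exists F, ads_seq R F.
Proof.
have [R' [R'P linR']] := mid_order.
move=> /(_ R' linR') [A [/next_ex [nx [Fnx [nxP nx_mono]]] mono]].
case: mono => mono.
  (* Position [p] lies in the lower half of run [nx p]. *)
  have posd p : p < nx p + 1 by have [_] := nxP p; mlra.
  have [|F [funF FP]] := @Fun1_graph (fun p => cell (nx p) p); first by d1.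
  exists F; split=> //; left=> i j x y; rewrite !FP => -[ij [<- <-]].
  have jd : j < d (nx j) by have := posd j; rewrite /d; mlra.
  case: (nx_mono i j (or_introl ij)) => [lt|e]; last by rewrite e; apply: cell_sl.
  have mm : rl (mid (nx i)) (mid (nx j)).
    by apply/R'P/mono; [split; [case: (nxP i)|case: (nxP j)]|left].
  have h := cell_above (mid_lt lt) (mid_d (nx j)) jd mm.
  by apply: sl_rl_trans (cell_sl (posd i) (mid_d (nx i))) (proj1 h).
(* Here [sub p] is [nx p - p], so positions in the upper half descend as [p] grows within a run. *)
have [||sub [Fsub subP]] := @Rel2_mu N (fun p v => p + v = nx p).
- by d1.
- by move=> p; have [_ /mleP [v e]] := nxP p; exists v.
have {}subP p : p + sub p = nx p by case: (subP p).
have posd p : nx p + 1 + sub p < d (nx p).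
  by have := subP p; rewrite /d; have := mle0x p; mlra.
have [|F [funF FP]] := @Fun1_graph (fun p => cell (nx p) (nx p + 1 + sub p)); first by d1.
exists F; split=> //; right=> i j x y; rewrite !FP => -[ij [<- <-]].
suff [h ne] : sl (cell (nx j) (nx j + 1 + sub j)) (cell (nx i) (nx i + 1 + sub i)).
  by split=> // /esym.
case: (nx_mono i j (or_introl ij)) => [lt|e].
  have mm : rl (mid (nx j)) (mid (nx i)).
    by apply/R'P/mono; [split; [case: (nxP i)|case: (nxP j)]|left].
  have h := cell_below (mid_lt lt) (mid_d (nx j)) (posd j) mm.
  apply: sl_rl_trans h _.
  have [e|n0] : 0 = sub i \/ 0 < sub i by case: (mle0x (sub i)); [right|left].
    by rewrite -e addx0; apply: rlxx.
  have pos : nx i + 1 < nx i + 1 + sub i by mlra.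
  exact: proj1 (cell_sl pos (posd i)).
rewrite -e; apply: cell_sl; last exact: posd.
by have := subP i; have := subP j; rewrite e; mlra.
Qed.


End Windows.
End ADS.

(** * Cardinality and trees *)

Section Strings.
Variable N : rca.
Local Notation M := (dom N).
Implicit Types (x y z i j k n p q : M) (A B X T C : sets N).

Add Ring dom_ring5 : (dom_semiring N).

Definition stabilising C A : Prop := forall x, mem N x A -> exists y, mem N y A /\ x < y /\
  forall z, mem N z A /\ y <= z -> (mem N (pr x z) C <-> mem N (pr x y) C).

Definition card_is A n : Prop := exists G,
  (forall i x, mem N (pr i x) G -> i < n /\ mem N x A) /\
  (forall i, i < n -> exists x, mem N (pr i x) G) /\
  (forall i x y, mem N (pr i x) G /\ mem N (pr i y) G -> x = y) /\
  (forall x, mem N x A -> exists i, mem N (pr i x) G) /\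
  (forall i j x, mem N (pr i x) G /\ mem N (pr j x) G -> i = j).

Definition card_full A : Prop := forall n, exists B,
  (forall x, mem N x B -> mem N x A) /\ (exists b, forall x, mem N x B -> x < b) /\ card_is B n.

(** If no element exceeded [n], a subset with [n + 2] elements would inject the numbers up to
    [n + 1] into those up to [n]. *)
Lemma card_full_unbounded A : card_full A -> is_unbounded A.
Proof.
move=> full n; apply: contrapT => no.
have [B [BA [_ [G [GB [Gtot [_ [_ Ginj]]]]]]]] := full (n + 1 + 1).
have [||f [Ff fP]] := @Rel2_mu N (fun i x => i <= n + 1 -> mem N (pr i x) G).
- by d1.
- move=> i; case: (pselect (i <= n + 1)) => h; last by exists 0.
  by have [|x] := Gtot i; [apply/ltxS|exists x].
have {}fP i : i <= n + 1 -> mem N (pr i (f i)) G by case: (fP i).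
apply: (@php N f (n + 1)) => // [i ile|i j ile jle e].
  have [_ /BA fA] := GB _ _ (fP i ile).
  by apply/ltxS/nlt_le => nf; apply: no; exists (f i).
by apply: (Ginj i j (f i)); split; [exact: fP|rewrite e; exact: fP].
Qed.

(** [B] consists of the first [n] elements of [P], and the counting function is the inverse of the
    required bijection. *)
Lemma count_card (P : M -> Prop) (k : M -> M) n v : Rel1 P -> counts P k -> Fun1 k ->
  n <= k v -> exists B, (forall x, mem N x B -> P x /\ x < v) /\
    (exists b, forall x, mem N x B -> x < b) /\ card_is B n.
Proof.
move=> RP kP Fk nv.
have [|B BP] := @Rel1_set N (fun x => x < v /\ (P x /\ k x < n)); first by d1.
have [|G GP] := @Rel1_set N (fun z => k (pi2 z) = pi1 z /\ mem N (pi2 z) B); first by d1.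
have {}GP i x : mem N (pr i x) G <-> k x = i /\ mem N x B by rewrite GP pi1_pr pi2_pr.
exists B; split; first by move=> x /BP [xv [Px _]].
split; first by exists v => x /BP [].
exists G; split.
  by move=> i x /GP [<- xB]; split=> //; case/BP: xB => _ [].
split.
  move=> i iN; have [|y [yv [Py ky]]] := @count_onto _ P k kP Fk i v RP; first by mlra.
  by exists y; apply/GP; split=> //; apply/BP; rewrite ky.
split.
  move=> i x y [/GP [kx /BP [_ [Px _]]] /GP [ky /BP [_ [Py _]]]].
  by apply: (count_inj kP Fk Px Py); rewrite kx.
split; first by move=> x xB; exists (k x); apply/GP.
by move=> i j x [/GP [<- _] /GP [<- _]].
Qed.

(** Position [i] of the string of length [n] with code [c]: the leading bit of
    [c] marks the end of the string and the first entry is the next bit. *)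
Definition entry n c i : Prop := exists j, j <= n /\ (i + j + 1 = n /\ Bit j c).

Definition is_string n c : Prop := exp2 n <= c /\ c < exp2 n + exp2 n.

Lemma Rel3_entry : Rel3 entry.
Proof. by rewrite /entry; d1. Qed.

(** Appending a digit moves the old bits up by one, but also moves the end of the string by one. *)
Lemma entryS n c b i : b <= 1 -> i < n -> entry (n + 1) (c + c + b) i <-> entry n c i.
Proof.
move=> b1 /lt_ex [z ->]; split=> -[j [_ [e bj]]].
  have ej : j = z + 1 by mlra.
  rewrite ej Bit_double // in bj; exists z; split=> //; first by have := mle0x i; mlra.
have ej : j = z by mlra.
rewrite {}ej in bj e; exists (z + 1); split; first by have := mle0x i; mlra.
by split; [mlra|apply/Bit_double].
Qed.

Lemma entry_last1 n c : entry (n + 1) (c + c + 1) n.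
Proof. by exists 0; split; [apply: mle0x|split; [rewrite addx0|apply: Bit_odd]]. Qed.

Lemma entry_last0 n c : ~ entry (n + 1) (c + c) n.
Proof.
move=> [j [_ [e]]]; have -> : j = 0 by mlra.
exact: Bit_even.
Qed.

(** Entries are bits in reverse order: the reversed predicate is coded and [exp2 n] added as leading
    digit. *)
Lemma string_ex (P : M -> Prop) n : Rel1 P ->
  exists c, is_string n c /\ forall i, i < n -> (entry n c i <-> P i).
Proof.
move=> RP; have [|c [cn cP]] :=
  @code_ex N (fun j => exists i, i <= n /\ (i + j + 1 = n /\ P i)) n; first by d1.
exists (c + exp2 n); split; first by split; have := mle0x c; mlra.
move=> i iN; split=> [[j [_ [e bj]]]|Pi].
  have jn : j < n by have := mle0x i; mlra.
  move: bj; rewrite Bit_add // cP // => -[i' [_ [e' Pi]]].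
  by have -> : i = i' by mlra.
have /lt_ex [z e] := iN.
have zn : z < n by have := mle0x i; rewrite e; mlra.
exists z; split; first by left.
split=> //; apply/Bit_add => //; apply/cP => //.
by exists i; split; [left|].
Qed.

Definition is_tree T : Prop := ~ mem N 0 T /\
  forall c, 0 < c -> (mem N (c + c) T \/ mem N (c + c + 1) T) -> mem N c T.

Definition is_path T X : Prop := exists G,
  (is_fun G /\ mem N (pr 0 1) G /\
   forall n c, mem N (pr n c) G ->
     (mem N n X -> mem N (pr (n + 1) (c + c + 1)) G) /\
     (~ mem N n X -> mem N (pr (n + 1) (c + c)) G)) /\
  forall n c, mem N (pr n c) G -> mem N c T.

Lemma is_string_uniq n m c : is_string n c -> is_string m c -> n = m.
Proof.
move=> [h1 h2] [h3 h4].
by case: (mlt_total n m) => [/exp2_lt|[//|/exp2_lt]] h; mlra.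
Qed.

(** Weak Koenig's Lemma for a condition on strings. A code determines the length of its string, so
    the condition can be read back from membership in the tree. *)
Lemma wkl_strings (Th : M -> M -> Prop) :
  (forall T, is_tree T /\ is_unbounded T -> exists X, is_path T X) -> Rel2 Th ->
  (forall n c b, b <= 1 -> is_string n c -> Th (n + 1) (c + c + b) -> Th n c) ->
  (forall n, exists c, is_string n c /\ Th n c) ->
  exists X, forall n, exists c, Th n c /\ forall i, i < n -> (entry n c i <-> mem N i X).
Proof.
move=> wkl RTh down ex.
have [|T TP] := @Rel1_set N (fun c => exists n, n <= c /\ (is_string n c /\ Th n c)).
  by rewrite /is_string; d1.
have {}TP c : mem N c T <-> exists n, is_string n c /\ Th n c.
  rewrite TP; split=> [[n [_ h]]|[n [[h h'] th]]]; first by exists n.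
  by exists n; split=> //; have := exp2_gt n; mlra.
have step c b : 0 < c -> b <= 1 -> mem N (c + c + b) T -> mem N c T.
  move=> c0 b1 /TP [m [[h h'] th]]; apply/TP.
  case: (mle0x m) => [/lt_ex [n me]|m0]; last by rewrite -m0 exp2_0 in h h'; mlra.
  rewrite me add0x in h h' th; rewrite exp2S in h h'.
  have str : is_string n c by split; [apply/nlt_le => lt; mlra|apply/nle_lt => le; mlra].
  by exists n; split=> //; apply: down th.
have [|X [G [[funG [G0 GS]] GT]]] := wkl T.
  split; first split.
  - by move=> /TP [n [[h _] _]]; have := exp2_gt0 n; mlra.
  - by move=> c c0 [] h; [apply: (step c 0) => //; rewrite ?addx0 //; apply: mle0x|apply: (step c 1) => //; right].
  - move=> n; have [c [str th]] := ex n; exists c; split; first by apply/TP; exists n.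
    by case: str => h _; have := exp2_gt n; mlra.
have [g [Fg gG]] := is_funP funG.
have g0 : g 0 = 1 by apply/gG.
have gS1 n : mem N n X -> g (n + 1) = g n + g n + 1.
  by move=> nX; apply/gG; have [h _] := GS n (g n) (proj2 (gG _ _) erefl); apply: h.
have gS0 n : ~ mem N n X -> g (n + 1) = g n + g n.
  by move=> nX; apply/gG; have [_ h] := GS n (g n) (proj2 (gG _ _) erefl); apply: h.
have str : forall n, is_string n (g n).
  apply: Rel1_ind; first by rewrite /is_string; d1.
    by rewrite /is_string g0 exp2_0; split; [right|mlra].
  move=> n [h h']; rewrite /is_string exp2S; case: (pselect (mem N n X)) => nX.
    by rewrite gS1 //; split; mlra.
  by rewrite gS0 //; split; mlra.
exists X => n; exists (g n); split.
  have /TP [m [strm thm]] := GT n (g n) (proj2 (gG _ _) erefl).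
  by rewrite -(is_string_uniq (str n) strm) in thm.
have RE := Rel3_entry.
move: n; apply: Rel1_ind; first by d1.
  by move=> i /mltx0.
move=> n IH i; case: (pselect (mem N n X)) => nX /ltxS [iN|->].
- by rewrite gS1 // entryS //; [apply: IH|right].
- by rewrite gS1 //; split=> // _; apply: entry_last1.
- by rewrite gS0 // -[g n + g n]addx0 entryS //; [apply: IH|apply: mle0x].
- by rewrite gS0 //; split=> // /entry_last0.
Qed.

End Strings.

(** * CRT *)

Section CRT.
Variable N : rca.
Local Notation M := (dom N).
Implicit Types (x y z i j n p q : M) (A B X T C : sets N).

Add Ring dom_ring6 : (dom_semiring N).

(** Greedy selection: [L n] is the last element selected below [n], or 0 if there is none, and [i]
    is selected when it lies far enough beyond [L i]. Since [L n] never exceeds [n], bounded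
    recursion applies. *)
Lemma sparse_subset A (f : M -> M) (b : M) : is_unbounded A -> Fun1 f ->
  (forall x y, x <= y -> f x <= f y) -> exists (S : M -> Prop) (L : M -> M),
  [/\ Rel1 S, Fun1 L, forall a, S a -> mem N a A /\ b <= a,
   forall a a', S a -> S a' -> a < a' -> f a <= a' &
   [/\ forall n, exists a, S a /\ n < a,
     forall n, L n = 0 \/ S (L n) /\ L n < n &
     forall n a, S a -> a < n -> a <= L n]].
Proof.
move=> unb Ff mono.
pose good i u := mem N i A /\ (b <= i /\ f u <= i).
have Rg : Rel2 good by rewrite /good; d1.
have [||F [FF FP]] := @bounded_recursion N (fun x i u => If (good i u) i u).
- by d1.
- by move=> x n u un; case: (pselect (good n u)) => h; [rewrite IfT|rewrite IfF] => //; mlra.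
pose L := F 0; have FL : Fun1 L by rewrite /L; d1.
have L0 : L 0 = 0 by case: (FP 0).
pose S i := good i (L i).
have LT n : S n -> L (n + 1) = n by move=> h; have [_ h'] := FP 0; rewrite /L (proj1 (h' n)) IfT.
have LF n : ~ S n -> L (n + 1) = L n by move=> h; have [_ h'] := FP 0; rewrite /L (proj1 (h' n)) IfF.
have RS : Rel1 S by rewrite /S; d1.
have L_in : forall n, L n = 0 \/ S (L n) /\ L n < n.
  apply: Rel1_ind; [by d1|by left|move=> n IH].
  case: (pselect (S n)) => h; first by rewrite LT //; right; split=> //; mlra.
  by rewrite LF //; case: IH => [|[? ?]]; [left|right; split=> //; mlra].
have L_max : forall n a, S a -> a < n -> a <= L n.
  move=> n a Sa; move: n; apply: Rel1_ind; [by d1|by move/mltx0|move=> n IH].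
  case: (pselect (S n)) => h; first by rewrite LT // => /ltxS.
  by rewrite LF // => /ltxS [|e] //; case: h; rewrite -e.
exists S, L; split=> //; first by move=> a [? [? _]].
  move=> a a' Sa Sa' aa'; have [_ [_ h]] := Sa'.
  by have := mono _ _ (L_max _ _ Sa aa'); mlra.
split=> // n; apply: contrapT => no.
(* If nothing were selected beyond [n], [L] would stay constant, and a large enough element of [A]
   would qualify. *)
have stop : forall m, L (n + 1 + m) = L (n + 1).
  apply: Rel1_ind; [by d1|by rewrite addx0|move=> m IH].
  rewrite addxS LF // => h; apply: no; exists (n + 1 + m); split=> //.
  by have := mle0x m; mlra.
have [i [iA lt]] := unb (n + 1 + b + f (L (n + 1))).
have [m im] : exists m, i = n + 1 + m by apply/mleP; have := mle0x b; have := mle0x (f (L (n + 1))); mlra.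
apply: no; exists i; split; last by have := mle0x b; have := mle0x (f (L (n + 1))); mlra.
split=> //; split; first by have := mle0x n; have := mle0x (f (L (n + 1))); mlra.
by rewrite im stop -im; have := mle0x n; have := mle0x b; mlra.
Qed.

Lemma code_fun (P : M -> M -> Prop) (l : M -> M) : Rel2 P -> Fun1 l ->
  exists F : M -> M, Fun1 F /\ forall x, F x < exp2 (l x) /\
    forall i, i < l x -> (Bit i (F x) <-> P x i).
Proof.
move=> RP Fl; have [||F [FF FP]] := @Rel2_mu N
  (fun x c => c < exp2 (l x) /\ forall i, i < l x -> (Bit i c <-> P x i)).
- by d1.
- by move=> x; apply: code_ex; d1.
by exists F; split=> // x; case: (FP x).
Qed.

(** * Colourings on the blocks cut out by a sparse set *)

Section Blocks.
Variables (A C : sets N) (cnt : M -> M) (b : M).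
Hypotheses (cntA : counts (fun x => mem N x A) cnt)
  (Fcnt : Fun1 cnt) (cnt_lt : forall n, cnt n < b).

(** [S] is the set of the left ends of the blocks, [next a] the right end of the
    block of [a] and [blk x] the left end of the block of [x]. *)
Variables (S : M -> Prop) (next blk : M -> M).
Hypotheses (RS : Rel1 S) (Fnext : Fun1 next) (Fblk : Fun1 blk).
Hypothesis S_A : forall a, S a -> mem N a A /\ b <= a.
Hypothesis next_big : forall a, S a -> a + a * exp2 a * exp2 a < next a.
Hypothesis blkP : forall a y, S a -> (a <= y /\ y < next a <-> blk y = a).
Hypothesis blk_mono : forall y z, y <= z -> blk y <= blk z.
Hypothesis S_unb : forall n, exists a, S a /\ n < a.
Hypothesis blk_S : forall y, blk y = 0 \/ S (blk y).

Let col x y : Prop := mem N (pr x y) C.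
Let Rel2_col : Rel2 col. Proof. by rewrite /col; d1. Qed.

Let b_gt0 : 0 < b.
Proof. by have := cnt_lt 0; have := mle0x (cnt 0); mlra. Qed.

Let S_gt0 a : S a -> 0 < a.
Proof. by move=> /S_A [_]; have := b_gt0; mlra. Qed.

(** In each block, the elements with the most frequent pattern of colours towards
    the numbers below the block. *)
Let homog_ex : exists (D : M -> M -> Prop) (K : M -> M -> M),
  [/\ Rel2 D, Fun2 K, forall a, counts (D a) (K a),
   forall a y, D a y -> a <= y &
   (forall a, S a -> a * exp2 a < K a (next a)) /\
   forall a y y' x, S a -> D a y -> D a y' -> x < a -> (col x y <-> col x y')].
Proof.
have [||F [FF FP]] := @code_fun (fun z i => col i (pi2 z)) (@pi1 N); [by d1|by d1|].
pose pat a y := F (pr a y).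
have Fpat : Fun2 pat by rewrite /pat; d1.
have pat_lt a y : pat a y < exp2 a by have [h _] := FP (pr a y); rewrite pi1_pr in h.
have patP a y i : i < a -> (Bit i (pat a y) <-> col i y).
  by have [_ h] := FP (pr a y); rewrite pi1_pr pi2_pr in h; apply: h.
have [|K1 [FK1 K1P]] := @count_ex N (fun z y => pi1 z <= y /\ pat (pi1 z) y = pi2 z); first by d1.
have K1aq a q : counts (fun y => a <= y /\ pat a y = q) (K1 (pr a q)).
  by have := K1P (pr a q); rewrite pi1_pr pi2_pr.
have [||q1 [Fq1 q1P]] := @Rel2_mu N (fun a q => S a -> q < exp2 a /\ a * exp2 a < K1 (pr a q) (next a)).
- by d1.
- move=> a; case: (pselect (S a)) => Sa; last by exists 0.
  apply: contrapT => no.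
  have [|kD [FkD kDP]] := @count1_ex N (fun y => a <= y); first by d1.
  (* A block exceeds [a * exp2 a * exp2 a] elements, so one of the [exp2 a] patterns occurs more
     than [a * exp2 a] times. *)
  have tail : forall n, n <= a + kD n.
    apply: Rel1_ind; [by d1|by apply: mle0x|move=> n IH].
    case: (pselect (a <= n)) => h; first by rewrite (countST kDP) //; mlra.
    by rewrite (countSF kDP) //; have := mle0x (kD n); mlra.
  have := @pigeonhole N (fun y => a <= y) (pat a) kD (fun q => K1 (pr a q)) (a * exp2 a) (exp2 a) (next a).
  have := next_big Sa; have := tail (next a); move=> h1 h2 ph.
  suff : kD (next a) <= a * exp2 a * exp2 a by mlra.
  apply: ph => //; try by d1.
  move=> q qE; apply/nlt_le => lt; apply: no; exists q => _; by split.
exists (fun a y => a <= y /\ pat a y = q1 a), (fun a => K1 (pr a (q1 a))); split=> //.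
- by d1.
- by d1.
- by move=> a y [].
split; first by move=> a Sa; have [/(_ Sa) []] := q1P a.
by move=> a y y' x Sa [_ e] [_ e'] xa; rewrite -!(patP a) // e e'.
Qed.

(** Since the blocks below [l] are indexed by numbers below [b], a block has at
    most [exp2 b] patterns of colours towards the later blocks below [l]. *)
Let grouping l : exists X : M -> Prop, Rel1 X /\
  (forall a, S a -> exists k, [/\ Fun1 k, counts (fun y => a <= y /\ X y) k & a <= k (next a)]) /\
  (forall x x' y y', X x -> X x' -> X y -> X y' -> y < l -> blk x = blk x' -> blk y = blk y' ->
     blk x < blk y -> (col x y <-> col x' y')).
Proof.
have [D [K [RD FK KP D_ge [K_big homog]]]] := homog_ex.
have [||rep [Frep repP]] := @Rel2_mu N (fun a y => S a -> y < next a /\ D a y).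
- by d1.
- move=> a; case: (pselect (S a)) => Sa; last by exists 0.
  have [|||y [yn [Dy _]]] := @count_onto N (D a) (K a) (KP a) _ 0 (next a).
  + by d1.
  + by d1.
  + by have := K_big a Sa; have := mle0x (a * exp2 a); mlra.
  by exists y.
(* Bit j of a pattern is the colour towards the representative of the later block counted j by
   [cnt]. Since [cnt] stays below [b], patterns have [b] bits for every [l]. *)
have [||F [FF FP]] := @code_fun (fun z j => exists a, a < l /\
    (S a /\ (pi1 z < a /\ (cnt a = j /\ col (pi2 z) (rep a))))) (fun _ => b); [by d1|by d1|].
pose pat a y := F (pr a y).
have Fpat : Fun2 pat by rewrite /pat; d1.
have patP a y a' : S a' -> a < a' -> a' < l ->
    (Bit (cnt a') (pat a y) <-> col y (rep a')).
  have [_ h] := FP (pr a y) => Sa' aa' a'l; rewrite h // pi1_pr pi2_pr.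
  split=> [[u [_ [Su [_ [e]]]]]|cy]; last by exists a'.
  by rewrite (count_inj cntA Fcnt (proj1 (S_A Su)) (proj1 (S_A Sa')) e).
have [|K2 [FK2 K2P]] := @count_ex N (fun z y => D (pi1 z) y /\ pat (pi1 z) y = pi2 z); first by d1.
have K2aq a q : counts (fun y => D a y /\ pat a y = q) (K2 (pr a q)).
  by have := K2P (pr a q); rewrite pi1_pr pi2_pr.
have [||q2 [Fq2 q2P]] := @Rel2_mu N (fun a q => S a -> a < K2 (pr a q) (next a)).
- by d1.
- move=> a; case: (pselect (S a)) => Sa; last by exists 0.
  apply: contrapT => no.
  have := @pigeonhole N (D a) (pat a) (K a) (fun q => K2 (pr a q)) a (exp2 b) (next a).
  (* As [b <= a], more than [a * exp2 b] elements are available, so some pattern keeps more than [a]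
     of them. *)
  have := K_big a Sa; have := le_mul (or_intror (erefl a)) (exp2_le (proj2 (S_A Sa))).
  move=> h1 h2 ph; suff : K a (next a) <= a * exp2 b by mlra.
  apply: ph => //; try by d1.
    by move=> y _ _; case: (FP (pr a y)).
  by move=> q qE; apply/nlt_le => lt; apply: no; exists q.
pose X y := S (blk y) /\ (D (blk y) y /\ pat (blk y) y = q2 (blk y)).
exists X; split; first by rewrite /X; d1.
split=> [a Sa|x x' y y' [Sx [Dx px]] [Sx' [Dx' px']] [Sy [Dy py]] [Sy' [Dy' py']] yl ex ey lt].
  have [|k [Fk kP]] := @count1_ex N (fun y => a <= y /\ X y); first by rewrite /X; d1.
  exists k; split=> //; have [/(_ Sa) h _] := q2P a.
  rewrite (count_ext kP (K2aq a (q2 a))) //; [by left|by d1|].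
  move=> y yn; rewrite /X; split=> [[ay]|[Dy py]].
    have -> : blk y = a by apply/(blkP y Sa).
    by case.
  have -> : blk y = a by apply/(blkP y Sa); split=> //; apply: D_ge Dy.
  by split=> //; apply: D_ge Dy.
have blk_le z : S (blk z) -> blk z <= z by move=> Sz; case: (proj2 (blkP z Sz) erefl).
have block z a : S (blk z) -> blk z < a -> S a -> z < a.
  move=> Sz za Sa; apply/nle_lt => az; have := blk_mono az.
  have -> : blk a = a; last by mlra.
  by apply/blkP => //; split; [right|have := next_big Sa; have := mle0x (a * exp2 a * exp2 a); mlra].
(* Homogeneity replaces [t] by the representative of its block; the pattern of [z], which is the
   same throughout its thinned block, then gives the colour. *)
have byrep z t : S (blk z) -> D (blk z) z -> S (blk t) -> D (blk t) t -> blk z < blk t ->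
    blk t < l -> (col z t <-> Bit (cnt (blk t)) (pat (blk z) z)).
  move=> Sz Dz St Dt zt tl; rewrite patP //.
  apply: (homog (blk t)) => //; last exact: block.
  by have [/(_ St) []] := repP (blk t).
have yl' : blk y < l by have := blk_le y Sy; mlra.
have h := byrep x y Sx Dx Sy Dy lt yl'; have h' := byrep x' y' Sx' Dx' Sy' Dy'.
by rewrite h h' -?ex -?ey // px ex px' -ex.
Qed.


Hypothesis wkl : forall T, is_tree T /\ is_unbounded T -> exists X, is_path T X.

(** The sets from [grouping] handle colours below a bound [l] and may change with [l]. They supply
    strings of every length for a tree, and a path handles all blocks at once. *)
Let block_set : exists X,
  (forall a, S a -> exists k,
     [/\ Fun1 k, counts (fun y => a <= y /\ mem N y X) k & a <= k (next a)]) /\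
  (forall x x' y y', mem N x X -> mem N x' X -> mem N y X -> mem N y' X ->
     blk x = blk x' -> blk y = blk y' -> blk x < blk y -> (col x y <-> col x' y')).
Proof.
have RE := @Rel3_entry N.
have [|K [FK KP]] := @count_ex N
  (fun z y => pi1 z <= y /\ entry (pi1 (pi2 z)) (pi2 (pi2 z)) y); first by d1.
have {}KP a n c : counts (fun y => a <= y /\ entry n c y) (K (pr a (pr n c))).
  by have := KP (pr a (pr n c)); rewrite !(pi1_pr, pi2_pr).
(* Size is demanded only of blocks that end by [n], so that shorter strings inherit the
   condition. *)
pose Th n c := (forall a, a <= n -> S a -> next a <= n -> a <= K (pr a (pr n c)) (next a)) /\
  (forall x, x < n -> forall x', x' < n -> forall y, y < n -> forall y', y' < n ->
     entry n c x -> entry n c x' -> entry n c y -> entry n c y' ->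
     blk x = blk x' -> blk y = blk y' -> blk x < blk y -> (col x y <-> col x' y')).
have RTh : Rel2 Th by rewrite /Th; d1.
have [|n|X XP] := wkl_strings wkl RTh.
- move=> n c e e1 _ [size colour]; split=> [a an Sa nn|x xn x' xn' y yn y' yn' hx hx' hy hy'].
    have <- : K (pr a (pr (n + 1) (c + c + e))) (next a) = K (pr a (pr n c)) (next a).
      apply: (count_ext (KP _ _ _) (KP _ _ _)); [by d1|by d1|move=> y yn].
      by rewrite entryS //; mlra.
    by apply: size => //; mlra.
  by apply: colour; rewrite ?entryS //; mlra.
- have [X [RX [size colour]]] := grouping n.
  have [c [str cX]] := string_ex n RX; exists c; split=> //; split.
    move=> a an Sa nn; have [k [Fk kP ak]] := size a Sa.
    rewrite (count_ext (KP _ _ _) kP) //; first by d1.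
    by move=> y yn; rewrite cX //; mlra.
  move=> x xn x' xn' y yn y' yn'; rewrite !cX // => hx hx' hy hy'; exact: colour.
exists X; split=> [a Sa|x x' y y' hx hx' hy hy' ex ey lt].
  have [|k [Fk kP]] := @count1_ex N (fun y => a <= y /\ mem N y X); first by d1.
  exists k; split=> //; have [c [[size _] cX]] := XP (next a).
  rewrite (count_ext kP (KP a (next a) c)) //; first by apply: size; [have := next_big Sa; have := mle0x (a * exp2 a * exp2 a); mlra|done|right].
    by d1.
  by move=> y yn; rewrite cX.
have [c [[_ colour] cX]] := XP (x + x' + y + y' + 1).
have := (mle0x x, mle0x x', mle0x y, mle0x y') => -[[[x0 x0'] y0] y0'].
by apply: colour => //; rewrite ?cX //; mlra.
Qed.

(** CRT is applied to the colouring through representatives of blocks. [Y] collects the thinned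
    blocks that meet its solution [D]; arbitrarily late, hence arbitrarily large, ones occur. *)
Lemma blocks_crt : (forall C', exists D, is_unbounded D /\ stabilising C' D) ->
  exists Y, card_full Y /\ stabilising C Y.
Proof.
move=> crt; have [X [size colour]] := block_set.
have [||rep [Frep repP]] := @Rel2_mu N (fun a y => S a -> mem N y X /\ blk y = a).
- by d1.
- move=> a; case: (pselect (S a)) => Sa; last by exists 0.
  have [k [Fk kP ak]] := size a Sa.
  have [||y [yn [[ay yX] _]]] := @count_onto N _ k kP Fk 0 (next a).
  + by d1.
  + by have := S_gt0 Sa; mlra.
  by exists y => _; split=> //; apply/(blkP y Sa).
have {}repP a : S a -> mem N (rep a) X /\ blk (rep a) = a by case: (repP a).
have [|C' C'P] := @Rel1_set N (fun z => col (rep (blk (pi1 z))) (rep (blk (pi2 z)))); first by d1.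
have {}C'P u v : mem N (pr u v) C' <-> col (rep (blk u)) (rep (blk v)).
  by rewrite C'P pi1_pr pi2_pr.
have [D [unbD stabD]] := crt C'.
have [|Y YP] := @Rel1_set N (fun x => mem N x X /\ (S (blk x) /\
   exists u, u < next (blk x) /\ (mem N u D /\ blk u = blk x))); first by d1.
have blk_le y : S (blk y) -> blk y <= y by move=> Sy; case: (proj2 (blkP y Sy) erefl).
have next_gt a : S a -> a < next a.
  by move=> Sa; have := next_big Sa; have := mle0x (a * exp2 a * exp2 a); mlra.
have blkS a : S a -> blk a = a.
  by move=> Sa; apply/(blkP a Sa); split; [right|apply: next_gt].
have far n : exists u, mem N u D /\ (n < blk u /\ S (blk u)).
  have [a [Sa na]] := S_unb n; have [u [uD au]] := unbD a.
  have le : a <= blk u by rewrite -(blkS a Sa); apply: blk_mono; left.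
  exists u; split=> //; split; first by mlra.
  by case: (blk_S u) => // e; have := S_gt0 Sa; mlra.
exists Y; split=> [n|x /YP [xX [Sx [u [_ [uD ux]]]]]].
  have [u [uD [nu Su]]] := far n; have [k [Fk kP uk]] := size _ Su.
  have [||B [BP [Bfin Bcard]]] := @count_card N _ k n (next (blk u)) _ kP Fk.
  - by d1.
  - by mlra.
  exists B; split=> // y /BP [[uy yX] yn]; apply/YP.
  have -> : blk y = blk u by apply/(blkP y Su).
  by split=> //; split=> //; exists u; split=> //; case: (proj2 (blkP u Su) erefl).
have [y [yD [uy stab]]] := stabD u uD.
have [y' [y'D [yy' Sy']]] := far y.
have [wX wy'] := repP _ Sy'.
have le := blk_le u; rewrite ux in le; have {}le := le Sx.
have above t : blk y' <= blk t -> blk x < blk t by mlra.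
(* A late [z] shares its block with some [v] in [D]. The colour of [x] and [z] is that of [u] and
   [v] under [C'], which is stable because [v] is beyond [y]. *)
have key z : mem N z X -> blk y' <= blk z -> S (blk z) ->
    (exists v, mem N v D /\ blk v = blk z) -> (col x z <-> mem N (pr u y) C').
  move=> zX yz Sz [v [vD vz]].
  have vy : y <= v by have := blk_le v; rewrite vz => /(_ Sz); mlra.
  rewrite -(stab v (conj vD vy)) C'P ux vz.
  have [rxX rx] := repP _ Sx; have [rzX rz] := repP _ Sz.
  by apply: colour => //; rewrite ?rx ?rz //; apply: above.
exists (rep (blk y')); split; last split.
- apply/YP; rewrite wy'; split=> //; split=> //; exists y'; split=> //.
  by case: (proj2 (blkP y' Sy') erefl).
- apply/nle_lt => /blk_mono; rewrite wy'; mlra.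
move=> z [/YP [zX [Sz [v [_ [vD vz]]]]] /blk_mono wz]; rewrite wy' in wz.
rewrite -/(col _ _) -/(col x (rep _)) !key ?wy' //; [by right|by exists y'|by exists v].
Qed.

End Blocks.

Lemma crt_full (C : sets N) :
  (forall T, is_tree T /\ is_unbounded T -> exists X, is_path T X) ->
  (forall C', exists D, is_unbounded D /\ stabilising C' D) ->
  exists Y, card_full Y /\ stabilising C Y.
Proof.
move=> wkl crt.
case: (pselect (forall A, is_unbounded A -> card_full A)) => [full|].
  by have [D [/full unbD stabD]] := crt C; exists D.
move=> /existsNP [A] /not_implyP [unbA /existsNP [b nb]].
have [|cnt [Fcnt cntA]] := @count1_ex N (fun x => mem N x A); first by d1.
(* A count of [b] would produce a bounded subset of size [b], which [nb] excludes. *)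
have cnt_lt n : cnt n < b.
  apply/nle_lt => le; apply: nb.
  have [|B [BP BF]] := @count_card N _ cnt b n _ cntA Fcnt le; first by d1.
  by exists B; split=> // x /BP [].
pose f a : M := a + a * exp2 a * exp2 a + 1.
have [||S [L [RS FL S_A sparse [S_unb L_in L_max]]]] := @sparse_subset A f b unbA.
- by rewrite /f; d1.
- move=> x y xy; have h := exp2_le xy; have := le_mul (le_mul xy h) h; rewrite /f; mlra.
have [||next [Fnext nextP]] := @Rel2_mu N (fun a y => a < y /\ S y).
- by d1.
- by move=> a; have [y [Sy ay]] := S_unb a; exists y.
have next_le a y : S y -> a < y -> next a <= y.
  by move=> Sy ay; apply/nlt_le => lt; case: (nextP a) => _ /(_ y lt); apply.
have b_gt0 : 0 < b by have := cnt_lt 0; have := mle0x (cnt 0); mlra.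
(* The block of y starts at the last left end up to y. Positivity of [b] keeps the default 0 of [L]
   apart from all left ends. *)
apply: (@blocks_crt A C cnt b cntA Fcnt cnt_lt S next (fun y => L (y + 1))) => //.
- by d1.
- move=> a Sa; have [[lt Sn] _] := nextP a; have := sparse _ _ Sa Sn lt; rewrite /f; mlra.
- move=> a y Sa; split=> [[ay yn]|e].
    have le : a <= L (y + 1) by apply: L_max => //; mlra.
    apply: mle_anti => //; apply/nlt_le => lt.
    case: (L_in (y + 1)) => [e|[SL Ly]]; first by rewrite e in lt; have := mle0x a; mlra.
    by have := next_le _ _ SL lt; mlra.
  case: (L_in (y + 1)) => [|[_]]; rewrite e => lt.
    by have [_] := S_A a Sa; rewrite lt; mlra.
  split; first by mlra.
  apply/nle_lt => le; have [[lt' Sn] _] := nextP a.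
  have := L_max (y + 1) _ Sn; rewrite e => h.
  have : next a <= a by apply: h; mlra.
  by mlra.
- move=> y z yz; case: (L_in (y + 1)) => [->|[SL Ly]]; first exact: mle0x.
  by apply: L_max => //; mlra.
- by move=> y; case: (L_in (y + 1)) => [|[]]; [left|right].
Qed.

End CRT.

(** * From validity in all models to provability of both equivalences *)

Theorem theorem4p8 :
  proves RCA0s (closed (fm_iff lADSsq ADS)) /\
  proves WKL0s (closed (fm_iff lCRT22 CRT22)).
Proof.
split; apply: completeness => [q sg rh|N NT v w].
- exact: RCA0s_subst.
(* Satisfaction unfolds to the principles about the model; the valuation itself supplies the set
   that [Rca] asks for. *)
- pose N' := Rca (w 0%N) NT; split=> principle R linR.
    have [F seqF] := principle R linR.
    exact: (@ads_seq_set N' R F linR seqF).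
  by apply: (@ads_set_seq N' R linR) => R' linR'; apply: principle.
- exact: WKL0s_subst.
have NR : satisfies N RCA0s by move=> p /WKL0s_RCA0s; apply: NT.
pose N' := Rca (w 0%N) NR; split=> principle C.
  have [A [full stab]] := principle C.
  by exists A; split=> //; apply: (@card_full_unbounded N' A full).
have wkl := NT _ WKL0s_WKL v w.
by apply: (@crt_full N' C) => [T treeT|C']; [apply: wkl|apply: principle].
Qed.
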